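(* Let $D\subset\mathbb{R}^n$ be a Greenian domain and let $\phi$ be a norming function on $D$. Let $\Phi(y)=\widetilde G_D(\cdot,y)=l(y)^{-1}G_D(\cdot,y)$ for $y\in D$, where $l(y)=\|G_D(\cdot,y)\|_\phi$; let $\widetilde D_\phi$ be the closure of $\Phi(D)$ in $L^1(D,\phi)$, and let $\partial_M D$ be the set of limits in $L^1(D,\phi)$ of sequences $\{\widetilde G_D(\cdot,y_j)\}$ such that $\{y_j\}$ has no accumulation points in $D$. Then $\widetilde D_\phi$ is homeomorphic to the Martin compactification of $D$, and (under this homeomorphism) $\partial_M D$ is the Martin boundary of $D$.
   Context: A domain is a nonempty connected open set; it is Greenian if for each $y\in D$ there is a Green function $G_D(\cdot,y)$. The Green function $G_D(x,y)$ is taken to be negative. ''Negative'' for functions means $\le 0$, and negative subharmonic functions are assumed not to be identically $-\infty$. For a positive continuous function $\phi$ on $D$, $L^1(D,\phi)$ is the Banach space of Lebesgue measurable functions $u$ on $D$ (modulo equality a.e.) with $\|u\|_\phi=\int_D|u|\,\phi\,dx<\infty$; for a measurable set $E\subset D$, $\|u\|_{L^1(E,\phi)}=\int_E|u|\,\phi\,dx$. A positive continuous function $\phi$ on $D$ is called norming if for each compact set $F\subset D$ there is a constant $C(F)>0$, and for every increasing sequence of subdomains $D_j$ relatively compact in $D$ with $\bigcup_j D_j=D$ there is a sequence of numbers $\varepsilon_j>0$ converging to $0$, such that for every negative subharmonic function $u$ on $D$: (1) $\|u\|_\phi<\infty$; (2) $u(x)\le -C(F)\|u\|_\phi$ for every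 $x\in F$; (3) $\|u\|_{L^1(D\setminus D_j,\phi)}\le\varepsilon_j\|u\|_\phi$ for every $j$. (The constants do not depend on $u$.) Martin compactification: fix $x_0\in D$ and let $m(y)=G_D(x_0,y)$. The Martin compactification of $D$ is obtained by adding to $D$ the Martin boundary, i.e. all equivalence classes of sequences of functions $m(y_j)^{-1}G_D(\cdot,y_j)$ that converge uniformly on compacta of $D$, where $\{y_j\}$ has no accumulation points in $D$ (two such sequences being equivalent if they have the same limit), with the usual Martin topology: it is the compact metrizable space containing $D$ as an open dense subspace for which the functions $y\mapsto m(y)^{-1}G_D(x,y)$, $x\in D$, extend continuously (with values in $[0,\infty]$) to the boundary points and separate the boundary points. *)

(* Defs.v *)
From HB Require Import structures.
From mathcomp Require Import all_boot all_order all_algebra.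
From mathcomp Require Import all_classical all_reals all_analysis measurable_realfun.
Import Order.TTheory GRing.Theory Num.Theory numFieldNormedType.Exports.
Set Implicit Arguments. Unset Strict Implicit. Unset Printing Implicit Defensive.
Local Open Scope classical_set_scope.
Local Open Scope ring_scope.

Definition rV_display : measure_display. Proof. exact. Qed.

Section measurable_rV.
Variables (R : realType) (n : nat).

Definition rV_coord (i : 'I_n) (v : 'rV[R]_n) : measurableTypeR R := v ord0 i.

Let rV_set0 : g_sigma_preimage rV_coord set0.
Proof. exact: sigma_algebra0. Qed.

Let rV_setC A : g_sigma_preimage rV_coord A -> g_sigma_preimage rV_coord (~` A).
Proof. exact: sigma_algebraC. Qed.

Let rV_bigcup (F : _^nat) : (forall i, g_sigma_preimage rV_coord (F i)) ->
  g_sigma_preimage rV_coord (\bigcup_i (F i)).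
Proof. exact: sigma_algebra_bigcup. Qed.

HB.instance Definition _ := @isMeasurable.Build rV_display
  'rV[R]_n (g_sigma_preimage rV_coord) rV_set0 rV_setC rV_bigcup.

End measurable_rV.


Section measurable_rV_lemmas.
Variables (R : realType).

Lemma measurable_rV_coord n (i : 'I_n) :
  measurable_fun [set: 'rV[R]_n] (rV_coord i).
Proof.
move=> _ Y mY; rewrite setTI; apply: sub_sigma_algebra => /=.
rewrite -bigcup_seq/=; exists i => /=; first by rewrite mem_index_enum.
by exists Y => //; rewrite setTI.
Qed.

Lemma measurable_fun_rVP n d (T : measurableType d) (f : T -> 'rV[R]_n) :
  measurable_fun [set: T] f <->
  forall i, measurable_fun [set: T] (rV_coord i \o f).
Proof.
apply: (@iff_trans _ (g_sigma_preimage
  (fun i : 'I_n => rV_coord i \o f) `<=` measurable)).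
  rewrite g_sigma_preimage_comp; split=> [mf A [/= C preC <-]|prefS].
    exact: mf.
  by move=> _ A mA; apply: prefS; exists A.
split=> [fS i|mf].
- move=> _ A mA; apply: fS; apply: sub_sigma_algebra.
  rewrite -bigcup_seq/=; exists i => /=; first by rewrite mem_index_enum.
  by exists A.
- apply: smallest_sub; first exact: sigma_algebra_measurable.
  rewrite -bigcup_seq/=; apply: bigcup_sub => i _.
  by move=> A [B mB <-]; exact: mf.
Qed.

Definition rV_cons n (p : measurableTypeR R * 'rV[R]_n) : 'rV[R]_n.+1 :=
  row_mx (const_mx (p.1 : R)) p.2 : 'rV[R]_(1 + n).

Definition rV_uncons n (v : 'rV[R]_n.+1) : measurableTypeR R * 'rV[R]_n :=
  (v ord0 ord0, rsubmx (v : 'rV[R]_(1 + n))).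

Lemma rV_consEl n p (j : 'I_1) : @rV_cons n p ord0 (lshift n j) = p.1.
Proof. by rewrite [LHS]row_mxEl mxE. Qed.

Lemma rV_consEr n p (j : 'I_n) : @rV_cons n p ord0 (rshift 1 j) = p.2 ord0 j.
Proof. by rewrite [LHS]row_mxEr. Qed.

Lemma rV_consK n : cancel (@rV_cons n) (@rV_uncons n).
Proof.
move=> [x v]; rewrite /rV_uncons; congr pair; last exact: row_mxKr.
by rewrite -[RHS](rV_consEl (x, v) ord0); congr (rV_cons _ _ _); exact: val_inj.
Qed.

Lemma measurable_rV_cons n : measurable_fun setT (@rV_cons n).
Proof.
apply/measurable_fun_rVP => i.
case: (@splitP 1 n i) => j ij.
- rewrite (_ : _ \o _ = fst); first exact: measurable_fst.
  apply/funext => -[x v]; rewrite /= /rV_coord.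
  have -> : i = lshift n j by exact/val_inj.
  exact: rV_consEl.
- rewrite (_ : _ \o _ = rV_coord j \o snd).
    by apply: measurableT_comp; [exact: measurable_rV_coord|exact: measurable_snd].
  apply/funext => -[x v]; rewrite /= /rV_coord.
  have -> : i = rshift 1 j by exact: val_inj.
  exact: rV_consEr.
Qed.

Lemma measurable_rV_uncons n : measurable_fun setT (@rV_uncons n).
Proof.
apply: measurable_fun_pair => /=; first exact: (@measurable_rV_coord n.+1 ord0).
apply/measurable_fun_rVP => i.
rewrite (_ : _ \o _ = rV_coord (rshift 1 i : 'I_n.+1)).
  exact: measurable_rV_coord.
by apply/funext => v; rewrite /rV_coord /= mxE.
Qed.

End measurable_rV_lemmas.

Section lebesgue_rV.
Variable R : realType.

Section step.
Variables (n : nat) (m : {sigma_finite_measure set 'rV[R]_n -> \bar R}).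

Definition lebesgue_rVS :=
  pushforward ((@lebesgue_measure R) \x m)%E (@rV_cons R n).

Let m0 : lebesgue_rVS set0 = 0%E.
Proof. by rewrite /lebesgue_rVS /pushforward preimage_set0 measure0. Qed.

Let m_ge0 A : (0 <= lebesgue_rVS A)%E.
Proof. by rewrite /lebesgue_rVS /pushforward measure_ge0. Qed.

Let m_sigma_additive : semi_sigma_additive lebesgue_rVS.
Proof.
move=> F mF tF mUF; rewrite /lebesgue_rVS /pushforward preimage_bigcup.
apply: measure_semi_sigma_additive.
- by move=> k; rewrite -[X in measurable X]setTI; exact: measurable_rV_cons.
- apply/trivIsetP => /= i j _ _ ij; rewrite -preimage_setI.
  by move/trivIsetP : tF => /(_ _ _ _ _ ij) ->//; rewrite preimage_set0.
- by rewrite -preimage_bigcup -[X in measurable X]setTI; exact: measurable_rV_cons.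
Qed.

HB.instance Definition _ := isMeasure.Build _ _ _ lebesgue_rVS
  m0 m_ge0 m_sigma_additive.

Let m_sigma_finite : sigma_finite setT lebesgue_rVS.
Proof.
have /sigma_finiteP[F [FT ndF Foo]] := sigma_finiteT (@lebesgue_measure R).
have /sigma_finiteP[G [GT ndG Goo]] := sigma_finiteT m.
exists (fun k => @rV_uncons R n @^-1` (F k `*` G k)).
  apply/esym; rewrite -subTset => v _.
  have [i _ Fi] : (\bigcup_k F k) (rV_uncons v).1 by rewrite -FT.
  have [j _ Gj] : (\bigcup_k G k) (rV_uncons v).2 by rewrite -GT.
  exists (maxn i j) => //; split => /=.
  - by move: Fi; exact/subsetPset/ndF/leq_maxl.
  - by move: Gj; exact/subsetPset/ndG/leq_maxr.
move=> k; have [mF Fk] := Foo k; have [mG Gk] := Goo k; split.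
  rewrite -[X in measurable X]setTI; apply: measurable_rV_uncons => //.
  exact: measurableX.
rewrite /lebesgue_rVS /pushforward -comp_preimage.
rewrite (_ : _ \o _ = id) ?preimage_id; last first.
  by apply/funext => x /=; rewrite rV_consK.
by rewrite product_measure1E// lte_mul_pinfty// ge0_fin_numE.
Qed.

HB.instance Definition _ := Measure_isSigmaFinite.Build _ _ _ lebesgue_rVS
  m_sigma_finite.

End step.

(* n-dimensional Lebesgue measure on the Borel sets of R^n (the sigma-algebra
   generated by the coordinates). Since a Lebesgue measurable function is a.e.
   equal to a Borel one, function spaces modulo a.e. equality are unaffected by
   not completing the sigma-algebra. *)
Fixpoint lebesgue_rV n : {sigma_finite_measure set 'rV[R]_n -> \bar R} :=
  if n is n'.+1 then lebesgue_rVS (lebesgue_rV n') else dirac (0 : 'rV[R]_0).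

End lebesgue_rV.

Section open_measurable_rV.
Variables (R : realType) (n : nat).

Let measurable_rV_ball (v : 'rV[R]_n) (e : R) : (0 < e)%R ->
  measurable (ball v e).
Proof.
move=> e0.
rewrite (_ : ball v e =
    \bigcap_(i in [set: 'I_n]) (rV_coord i @^-1` ball (v ord0 i) e)).
  apply: fin_bigcap_measurable => // i _.
  rewrite -[X in measurable X]setTI; apply: measurable_rV_coord => //.
  by apply: open_measurable; exact: ball_open.
apply/seteqP; split => [w [_ vw] i _ /=|w vw]; first exact: vw.
by split => // i j; rewrite ord1; exact: vw.
Qed.

Lemma open_measurable_rV (U : set 'rV[R]_n) : open U -> measurable U.
Proof.
move=> oU.
pose q2r (q : 'rV[rat]_n) : 'rV[R]_n := map_mx ratr q.
pose B (p : 'rV[rat]_n * nat) : set 'rV[R]_n := ball (q2r p.1) p.2.+1%:R^-1.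
rewrite (_ : U = \bigcup_p (if `[< B p `<=` U >] then B p else set0)).
  apply: countable_bigcupT_measurable => [|p]; first exact: countableP.
  case: ifP => _; last exact: measurable0.
  by apply: measurable_rV_ball; rewrite invr_gt0.
apply/seteqP; split => [v Uv|v [p _]]; last first.
  by case: ifPn => // /asboolP; exact.
have /nbhs_ballP[e /= e0 vU] : nbhs v U by exact: open_nbhs_nbhs.
have e20 : 0 < e / 2 by rewrite divr_gt0.
have [k _ /(_ k (leqnn k)) /= ke] := near_infty_natSinv_lt (PosNum e20).
have k0 : 0 < k.+1%:R^-1 :> R by rewrite invr_gt0.
have /choice[q vq] : forall i : 'I_n, exists q : rat,
    ball (v ord0 i) k.+1%:R^-1 (ratr q).
  move=> i; have /rat_in_itvoo[q] :
    v ord0 i - k.+1%:R^-1 < v ord0 i + k.+1%:R^-1.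
    by rewrite ltrD2l gtrN.
  by rewrite in_itv/= => ?; exists q; rewrite /ball/= ltr_distlC.
have vB : ball v k.+1%:R^-1 (q2r (\row_i q i)).
  by split => // i j; rewrite ord1 !mxE; exact: vq.
exists (\row_i q i, k) => //; case: ifPn => [_|/asboolP[]].
  exact: ball_sym.
move=> w qw; apply: vU; rewrite -[ball _ _ _]/(ball v e w).
by apply: ball_split; apply: (le_ball (ltW ke)); [exact: vB|exact: qw].
Qed.

End open_measurable_rV.

Section weighted_L1.
Local Open Scope ereal_scope.
Variables (R : realType) (n : nat).
Implicit Types (D E : set 'rV[R]_n) (phi : 'rV[R]_n -> R).

Definition wnorm E phi (u : 'rV[R]_n -> \bar R) : \bar R :=
  \int[lebesgue_rV R n]_(x in E) (`|u x| * (phi x)%:E).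

Definition weight D phi :=
  {within D, continuous phi} /\ (forall x, D x -> (0 < phi x)%R).

Definition L1_mem D phi (f : 'rV[R]_n -> R) :=
  measurable_fun D f /\ wnorm D phi (EFin \o f) < +oo.

Lemma measurable_weight D phi : open D -> weight D phi -> measurable_fun D phi.
Proof.
move=> oD [cphi _] mD; apply: (measurability _ (RGenOpens.measurableE R)) => //.
move=> _ [_ [a [b ->] <-]]; apply: open_measurable_rV.
move: cphi; rewrite continuous_open_subspace// => cphi.
rewrite openE => x [Dx abx]; apply: filterI; first exact: open_nbhs_nbhs.
apply: cphi; first exact/mem_set.
apply: open_nbhs_nbhs; split => //; exact: interval_open.
Qed.

Lemma L1_mem0 D phi : L1_mem D phi (cst 0%R).
Proof.
split; first exact: measurable_cst.
rewrite /wnorm integral0_eq ?ltry// => x _ /=.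
by rewrite normr0 mul0e.
Qed.

Record L1_fun D phi := L1Fun
  { L1_val :> 'rV[R]_n -> R; L1_valP : L1_mem D phi L1_val }.

HB.instance Definition _ D phi := gen_eqMixin (L1_fun D phi).
HB.instance Definition _ D phi := gen_choiceMixin (L1_fun D phi).

Definition L1_eqv D phi (f g : L1_fun D phi) : bool :=
  `[< {ae lebesgue_rV R n, forall x, D x -> f x = g x} >].

Section space.
Variables (D : set 'rV[R]_n) (phi : 'rV[R]_n -> R).

Let eqv_refl : reflexive (@L1_eqv D phi).
Proof. by move=> f; apply/asboolP; exact: aeW. Qed.

Let eqv_sym : symmetric (@L1_eqv D phi).
Proof.
by move=> f g; apply/asboolP/asboolP; apply: filterS => x fg Dx; rewrite fg.
Qed.

Let eqv_trans : transitive (@L1_eqv D phi).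
Proof.
move=> g f h /asboolP fg /asboolP gh; apply/asboolP.
by apply: filterS2 fg gh => x fg gh Dx; rewrite fg// gh.
Qed.

Canonical L1_eqv_canonical := EquivRel (@L1_eqv D phi) eqv_refl eqv_sym eqv_trans.

Hypotheses (oD : open D) (wphi : weight D phi).

(* The two proofs are recorded in the type so that the metric structure can be
   attached to it. *)
Definition L1 & open D & weight D phi : Type :=
  {eq_quot L1_eqv_canonical}%qT.
HB.instance Definition _ := Choice.on (L1 oD wphi).
HB.instance Definition _ := EqQuotient.on (L1 oD wphi).
Local Notation L1phi := (L1 oD wphi).

Definition L1_dist (p q : L1phi) : R :=
  fine (wnorm D phi (fun x => (repr p x - repr q x)%:E)).

Let mD : measurable D. Proof. exact: open_measurable_rV. Qed.

Lemma measurable_wnorm (f : 'rV[R]_n -> R) : measurable_fun D f ->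
  measurable_fun D (fun x => `|(f x)%:E| * (phi x)%:E).
Proof.
move=> mf; apply: emeasurable_funM.
  by apply: measurableT_comp => //; exact/measurable_EFinP.
by apply/measurable_EFinP; exact: measurable_weight.
Qed.

Let wnorm_ge0 (u : 'rV[R]_n -> \bar R) x : D x -> 0 <= `|u x| * (phi x)%:E.
Proof. by move=> Dx; rewrite mule_ge0// lee_fin ltW// wphi.2. Qed.

Lemma ler_wnormD (f g : 'rV[R]_n -> R) :
  measurable_fun D f -> measurable_fun D g ->
  wnorm D phi (fun x => (f x + g x)%:E) <=
  wnorm D phi (EFin \o f) + wnorm D phi (EFin \o g).
Proof.
move=> mf mg; rewrite /wnorm -ge0_integralD//=; last 4 first.
- by move=> x; exact: (wnorm_ge0 (EFin \o f)).
- exact: measurable_wnorm.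
- by move=> x; exact: (wnorm_ge0 (EFin \o g)).
- exact: measurable_wnorm.
apply: ge0_le_integral => //=.
- by move=> x; exact: (wnorm_ge0 (fun x => (f x + g x)%:E)).
- by apply: (@measurable_wnorm (f \+ g)%R); exact: measurable_funD.
- by apply: emeasurable_funD; exact: measurable_wnorm.
- move=> x Dx; rewrite -ge0_muleDl// lee_pmul2r// ?lte_fin ?wphi.2//.
  by rewrite -EFinD lee_fin ler_normD.
Qed.

Lemma wnormN (f : 'rV[R]_n -> R) :
  wnorm D phi (fun x => (- f x)%:E) = wnorm D phi (EFin \o f).
Proof. by apply: eq_integral => x _; rewrite /= normrN. Qed.

Lemma L1_memB (f g : 'rV[R]_n -> R) : L1_mem D phi f -> L1_mem D phi g ->
  L1_mem D phi (fun x => (f x - g x)%R).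
Proof.
move=> [mf foo] [mg goo]; split; first exact: measurable_funB.
have mNg : measurable_fun D (fun x => - g x)%R by exact: measurableT_comp.
by apply: (le_lt_trans (ler_wnormD mf mNg)); rewrite wnormN lte_add_pinfty.
Qed.

Let L1_mem_fin_num f : L1_mem D phi f -> wnorm D phi (EFin \o f) \is a fin_num.
Proof. by move=> [_ foo]; rewrite ge0_fin_numE//; apply: integral_ge0 => x; exact: wnorm_ge0. Qed.

Let L1_memBr (p q : L1phi) : L1_mem D phi (fun x => (repr p x - repr q x)%R).
Proof. by apply: L1_memB; exact: L1_valP. Qed.

Let L1_distxx p : L1_dist p p = 0%R.
Proof.
rewrite /L1_dist /wnorm integral0_eq// => x _.
by rewrite subrr abse0 mul0e.
Qed.

Let L1_dist_eq0 p q : L1_dist p q = 0%R -> p = q.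
Proof.
have mpq : measurable_fun D (fun x => `|(repr p x - repr q x)%:E| * (phi x)%:E).
  exact: (measurable_wnorm (L1_memBr p q).1).
move=> pq0; have {}pq0 : wnorm D phi (fun x => (repr p x - repr q x)%:E) = 0.
  by rewrite -[LHS]fineK ?[fine _]pq0//; exact: (L1_mem_fin_num (L1_memBr p q)).
rewrite -[p]reprK -[q]reprK; apply/eqP; rewrite eqmodE; apply/asboolP.
have /(ae_eq_integral_abs _ mD mpq) :
    \int[lebesgue_rV R n]_(x in D)
      `| `|(repr p x - repr q x)%:E| * (phi x)%:E| = 0.
  rewrite -[RHS]pq0; apply: eq_integral => x /set_mem Dx.
  by rewrite gee0_abs// (wnorm_ge0 (fun x => (repr p x - repr q x)%:E)).
apply: filterS => x /[swap] Dx /(_ Dx) /eqP.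
rewrite mule_eq0 => /orP[|]; last by rewrite eqe gt_eqF// wphi.2.
by rewrite abse_eq0 eqe subr_eq0 => /eqP.
Qed.

Let L1_distC p q : L1_dist p q = L1_dist q p.
Proof.
rewrite /L1_dist; congr fine; apply: eq_integral => x _.
by rewrite /= distrC.
Qed.

Let L1_dist_triangle q p r : (L1_dist p r <= L1_dist p q + L1_dist q r)%R.
Proof.
have fB a b := L1_mem_fin_num (L1_memBr a b).
rewrite -lee_fin EFinD !fineK; [|exact: fB..].
apply: le_trans (ler_wnormD (L1_memBr p q).1 (L1_memBr q r).1).
rewrite le_eqVlt; apply/orP; left; apply/eqP.
by apply: eq_integral => x _; rewrite subrKA.
Qed.

HB.instance Definition _ := isMetric.Build R L1phi
  L1_distxx L1_dist_eq0 L1_distC L1_dist_triangle.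

Definition toL1 (f : 'rV[R]_n -> R) : L1phi :=
  if pselect (L1_mem D phi f) is left fL1 then \pi_L1phi%qT (L1Fun fL1)
  else \pi_L1phi%qT (L1Fun (L1_mem0 D phi)).

Lemma toL1_dist (f g : 'rV[R]_n -> R) : L1_mem D phi f -> L1_mem D phi g ->
  mdist (toL1 f) (toL1 g) = fine (wnorm D phi (fun x => (f x - g x)%:E)).
Proof.
move=> fL1 gL1; rewrite /mdist/= /L1_dist; congr fine.
have rpr (h : 'rV[R]_n -> R) : L1_mem D phi h ->
    {ae lebesgue_rV R n, forall x, D x -> repr (toL1 h) x = h x}.
  move=> hL1; rewrite /toL1; case: pselect => // {}hL1.
  have /eqP := reprK (\pi_L1phi%qT (L1Fun hL1)).
  by rewrite eqmodE => /asboolP.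
apply: ge0_ae_eq_integral => //.
- exact: (measurable_wnorm (L1_memBr _ _).1).
- exact: (measurable_wnorm (L1_memB fL1 gL1).1).
- by move=> x; exact: (wnorm_ge0 (fun x => (_ x - _ x)%:E)).
- by move=> x; exact: (wnorm_ge0 (fun x => (f x - g x)%:E)).
by apply: filterS2 (rpr f fL1) (rpr g gL1) => x fx gx Dx; rewrite fx// gx.
Qed.

End space.
End weighted_L1.


Section potential_theory.
Local Open Scope ereal_scope.
Variables (R : realType) (n : nat).
Local Notation E := 'rV[R]_n.
Implicit Types (D F : set E) (x y z : E) (phi : E -> R).

(* [`|x|] on row vectors is the sup norm of the library. *)
Definition enorm x : R := Num.sqrt (\sum_i x ord0 i ^+ 2)%R.

Definition eball x (r : R) : set E := [set z | (enorm (z - x) <= r)%R].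

Definition ball_mean (u : E -> \bar R) x (r : R) : \bar R :=
  ((fine (lebesgue_rV R n (eball x r)))^-1)%:E *
  \int[lebesgue_rV R n]_(z in eball x r) u z.

Definition is_domain D := [/\ D !=set0, open D & connected D].

Definition subharmonic D (u : E -> \bar R) :=
  [/\ forall x, D x -> u x < +oo,
      forall x, D x -> forall a : R, u x < a%:E -> \forall z \near x, u z < a%:E
    & forall x (r : R), (0 < r)%R -> eball x r `<=` D -> u x <= ball_mean u x r].

Definition negative_subharmonic D (u : E -> \bar R) :=
  [/\ subharmonic D u, forall x, D x -> u x <= 0
    & exists2 x, D x & u x != -oo].

(* Harmonic functions are defined by continuity and the mean value property. *)
Definition harmonic D (h : E -> R) :=
  (forall x, D x -> {for x, continuous h}) /\
  forall x (r : R), (0 < r)%R -> eball x r `<=` D ->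
    (h x)%:E = ball_mean (EFin \o h) x r.

(* The fundamental subharmonic function |x|, log |x|, - |x|^(2-n) for n = 1,
   n = 2, n >= 3. Its normalization plays no role, as only quotients of Green
   functions with a common pole are used below. *)
Definition fundamental x : \bar R :=
  if n == 1%N then (enorm x)%:E
  else if x == 0%R then -oo
  else if n == 2%N then (ln (enorm x))%:E
  else (- (enorm x ^- (n - 2)%N))%:E.

(* g = G_D(., y); the last clause says that the least harmonic majorant of g
   on D is 0. *)
Definition is_green D y (g : E -> \bar R) :=
  [/\ negative_subharmonic D g,
      harmonic (D `\ y) (fine \o g),
      exists2 h : E -> R, harmonic D h &
        forall x, D x -> g x = fundamental (x - y) + (h x)%:E
    & forall h : E -> R, harmonic D h -> (forall x, D x -> g x <= (h x)%:E) ->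
        forall x, D x -> (0 <= h x)%R].

Definition greenian D :=
  is_domain D /\ (forall y, D y -> exists g, is_green D y g).

(* On a Greenian domain the function below is determined on D by [is_green]. *)
Definition green D x y : \bar R := xget (fun=> -oo) [set g | is_green D y g] x.

Definition exhaustion D (D_ : nat -> set E) :=
  [/\ forall j, is_domain (D_ j),
      forall j, compact (closure (D_ j)) /\ closure (D_ j) `<=` D,
      forall j, D_ j `<=` D_ j.+1
    & \bigcup_j D_ j = D].

Definition norming D phi :=
  [/\ weight D phi,
      forall u, negative_subharmonic D u -> wnorm D phi u < +oo,
      forall F, compact F -> F `<=` D -> exists2 C : R, (0 < C)%R &
        forall u, negative_subharmonic D u ->
          forall x, F x -> u x <= - (C%:E * wnorm D phi u)
    & forall D_ : nat -> set E, exhaustion D D_ ->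
        exists eps : nat -> R,
          [/\ forall j, (0 < eps j)%R, eps j @[j --> \oo] --> (0 : R)%R
            & forall u, negative_subharmonic D u -> forall j,
                wnorm (D `\` D_ j) phi u <= (eps j)%:E * wnorm D phi u]].

Definition no_accumulation D (y_ : nat -> E) :=
  (forall j, D (y_ j)) /\ (forall z, D z -> ~ cluster (y_ @ \oo) z).

(* m(y)^-1 G_D(x, y) with m = G_D(x0, .). For x <> y = x0 this is the value 0;
   only y different from x0 matter at the boundary. *)
Definition martin_kernel D (x0 x y : E) : \bar R :=
  green D x y * ((fine (green D x0 y))^-1)%:E.

(* The Martin boundary: an equivalence class of sequences is represented by the
   common limit, of which only the values on D are relevant. *)
Definition martin_function D (x0 : E) (k : E -> R) :=
  exists2 y_ : nat -> E, no_accumulation D y_ &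
    forall F, compact F -> F `<=` D ->
      {uniform F, (fun j x => fine (martin_kernel D x0 x (y_ j))) @ \oo --> k}.

(* M, with the embedding i : D -> M, is the Martin compactification of D: the
   points outside i(D) correspond exactly to the limits of sequences of Martin
   kernels, and K extends the kernel from D to M continuously at these points.
   Only the topology of M is used, i.e., M is a metrizable space. *)
Definition martin_compactification D (x0 : E) (M : metricType R) (i : E -> M) :=
  [/\ compact [set: M],
      [/\ {within D, continuous i}, set_inj D i
        & forall U, open U -> U `<=` D -> open (i @` U)],
      dense (i @` D)
    & exists K : E -> M -> \bar R,
      [/\ forall x y, D x -> D y -> K x (i y) = martin_kernel D x0 x y,
          forall x zeta, D x -> ~ (i @` D) zeta ->
            0 <= K x zeta /\ {for zeta, continuous (K x)},
          forall zeta zeta', ~ (i @` D) zeta -> ~ (i @` D) zeta' ->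
            (forall x, D x -> K x zeta = K x zeta') -> zeta = zeta'
        & forall k, martin_function D x0 k <->
            exists2 zeta, ~ (i @` D) zeta & forall x, D x -> K x zeta = (k x)%:E]].

Section Phi.
Variables (D : set E) (phi : E -> R) (hD : greenian D) (hphi : norming D phi).

Lemma greenian_open : open D. Proof. by case: hD => -[]. Qed.

Lemma norming_weight : weight D phi. Proof. by case: hphi. Qed.

Definition L1_norming := L1 greenian_open norming_weight.

Definition green_norm y : \bar R := wnorm D phi (fun x => green D x y).

(* [fine] only affects the value at the pole. *)
Definition Phi y : L1_norming := toL1 greenian_open norming_weight
  (fun x => (fine (green_norm y))^-1 * fine (green D x y))%R.

Definition Dtilde : set L1_norming := closure (Phi @` D).

Definition partialM : set L1_norming :=
  [set p | exists2 y_, no_accumulation D y_ & Phi (y_ j) @[j --> \oo] --> p].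

End Phi.

End potential_theory.
Arguments L1_norming {R n D phi} hD hphi.
Arguments Phi {R n D phi} hD hphi y.
Arguments Dtilde {R n D phi} hD hphi _.
Arguments partialM {R n D phi} hD hphi _.

Definition homeomorphism_on (S T : topologicalType) (A : set S) (B : set T)
    (h : S -> T) :=
  {within A, continuous h} /\ exists g : T -> S,
    [/\ {within B, continuous g}, h @` A `<=` B, g @` B `<=` A,
        {in A, cancel h g} & {in B, cancel g h}].

(* Main.v *)
From Pilot Require Import Defs.
From HB Require Import structures.
From mathcomp Require Import all_boot all_order all_algebra.
From mathcomp Require Import all_classical all_reals all_analysis measurable_realfun.
From mathcomp Require Import ring lra.
Import Order.TTheory GRing.Theory Num.Theory numFieldNormedType.Exports.
Set Implicit Arguments. Unset Strict Implicit. Unset Printing Implicit Defensive.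
Local Open Scope classical_set_scope.
Local Open Scope ring_scope.
Import Pilot.Defs.

(* Write G_D(., y) = f(. - y) + h_y with f the fundamental function. As the least
   harmonic majorant of G_D(., y) is 0, h_y is the greatest harmonic minorant of
   - f(. - y), so that y |-> h_y is continuous for the sup norm on D: two of
   these functions - f(. - y), - f(. - y') differ little except near the pole,
   where they are large. Hence Phi is continuous; it is injective, with values
   that are not harmonic, because G_D(., y) has a pole at y.
   Let y run through an ultrafilter on D that leaves every compact subset. The
   functions w_y = Phi y have norm 1, so away from y they are locally bounded by
   the mean value property, hence equicontinuous by Harnack's inequality, and
   they converge locally uniformly to a harmonic v; by condition (3) of norming
   functions the convergence holds in L^1(D, phi), so that v has norm 1 and, by
   (2), v < 0. So Phi(D) is relatively compact, its closure consists of Phi(D) and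
   of such limits v, and since the latter are harmonic the two parts are disjoint.
   At the point v the Martin kernel extends by v / v(x0), which determines v
   because v has norm 1. This makes the closure a Martin compactification; for
   an arbitrary one, it shows that Phi(y_j) converges if and only if i(y_j) does,
   and a correspondence between convergent sequences in dense subsets extends to
   a homeomorphism of the closures. *)

(** * Lebesgue measure and affine maps *)

(** Harmonicity is a mean value property over balls, and [fundamental] is given by a formula, so the
    estimates come from averages over Euclidean balls and from the norming conditions. Local
    integrability of f, for example, is read off from the finite norm of a Green function: near y
    the weight is bounded below and h_y is bounded. Ultrafilters replace subsequences: along an
    ultrafilter, pointwise limits of bounded functions exist outright. The price is that Fatou's
    lemma and dominated convergence fail along them, so each passage to the limit under an integral
    goes through uniform convergence on compact sets and an exhaustion. Dimension 1 differs from the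
    others: f(x) = |x| is finite at its pole, and the singularity is a kink, detected by a minimum
    principle instead of unboundedness. When the pole is infinite, [fine] puts the value 0 there,
    whence the conditions x <> y below. *)

Section affine_invariance.
Local Open Scope ereal_scope.
Context {R : realType}.

Lemma measurable_affine1 (a b : R) :
  measurable_fun [set: measurableTypeR R] (fun x : measurableTypeR R => (a * x + b)%R).
Proof.
by apply: measurable_funD => //; apply: measurable_funM.
Qed.

(** The pushforward of Lebesgue measure under x |-> a x + b, multiplied by a, agrees with Lebesgue
    measure on half-open intervals, which determine it. *)
Lemma lebesgue_measure_affine (a b : R) (A : set (measurableTypeR R)) :
  (0 < a)%R -> measurable A ->
  a%:E * lebesgue_measure ((fun x : measurableTypeR R => (a * x + b)%R) @^-1` A) =
  lebesgue_measure A.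
Proof.
move=> a0 mA.
pose T (x : measurableTypeR R) : measurableTypeR R := (a * x + b)%R.
have mT : measurable_fun setT T by exact: measurable_affine1.
pose pf : {measure set (measurableTypeR R) -> \bar R} :=
  measure_function_pushforward__canonical__measure_function_Measure lebesgue_measure mT.
pose mu := mscale (NngNum (ltW a0)) pf.
rewrite [RHS](@lebesgue_measure_unique R mu) //.
move=> X /ocitvP[->|[[p q]] /= pq ->]; first by rewrite !measure0.
rewrite /mu /mscale /= /pushforward.
have -> : T @^-1` `]p, q] = `]((p - b) / a)%R, ((q - b) / a)%R]%classic.
  apply/seteqP; split => x /=; rewrite !in_itv /= /T ltr_pdivrMr // ler_pdivlMr //; lra.
rewrite !lebesgue_measure_itv /= !lte_fin ltr_pM2r ?invr_gt0 // ltrD2r pq.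
by rewrite -!EFinB -EFinM; congr EFin; field; rewrite gt_eqF.
Qed.

Lemma ge0_integral_affine (a b : R) (F : measurableTypeR R -> \bar R) :
  (0 < a)%R -> measurable_fun setT F -> (forall x, 0 <= F x) ->
  a%:E * \int[lebesgue_measure]_x F (a * x + b)%R = \int[lebesgue_measure]_x F x.
Proof.
move=> a0 mF F0.
pose T (x : measurableTypeR R) : measurableTypeR R := (a * x + b)%R.
have mT : measurable_fun setT T by exact: measurable_affine1.
pose pf : {measure set (measurableTypeR R) -> \bar R} :=
  measure_function_pushforward__canonical__measure_function_Measure lebesgue_measure mT.
pose mu := mscale (NngNum (ltW a0)) pf.
rewrite [RHS](eq_measure_integral mu); last first.
  by move=> A mA _; rewrite /= -(lebesgue_measure_affine b a0).
rewrite ge0_integral_mscale //= ge0_integral_pushforward //.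
Qed.

Definition affine n (a : R) (b : 'rV[R]_n) (x : 'rV[R]_n) : 'rV[R]_n := (a *: x + b)%R.

Lemma measurable_rV_affine n (a : R) (b : 'rV[R]_n) : measurable_fun setT (affine a b).
Proof.
apply/measurable_fun_rVP => i.
rewrite (_ : _ \o _ = (fun x => a * x + b ord0 i)%R \o rV_coord i); last first.
  by apply/funext => x; rewrite /rV_coord /= !mxE.
by apply: measurableT_comp; [exact: measurable_affine1|exact: measurable_rV_coord].
Qed.

Lemma lebesgue_rVSE n (A : set 'rV[R]_n.+1) :
  lebesgue_rV R n.+1 A = \int[lebesgue_measure]_x lebesgue_rV R n [set v | A (rV_cons (x, v))].
Proof.
rewrite /= /lebesgue_rVS /pushforward /product_measure1.
by apply: eq_integral => x _ /=; congr (lebesgue_rV _ _ _);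
  apply/seteqP; split => v; rewrite /xsection/= inE.
Qed.

Lemma measurable_rV_section n (A : set 'rV[R]_n.+1) x : measurable A ->
  measurable [set v | A (rV_cons (x, v))].
Proof.
move=> mA; have : measurable (@rV_cons R n @^-1` A).
  by rewrite -[X in measurable X]setTI; exact: measurable_rV_cons.
move=> /(@measurable_xsection _ _ _ _ _ x); congr measurable.
by apply/seteqP; split => v; rewrite /xsection/= inE.
Qed.

Lemma measurable_rV_sectionF n (A : set 'rV[R]_n.+1) : measurable A ->
  measurable_fun setT (fun x => lebesgue_rV R n [set v | A (rV_cons (x, v))]).
Proof.
move=> mA; have : measurable (@rV_cons R n @^-1` A).
  by rewrite -[X in measurable X]setTI; exact: measurable_rV_cons.
move=> /(@measurable_fun_xsection _ _ _ _ _ (lebesgue_rV R n)).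
congr measurable_fun; apply/funext => x /=; congr (lebesgue_rV _ _ _).
by apply/seteqP; split => v; rewrite /xsection/= inE.
Qed.

(** Induction on the dimension: the integral over the first coordinate supplies one factor a through
    [ge0_integral_affine], the slices supply the others. *)
Lemma lebesgue_rV_affine n (a : R) (b : 'rV[R]_n) (A : set 'rV[R]_n) :
  (0 < a)%R -> measurable A ->
  (a ^+ n)%:E * lebesgue_rV R n (affine a b @^-1` A) = lebesgue_rV R n A.
Proof.
move=> a0; elim: n => [|n IH] in b A *.
  move=> mA; rewrite expr0 mul1e (_ : affine a b @^-1` A = A) //.
  by apply/funext => x /=; rewrite (thinmx0 (affine a b x)) (thinmx0 x).
move=> mA; rewrite !lebesgue_rVSE exprSr.
pose F x := lebesgue_rV R n [set v | A (rV_cons (x, v))].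
have mF : measurable_fun setT F by exact: measurable_rV_sectionF.
have F0 x : 0 <= F x by exact: measure_ge0.
rewrite -[RHS]/(\int[lebesgue_measure]_x F x).
rewrite -(ge0_integral_affine (b ord0 ord0) a0 mF F0).
have mFa : measurable_fun setT (fun x : measurableTypeR R => F (a * x + b ord0 ord0)%R).
  exact: (measurableT_comp mF (measurable_affine1 a (b ord0 ord0))).
rewrite [in LHS]EFinM -muleA muleCA; congr (_ * _).
rewrite -ge0_integralZl//; last 2 first.
- apply: measurable_rV_sectionF; rewrite -[X in measurable X]setTI.
  exact: measurable_rV_affine.
- by rewrite lee_fin exprn_ge0 // ltW.
apply: eq_integral => x _.
have /(IH (rV_uncons b).2) := measurable_rV_section (a * x + b ord0 ord0)%R mA.
rewrite -[F _]/(lebesgue_rV R n _) => <-.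
congr (_ * lebesgue_rV _ _ _); apply/funext => v /=; congr (A _).
apply/rowP => i; case: (@splitP 1 n i) => j ij.
  have -> : i = lshift n j by exact/val_inj.
  by rewrite 2!mxE !(rV_consEl (_, _)) /= (_ : lshift n j = ord0) //; apply/val_inj; rewrite /= ord1.
have -> : i = rshift 1 j by exact/val_inj.
by rewrite 2!mxE !(rV_consEr (_, _)) /= !mxE.
Qed.

Lemma lebesgue_rV_translate n (b : 'rV[R]_n) (A : set 'rV[R]_n) : measurable A ->
  lebesgue_rV R n ((fun x => x + b)%R @^-1` A) = lebesgue_rV R n A.
Proof.
move=> mA; rewrite -[RHS](lebesgue_rV_affine b ltr01 mA) expr1n mul1e.
by congr (lebesgue_rV _ _ _); apply/funext => x /=; rewrite /affine scale1r.
Qed.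

Lemma ge0_integral_translate n (b : 'rV[R]_n) (A : set 'rV[R]_n) (F : 'rV[R]_n -> \bar R) :
  measurable A -> measurable_fun A F -> (forall x, A x -> 0 <= F x) ->
  \int[lebesgue_rV R n]_(x in (fun x => x + b)%R @^-1` A) F (x + b)%R =
  \int[lebesgue_rV R n]_(x in A) F x.
Proof.
move=> mA mF F0.
have mT : measurable_fun setT (fun x : 'rV[R]_n => x + b)%R.
  have := measurable_rV_affine 1%R b; congr measurable_fun.
  by apply/funext => x /=; rewrite /affine scale1r.
rewrite -(@ge0_integral_pushforward _ _ _ _ _ _ mT (lebesgue_rV R n) A F) //.
  apply: eq_measure_integral => B mB _; exact: lebesgue_rV_translate.
by move=> x /set_mem; exact: F0.
Qed.
End affine_invariance.

(** * Euclidean balls *)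

Section euclidean_norm.
Context {R : realType} {n : nat}.
Local Notation E := 'rV[R]_n.
Implicit Types (x y z : E) (r s : R).

Lemma enorm_ge0 x : 0 <= enorm x.
Proof. exact: sqrtr_ge0. Qed.

Lemma sqr_enorm x : enorm x ^+ 2 = \sum_i x ord0 i ^+ 2.
Proof. by rewrite sqr_sqrtr// sumr_ge0// => i _; rewrite sqr_ge0. Qed.

Lemma enormZ (a : R) x : enorm (a *: x) = `|a| * enorm x.
Proof.
rewrite /enorm -sqrtr_sqr -sqrtrM ?sqr_ge0//; congr Num.sqrt.
by rewrite mulr_sumr; apply: eq_bigr => i _; rewrite mxE exprMn.
Qed.

Lemma enorm0 : enorm (0 : E) = 0.
Proof. by rewrite -(scale0r 0) enormZ normr0 mul0r. Qed.

Lemma enormN x : enorm (- x) = enorm x.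
Proof. by rewrite -scaleN1r enormZ normrN1 mul1r. Qed.

Lemma enorm_distC x y : enorm (x - y) = enorm (y - x).
Proof. by rewrite -enormN opprB. Qed.

Lemma ler_coord_enorm x i : `|x ord0 i| <= enorm x.
Proof.
rewrite -sqrtr_sqr ler_wsqrtr// (bigD1 i)//= lerDl sumr_ge0// => j _.
exact: sqr_ge0.
Qed.

Lemma ler_norm_enorm x : `|x| <= enorm x.
Proof.
rewrite /Num.Def.normr /= mx_normrE; apply/bigmax_leP; split; first exact: enorm_ge0.
by move=> [i j] _ /=; rewrite ord1 ler_coord_enorm.
Qed.

Lemma enorm_eq0 x : enorm x = 0 -> x = 0.
Proof.
by move=> x0; apply/eqP; rewrite -normr_le0 -x0 ler_norm_enorm.
Qed.

Lemma enorm_gt0 x : (0 < enorm x) = (x != 0).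
Proof.
rewrite lt0r enorm_ge0 andbT; congr negb; apply/eqP/eqP => [/enorm_eq0 //|->].
exact: enorm0.
Qed.

Lemma ler_enorm_norm x : enorm x <= n%:R * `|x|.
Proof.
rewrite -ler_sqr ?nnegrE ?mulr_ge0 ?enorm_ge0// sqr_enorm exprMn.
rewrite (@le_trans _ _ (\sum_(i < n) `|x| ^+ 2))//.
  apply: ler_sum => i _; rewrite -real_normK ?num_real// ler_sqr ?nnegrE//.
  rewrite [leRHS]/Num.Def.normr /= mx_normrE.
  by apply/bigmax_geP; right => /=; exists (ord0, i).
rewrite sumr_const card_ord -[leLHS]mulr_natl ler_wpM2r ?sqr_ge0// -natrX ler_nat.
by case: n => // k; rewrite -[leqLHS]muln1 expnS expn1 leq_mul.
Qed.

Lemma ler_enormD x y : enorm (x + y) <= enorm x + enorm y.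
Proof.
have [->|x0] := eqVneq x 0; first by rewrite enorm0 !add0r.
have [->|y0] := eqVneq y 0; first by rewrite enorm0 !addr0.
have A0 : 0 < enorm x by rewrite enorm_gt0.
have B0 : 0 < enorm y by rewrite enorm_gt0.
rewrite -ler_sqr ?nnegrE ?addr_ge0 ?enorm_ge0// sqr_enorm.
set A := enorm x in A0 *; set B := enorm y in B0 *.
(* convexity of the square with weights A / (A + B) and B / (A + B) *)
have H i : (x + y) ord0 i ^+ 2 <=
    (A + B) / A * (x ord0 i ^+ 2) + (A + B) / B * (y ord0 i ^+ 2).
  rewrite mxE; set a := x _ _; set b := y _ _; rewrite -subr_ge0.
  rewrite (_ : _ - _ = (B * a - A * b) ^+ 2 / (A * B)); last first.
    by field; rewrite !gt_eqF.
  by rewrite divr_ge0 ?sqr_ge0 // mulr_ge0 // ltW.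
apply: (le_trans (ler_sum _ (fun i _ => H i))).
rewrite big_split /= -!mulr_sumr -!sqr_enorm -/A -/B le_eqVlt; apply/orP; left.
by apply/eqP; field; rewrite !gt_eqF.
Qed.

Lemma ler_enormB x y : enorm x - enorm y <= enorm (x - y).
Proof. by rewrite lerBlDr (le_trans _ (ler_enormD _ _)) // subrK. Qed.

Lemma ler_dist_enorm x y : `|enorm x - enorm y| <= enorm (x - y).
Proof.
by rewrite ler_norml ler_enormB andbT lerNl opprB enorm_distC ler_enormB.
Qed.

Lemma enorm_continuous : continuous (@enorm R n).
Proof.
move=> x; apply/(@cvgrPdist_le _ _ _ (nbhs x) (nbhs_filter x)) => e e0.
have n1 : 0 < n%:R + 1 :> R by rewrite ltr_wpDl.
have d0 : 0 < e / (n%:R + 1) by rewrite divr_gt0.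
have : nbhs x (ball x (e / (n%:R + 1))) by exact: nbhsx_ballx.
apply: filterS => y; rewrite mx_norm_ball /ball_ /= => /ltW xy.
apply: (le_trans (ler_dist_enorm _ _)); apply: (le_trans (ler_enorm_norm _)).
rewrite (@le_trans _ _ (n%:R * (e / (n%:R + 1))))//; first by rewrite ler_wpM2l.
by rewrite mulrA ler_pdivrMr // mulrC ler_wpM2l ?ltW // ltrDl.
Qed.

Lemma eball_center x r : 0 <= r -> eball x r x.
Proof. by move=> r0; rewrite /eball /= subrr enorm0. Qed.

Lemma eball_sub x y r s : enorm (y - x) + s <= r -> eball y s `<=` eball x r.
Proof.
move=> sr z; rewrite /eball /= => zs; apply: le_trans sr.
have -> : z - x = (y - x) + (z - y) by rewrite [RHS]addrC addrA subrK.
by rewrite (le_trans (ler_enormD _ _))// lerD2l.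
Qed.

Lemma le_eball x r s : r <= s -> eball x r `<=` eball x s.
Proof. by move=> rs; apply: eball_sub; rewrite subrr enorm0 add0r. Qed.

Lemma eball_sym x y r : eball x r y -> eball y r x.
Proof. by rewrite /eball /= enorm_distC. Qed.

Lemma dist_continuous x : continuous (fun z => enorm (z - x)).
Proof.
move=> z; apply: (@continuous_comp _ _ _ (fun z : E => z - x) (@enorm R n)).
  apply: (@cvgB R E E (nbhs z) (nbhs_filter z) id (cst x)); first exact: cvg_id.
  exact: cst_continuous.
exact: enorm_continuous.
Qed.

Lemma eball_closed x r : closed (eball x r).
Proof.
apply: (@closed_comp _ _ (fun z => enorm (z - x)) [set t | t <= r]).
  by move=> z _; exact: dist_continuous.
exact: closed_le.
Qed.

Lemma eoball_open x r : open [set z | enorm (z - x) < r].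
Proof.
apply: (@open_comp _ _ (fun z => enorm (z - x)) [set t | t < r]).
  by move=> z _; exact: dist_continuous.
exact: open_lt.
Qed.

Lemma nbhs_eball x r : 0 < r -> nbhs x (eball x r).
Proof.
move=> r0; apply: (@filterS _ _ _ [set z | enorm (z - x) < r]).
  by move=> z /ltW.
by apply: open_nbhs_nbhs; split; [exact: eoball_open|rewrite /= subrr enorm0].
Qed.

Lemma nbhs_eballP x (U : set E) : nbhs x U <-> exists2 r, 0 < r & eball x r `<=` U.
Proof.
split; last by move=> [r r0 /filterS]; apply; exact: nbhs_eball.
move=> /nbhs_ballP[e /= e0 xU]; exists (e / 2); first by rewrite divr_gt0.
move=> z xz; apply: xU; rewrite mx_norm_ball /ball_ /= distrC.
by rewrite (le_lt_trans (ler_norm_enorm _))// (le_lt_trans xz)//; lra.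
Qed.

Lemma eball_compact x r : compact (eball x r).
Proof.
apply: bounded_closed_compact; last exact: eball_closed.
exists (r + `|x|); split; first exact: num_real.
move=> M rM z zr; apply: ltW; apply: le_lt_trans rM; rewrite -(subrK x z).
by rewrite (le_trans (ler_normD _ _))// lerD2r (le_trans (ler_norm_enorm _)).
Qed.

Lemma measurable_closed (A : set E) : closed A -> measurable A.
Proof.
move=> cA; rewrite -[A]setCK; apply: measurableC.
by apply: open_measurable_rV; exact: closed_openC.
Qed.

Lemma measurable_eball x r : measurable (eball x r).
Proof. by apply: measurable_closed; exact: eball_closed. Qed.

End euclidean_norm.

(** * Volumes of Euclidean balls *)

Section ball_volume.
Context {R : realType}.
Local Open Scope ereal_scope.

Definition cube n (r : R) : set 'rV[R]_n := [set v | forall i, (`|v ord0 i| < r)%R].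

Lemma measurable_cube n r : measurable (@cube n r).
Proof.
rewrite (_ : cube r = \bigcap_(i in [set: 'I_n]) (rV_coord i @^-1` ball 0%R r)).
  apply: fin_bigcap_measurable => // i _.
  rewrite -[X in measurable X]setTI; apply: measurable_rV_coord => //.
  by apply: open_measurable; exact: ball_open.
apply/seteqP; split => [v vr i _|v vr i].
  by rewrite /= /ball /= sub0r normrN; exact: vr.
by have := vr i I; rewrite /= /ball /= sub0r normrN.
Qed.

Lemma lebesgue_cube n (r : R) : (0 < r)%R -> lebesgue_rV R n (cube r) = ((2 * r) ^+ n)%:E.
Proof.
move=> r0; elim: n => [|n IH].
  rewrite expr0 /= diracE mem_set //; by case.
rewrite [LHS]/= /lebesgue_rVS /pushforward.
rewrite (_ : _ @^-1` _ = ball (0 : R)%R r `*` cube r).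
  rewrite product_measure1E; last 2 first.
  - by apply: open_measurable; exact: ball_open.
  - exact: measurable_cube.
  transitivity ((2 * r)%:E * ((2 * r) ^+ n)%:E); last by rewrite -EFinM exprS.
  congr (_ * _); last exact: IH.
  by have := lebesgue_measure_ball 0%R (ltW r0); rewrite mulr_natl.
apply/seteqP; split => -[x v] /=; rewrite /ball /= sub0r normrN /cube /=.
  move=> H; split.
    by have := H (lshift n (ord0 : 'I_1)); rewrite (rV_consEl (_, _)).
  by move=> i; have := H (rshift 1 i : 'I_n.+1); rewrite (rV_consEr (_, _)).
move=> [H1 H2] i; case: (@splitP 1 n i) => j ij.
  have -> : i = lshift n j by exact/val_inj.
  by rewrite (rV_consEl (_, _)).
have -> : i = rshift 1 j by exact/val_inj.
by rewrite (rV_consEr (_, _)).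
Qed.

Context {n : nat}.
Local Notation E := 'rV[R]_n.
Local Notation lam := (lebesgue_rV R n).

Lemma eball_cube (r s : R) : (r < s)%R -> @eball R n 0 r `<=` cube s.
Proof.
move=> rs v; rewrite /eball /= subr0 => vr i.
by rewrite (le_lt_trans (ler_coord_enorm v i))// (le_lt_trans vr).
Qed.

Definition vol (r : R) : R := fine (lam (eball 0%R r)).

Lemma lebesgue_eball x (r : R) : lam (eball x r) = (vol r)%:E.
Proof.
rewrite /vol fineK; last first.
  rewrite ge0_fin_numE ?measure_ge0// (@le_lt_trans _ _ (lam (cube (`|r| + 1)%R)))//.
    rewrite le_measure ?inE; [by []|exact: measurable_eball|exact: measurable_cube|].
    by apply: eball_cube; rewrite (le_lt_trans (ler_norm r))// ltrDl.
  by rewrite lebesgue_cube ?ltry// ltr_wpDl.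
rewrite -[RHS](@lebesgue_rV_translate _ _ (- x)%R); last exact: measurable_eball.
by congr (lam _); apply/funext => z; rewrite /eball /= subr0.
Qed.

(** Dilation of the unit ball; it turns the quotient of volumes in Harnack's inequality into a power
    of the quotient of radii. *)
Lemma volE (r : R) : (0 < r)%R -> vol r = (r ^+ n * vol 1)%R.
Proof.
move=> r0; have := lebesgue_rV_affine (0 : E)%R r0 (measurable_eball 0%R r).
rewrite lebesgue_eball (_ : _ @^-1` _ = eball 0%R 1); last first.
  apply/funext => z; rewrite /eball /affine /= addr0 !subr0 enormZ gtr0_norm//.
  by rewrite -[X in (_ <= X)%R]mulr1 ler_pM2l.
by rewrite lebesgue_eball -EFinM => -[].
Qed.

Lemma vol_gt0 (r : R) : (0 < r)%R -> (0 < vol r)%R.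
Proof.
move=> r0; rewrite -lte_fin -(lebesgue_eball 0%R).
(* The cube with this half-side lies in the ball, as [enorm] is at most n times the sup norm; [n.+1]
   avoids a division by 0 for n = 0. *)
have s0 : (0 < r / n.+1%:R)%R by rewrite divr_gt0.
apply: (@lt_le_trans _ _ (lam (cube (r / n.+1%:R)%R))).
  by rewrite lebesgue_cube // lte_fin exprn_gt0 // mulr_gt0.
rewrite le_measure ?inE; [by []|exact: measurable_cube|exact: measurable_eball|].
move=> v vs; rewrite /eball /= subr0 (le_trans (ler_enorm_norm _))//.
have : (`|v| <= r / n.+1%:R)%R.
  rewrite /Num.Def.normr /= mx_normrE; apply/bigmax_leP; split; first exact: ltW.
  by move=> [i j] _ /=; rewrite ord1 ltW// vs.
rewrite ler_pdivlMr// mulrC => /(le_trans _); apply.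
by rewrite ler_wpM2r// ler_nat.
Qed.

Lemma lebesgue_compact (F : set E) : compact F -> lam F < +oo.
Proof.
move=> cF; have [M [_ FM]] := compact_bounded cF.
have {}FM := FM (M + 1)%R (ltr_pwDr ltr01 (lexx _)).
apply: (@le_lt_trans _ _ (lam (eball 0%R (n%:R * (M + 1))%R))); last first.
  by rewrite lebesgue_eball ltry.
rewrite le_measure ?inE; [by []| |exact: measurable_eball|].
  by apply: measurable_closed; apply: compact_closed => //; exact: norm_hausdorff.
move=> v /FM vM; rewrite /eball /= subr0 (le_trans (ler_enorm_norm _))//.
by rewrite ler_wpM2l.
Qed.

Lemma measurable_rV_set1 (x : E) : measurable [set x].
Proof.
apply: measurable_closed; apply: compact_closed; first exact: norm_hausdorff.
exact: compact_set1.
Qed.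

(** The map z |-> 2 z - x has {x} as the preimage of {x}, so the finite measure of {x} equals 2^n
    times itself, and 2^n <> 1. *)
Lemma lebesgue_set1 (x : E) : (0 < n)%N -> lam [set x] = 0.
Proof.
move=> n0; have m1 := measurable_rV_set1 x.
have : lam [set x] \is a fin_num.
  by rewrite ge0_fin_numE ?measure_ge0 // lebesgue_compact //; exact: compact_set1.
have := lebesgue_rV_affine (- x)%R (ltr0n R 2) m1.
rewrite (_ : _ @^-1` _ = [set x]); last first.
  apply/funext => z; rewrite /affine/= ; apply/propext; split => [zx|->].
    have : (2 : R) *: z = (2 : R) *: x by move/(congr1 (fun t => t + x)%R): zx;
      rewrite subrK => ->; rewrite scaler_nat mulr2n.
    by move/scalerI; apply.
  by rewrite scaler_nat mulr2n addrK.
case: (lam [set x]) => // r /eqP; rewrite -EFinM eqe => + _.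
have : (2 ^+ n != 1 :> R)%R by rewrite gt_eqF // exprn_egt1 // -?lt0n // ltr1n.
rewrite -subr_eq0 => c0 /eqP rr; congr EFin; apply: (mulfI c0).
by rewrite mulr0 mulrBl rr mul1r subrr.
Qed.

End ball_volume.
Arguments vol {R} n r.
Arguments vol_gt0 {R} n {r}.
Arguments eball_compact {R n} x r.

(** * Harmonic functions *)

Section continuous_functions.
Context {R : realType} {n : nat}.
Local Notation E := 'rV[R]_n.
Local Notation lam := (lebesgue_rV R n).
Implicit Types (A F D O : set E) (u v h : E -> R) (x y z : E).

Lemma measurable_compact F : compact F -> measurable F.
Proof.
by move=> cF; apply: measurable_closed; apply: compact_closed => //; exact: norm_hausdorff.
Qed.

Lemma measurable_continuous A u : measurable A ->
  (forall x, A x -> {for x, continuous u}) -> measurable_fun A u.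
Proof.
move=> mA cu _; apply: (measurability _ (RGenOpens.measurableE R)) => //.
move=> _ [_ [a [b ->] <-]].
(* Continuity at the points of [A] refers to neighbourhoods in the whole space, so the part of the
   preimage in [A] lies in its interior. *)
rewrite (_ : A `&` _ = A `&` (u @^-1` `]a, b[%classic)^°).
  by apply: measurableI => //; apply: open_measurable_rV; exact: open_interior.
apply/seteqP; split => x [Ax ux]; split => //; last exact: interior_subset ux.
by apply: cu => //; apply: open_nbhs_nbhs; split => //; exact: interval_open.
Qed.

Lemma compact_bounded_continuous F u : compact F ->
  (forall x, F x -> {for x, continuous u}) ->
  exists2 M, 0 < M & forall x, F x -> `|u x| <= M.
Proof.
move=> cF cu.
have : compact (u @` F).
  by apply: continuous_compact => //; apply: continuous_in_subspaceT => x /set_mem /cu.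
move=> /compact_bounded[M [_ FM]]; exists (`|M| + 1); first by rewrite ltr_wpDl.
move=> x Fx; apply: FM; last by exists x.
by rewrite (le_lt_trans (ler_norm _))// ltrDl.
Qed.

Lemma integrable_continuous F u : compact F ->
  (forall x, F x -> {for x, continuous u}) -> lam.-integrable F (EFin \o u).
Proof.
move=> cF cu; apply: measurable_bounded_integrable.
- exact: measurable_compact.
- exact: lebesgue_compact.
- by apply: measurable_continuous => //; exact: measurable_compact.
- have [M M0 FM] := compact_bounded_continuous cF cu.
  exists M; split; first exact: num_real.
  by move=> N MN x Fx /=; rewrite (le_trans (FM _ Fx))// ltW.
Qed.

Definition rmean u x (r : R) : R := (vol n r)^-1 * \int[lam]_(z in eball x r) u z.

Lemma ball_meanE u x (r : R) : lam.-integrable (eball x r) (EFin \o u) ->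
  ball_mean (EFin \o u) x r = (rmean u x r)%:E.
Proof.
move=> iu; rewrite /ball_mean /rmean EFinM -[in RHS]/(fine _) fineK; last first.
  by apply: integrable_fin_num => //; exact: measurable_eball.
by rewrite lebesgue_eball.
Qed.

Lemma harmonic_continuous D h x : harmonic D h -> D x -> {for x, continuous h}.
Proof. by move=> [ch _] /ch. Qed.

Lemma harmonic_rmean D h x r : harmonic D h -> 0 < r -> eball x r `<=` D ->
  h x = rmean h x r.
Proof.
move=> [ch mh] r0 rD; apply: EFin_inj; rewrite (mh x r r0 rD) ball_meanE//.
by apply: integrable_continuous => [|z /rD/ch//]; exact: eball_compact.
Qed.

Lemma harmonicP D h : (forall x, D x -> {for x, continuous h}) ->
  (forall x r, 0 < r -> eball x r `<=` D -> h x = rmean h x r) -> harmonic D h.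
Proof.
move=> ch mh; split => // x r r0 rD; rewrite ball_meanE -?(mh x r r0 rD)//.
by apply: integrable_continuous => [|z /rD/ch//]; exact: eball_compact.
Qed.

Lemma harmonicS D O h : O `<=` D -> harmonic D h -> harmonic O h.
Proof.
move=> OD [ch mh]; split => [x /OD/ch//|x r r0 rO].
by apply: mh => //; exact: subset_trans OD.
Qed.

Lemma rmean_cst (c : R) x r : 0 < r -> rmean (cst c) x r = c.
Proof.
move=> r0; rewrite /rmean Rintegral_cst; last exact: measurable_eball.
rewrite [fine _](congr1 fine (lebesgue_eball x r)) /=.
by rewrite mulrCA mulVf ?mulr1// gt_eqF// vol_gt0.
Qed.

Lemma harmonic_cst D (c : R) : harmonic D (cst c).
Proof.
apply: harmonicP => [x _|x r r0 _]; first exact: cst_continuous.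
by rewrite rmean_cst.
Qed.

Lemma harmonicZ D (a : R) u : harmonic D u -> harmonic D (fun x => a * u x).
Proof.
move=> hu; apply: harmonicP => [x Dx|x r r0 rD].
  by apply: continuousM; [exact: cst_continuous|exact: harmonic_continuous hu Dx].
rewrite (harmonic_rmean hu r0 rD) /rmean RintegralZl; first by rewrite mulrCA.
  exact: measurable_eball.
by apply: integrable_continuous => [|z /rD]; [exact: eball_compact|case: hu => + _; exact].
Qed.

Lemma harmonicB D u v : harmonic D u -> harmonic D v -> harmonic D (fun x => u x - v x).
Proof.
move=> hu hv; apply: harmonicP => [x Dx|x r r0 rD].
  by apply: continuousB; [exact: harmonic_continuous hu Dx|exact: harmonic_continuous hv Dx].
rewrite (harmonic_rmean hu r0 rD) (harmonic_rmean hv r0 rD) /rmean RintegralB; first by rewrite mulrBr.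
- exact: measurable_eball.
- by apply: integrable_continuous => [|z /rD]; [exact: eball_compact|case: hu => + _; exact].
- by apply: integrable_continuous => [|z /rD]; [exact: eball_compact|case: hv => + _; exact].
Qed.

Lemma harmonic_le_integral D u x r : harmonic D u -> 0 < r -> eball x r `<=` D ->
  (`|u x|%:E * (vol n r)%:E <= \int[lam]_(z in eball x r) `|u z|%:E)%E.
Proof.
move=> hu r0 rD; rewrite {1}(harmonic_rmean hu r0 rD) /rmean normrM ger0_norm; last first.
  by rewrite invr_ge0 ltW// vol_gt0.
have iu : lam.-integrable (eball x r) (EFin \o u).
  by apply: integrable_continuous => [|z /rD]; [exact: eball_compact|case: hu => + _; exact].
rewrite -EFinM mulrAC mulVf ?mul1r ?gt_eqF ?vol_gt0//.
rewrite EFin_normr_Rintegral//; last exact: measurable_eball.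
apply: le_abse_integral; first exact: measurable_eball.
exact: measurable_int iu.
Qed.

(* Harnack's inequality follows from the inclusion of the ball of radius r - d
   at y in the ball of radius r at x. *)
Lemma harnack D u x y (r d : R) : harmonic D u -> (forall z, eball x r z -> u z <= 0) ->
  0 <= d < r -> eball x r `<=` D -> enorm (y - x) <= d ->
  - u y <= (r / (r - d)) ^+ n * - u x.
Proof.
move=> hu u0 /andP[d0 dr] rD yx.
have rd0 : 0 < r - d by rewrite subr_gt0.
have r0 : 0 < r by exact: le_lt_trans dr.
have yr : eball y (r - d) `<=` eball x r.
  by apply: eball_sub; lra.
have yD : eball y (r - d) `<=` D by exact: subset_trans rD.
have V0 := vol_gt0 n rd0; have W0 := vol_gt0 n r0.
rewrite (harmonic_rmean hu r0 rD) (harmonic_rmean hu rd0 yD) /rmean.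
rewrite [vol n (r - d)]volE// [vol n r]volE//.
have v10 := @vol_gt0 R n 1 ltr01.
rewrite expr_div_n -!mulrN !invfM !mulrA.
rewrite [leRHS](_ : _ = (r - d) ^- n / vol n 1 * - \int[lam]_(z in eball x r) u z); last first.
  by field; rewrite !gt_eqF ?exprn_gt0.
apply: ler_wpM2l; first by rewrite mulr_ge0 ?invr_ge0 ?exprn_ge0// ltW.
have iu B : compact B -> B `<=` D -> lam.-integrable B (EFin \o u).
  by move=> cB BD; apply: integrable_continuous => // z /BD; case: hu => + _; exact.
have cx := eball_compact x r; have cy := eball_compact y (r - d).
rewrite -![- Rintegral _ _ _]mulN1r -!RintegralZl; [|exact: measurable_eball|exact: iu|exact: measurable_eball|exact: iu].
rewrite /Rintegral fine_le//.
- apply: integrable_fin_num; first exact: measurable_eball.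
  rewrite (_ : (fun _ => _) = (fun z => (-1)%:E * (EFin \o u) z)%E)//.
  by apply: integrableZl; [exact: measurable_eball|exact: iu].
- apply: integrable_fin_num; first exact: measurable_eball.
  rewrite (_ : (fun _ => _) = (fun z => (-1)%:E * (EFin \o u) z)%E)//.
  by apply: integrableZl; [exact: measurable_eball|exact: iu].
apply: ge0_subset_integral => //.
- exact: measurable_eball.
- exact: measurable_eball.
- apply/measurable_EFinP; apply: measurable_funM => //.
  by have /measurable_int/measurable_EFinP := iu _ cx rD.
- by move=> z xz; rewrite lee_fin mulN1r oppr_ge0 u0.
Qed.

Lemma weight_lower_bound D phi F : weight D phi -> compact F -> F `<=` D ->
  exists2 c, 0 < c & forall x, F x -> c <= phi x.
Proof.
move=> [cphi phi0] cF FD.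
have [[x Fx]|F0] := pselect (F !=set0); last first.
  by exists 1 => // x Fx; exfalso; apply: F0; exists x.
have [||c cF' cmin] := @EVT_min_rV R n phi F _ cF.
- by exists x.
- exact: continuous_subspaceW cphi.
exists (phi c); first by apply/phi0/FD/set_mem.
by move=> z Fz; apply: cmin; exact/mem_set.
Qed.

Lemma weight_upper_bound D phi F : weight D phi -> compact F -> F `<=` D ->
  exists2 c, 0 < c & forall x, F x -> phi x <= c.
Proof.
move=> [cphi phi0] cF FD.
have : compact (phi @` F).
  by apply: continuous_compact => //; exact: continuous_subspaceW cphi.
move=> /compact_bounded[M [_ FM]]; exists (`|M| + 1); first by rewrite ltr_wpDl.
move=> x Fx; apply: le_trans (ler_norm _) _; apply: FM; last by exists x.
by rewrite (le_lt_trans (ler_norm _))// ltrDl.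
Qed.

(** The mean value at y is taken over [eball y (r / 2)], which stays in [eball x r], where the
    weight has a lower bound c. Harmonicity is asked on [O] only, so that the bound applies to a
    Green function on D minus its pole while the norm is taken over D. *)
Lemma harmonic_le_wnorm D phi x (r : R) : open D -> weight D phi ->
  0 < r -> eball x r `<=` D ->
  exists2 C, 0 < C & forall O u, measurable_fun D u -> eball x r `<=` O ->
    harmonic O u -> forall y, eball x (r / 2) y ->
    (`|u y|%:E <= C%:E * wnorm D phi (EFin \o u))%E.
Proof.
move=> oD wphi r0 rD.
have [c c0 cphi] := weight_lower_bound wphi (eball_compact x r) rD.
have r20 : 0 < r / 2 by rewrite divr_gt0.
have V0 := vol_gt0 n r20.
exists ((c * vol n (r / 2))^-1); first by rewrite invr_gt0 mulr_gt0.
move=> O u mu rO hu y xy.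
have yr : eball y (r / 2) `<=` eball x r.
  by apply: eball_sub; move: xy; rewrite /eball /=; lra.
rewrite muleC -lee_pdivrMr ?invr_gt0 ?mulr_gt0// invrK mulrC EFinM muleA.
have mD : measurable D by exact: open_measurable_rV.
have mf : measurable_fun D (fun z => `|u z|%:E * (phi z)%:E)%E.
  exact: (measurable_wnorm oD wphi mu).
apply: (@le_trans _ _ (c%:E * \int[lam]_(z in eball y (r / 2)) `|u z|%:E)%E).
  rewrite muleC; apply: lee_wpmul2l; first by rewrite lee_fin ltW.
  by apply: (harmonic_le_integral hu) => //; exact: subset_trans rO.
rewrite -ge0_integralZl//; last 3 first.
- exact: measurable_eball.
- apply: (@measurable_funS _ _ _ _ D) => //; first by apply: subset_trans rD.
  by do 2 apply: measurableT_comp => //.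
- by rewrite lee_fin ltW.
rewrite /wnorm; apply: (@le_trans _ _ (\int[lam]_(z in eball y (r / 2)) (`|u z|%:E * (phi z)%:E))%E).
  apply: ge0_le_integral => //.
  - exact: measurable_eball.
  - by move=> z _; rewrite -EFinM lee_fin mulr_ge0// ltW.
  - apply: emeasurable_funM => //; apply: (@measurable_funS _ _ _ _ D) => //; first by apply: subset_trans rD.
    by do 2 apply: measurableT_comp => //.
  - apply: measurable_funS mf => //; by apply: subset_trans rD.
  - by move=> z /yr xz; rewrite muleC; apply: lee_wpmul2l; rewrite lee_fin// cphi.
apply: ge0_subset_integral => //.
- exact: measurable_eball.
- by move=> z Dz; rewrite mule_ge0// lee_fin ltW// wphi.2.
- exact: subset_trans rD.
Qed.

End continuous_functions.

(** * The fundamental function *)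

(** Induction from p^(k+1) - q^(k+1) = p (p^k - q^k) + q^k (p - q). It serves the fundamental
    function for n >= 3 and the factor in Harnack's inequality. *)
Lemma exprn_sub_le {R : realFieldType} (S : R) k : 0 <= S -> exists2 C, 0 <= C &
  forall p q, 0 <= p <= S -> 0 <= q <= S -> `|p ^+ k - q ^+ k| <= C * `|p - q|.
Proof.
move=> S0; elim: k => [|k [C C0 IH]].
  by exists 0 => // p q _ _; rewrite !expr0 subrr normr0 mul0r.
exists (S * C + S ^+ k); first by rewrite addr_ge0 ?mulr_ge0 ?exprn_ge0.
move=> p q pS qS; have /andP[p0 pS'] := pS; have /andP[q0 qS'] := qS.
rewrite (_ : _ - _ = p * (p ^+ k - q ^+ k) + q ^+ k * (p - q)); last by rewrite !exprS; ring.
rewrite (le_trans (ler_normD _ _))// mulrDl lerD// normrM ger0_norm ?exprn_ge0//.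
  by rewrite -mulrA ler_pM// IH.
by rewrite ler_wpM2r// lerXn2r.
Qed.

Section fundamental_solution.
Context {R : realType} {n : nat}.
Local Notation E := 'rV[R]_n.
Local Notation lam := (lebesgue_rV R n).
Local Notation f := (@fundamental R n).
Hypothesis n_gt0 : (0 < n)%N.
Implicit Types z : E.

Lemma fundamental_fin_num z : z != 0 -> f z \is a fin_num.
Proof. by move=> /negbTE z0; rewrite /fundamental z0; case: ifP => //; case: ifP. Qed.

Lemma fundamental_leN (M : R) : n != 1%N ->
  exists2 r, 0 < r & forall z, enorm z <= r -> (f z <= (- M)%:E)%E.
Proof.
move=> n1; have [n2|n2] := boolP (n == 2%N).
  exists (expR (- M)); first exact: expR_gt0.
  move=> z zM; rewrite /fundamental (negbTE n1); case: ifPn => [_|z0]; first exact: leNye.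
  rewrite -(enorm_gt0 z) in z0.
  by rewrite n2 lee_fin -ler_expR lnK.
(* Here n >= 3. On this ball |z| <= 1, so |z|^-(n - 2) is at least |z|^-1, hence at least |M| +
   1. *)
have M1 : 0 < `|M| + 1 by rewrite ltr_wpDl.
exists (`|M| + 1)^-1; first by rewrite invr_gt0.
move=> z zM; rewrite /fundamental (negbTE n1); case: ifPn => [_|z0]; first exact: leNye.
rewrite -(enorm_gt0 z) in z0.
rewrite (negbTE n2) lee_fin lerN2 (le_trans (ler_norm M))// -exprVn.
have zM' : `|M| + 1 <= (enorm z)^-1.
  by rewrite -[leLHS]invrK lef_pV2// posrE invr_gt0.
apply: (@le_trans _ _ (enorm z)^-1); first by rewrite (le_trans _ zM')// lerDl.
have [k ->] : exists k, (n - 2 = k.+1)%N.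
  have n3 : (2 < n)%N by rewrite ltn_neqAle eq_sym n2 ltn_neqAle eq_sym n1.
  by exists (n - 3)%N; rewrite -subSn// subSS.
rewrite exprS; apply: ler_peMr; first by rewrite invr_ge0 enorm_ge0.
by apply: exprn_ege1; rewrite (le_trans _ zM')// lerDr.
Qed.

(** A bound on the slope outside radius s: 1 for n = 1, 1 / s for the logarithm by ln t <= t - 1,
    and C / s^2 for n >= 3, where C is a Lipschitz constant of the power on [0, 1 / s]. For n = 1
    the bound holds up to the pole, hence the disjunction. *)
Lemma fundamental_near (s e : R) : 0 < s -> 0 < e -> exists2 d, 0 < d &
  forall z z', n = 1%N \/ s <= enorm z /\ s <= enorm z' -> enorm (z - z') <= d ->
    [/\ f z \is a fin_num, f z' \is a fin_num & `|fine (f z) - fine (f z')| <= e].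
Proof.
move=> s0 e0; have [n1|n1] := boolP (n == 1%N).
  exists e => // z z' _ zz'; rewrite /fundamental n1; split => //=.
  by rewrite (le_trans (ler_dist_enorm _ _)).
have zne z : s <= enorm z -> z != 0.
  by move=> /(lt_le_trans s0); rewrite enorm_gt0.
have [n2|n2] := boolP (n == 2%N).
  exists (e * s); first by rewrite mulr_gt0.
  move=> z z' [/eqP|[sz sz'] zz']; first by rewrite (negbTE n1).
  rewrite !fundamental_fin_num ?zne//; split => //.
  rewrite /fundamental (negbTE n1) !(negbTE (zne _ _))// n2 /=.
  have H (a b : R) : s <= a -> s <= b -> a - b <= e * s -> ln a - ln b <= e.
    move=> sa sb ab; have a0 := lt_le_trans s0 sa; have b0 := lt_le_trans s0 sb.
    rewrite -ln_div ?posrE//; apply: (@le_trans _ _ (a / b - 1)).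
      by rewrite -[leLHS](_ : ln (1 + (a / b - 1)) = _) ?le_ln1Dx// ?ltrBDr ?addNr ?divr_gt0//; congr ln; ring.
    rewrite -[X in _ - X](divff (lt0r_neq0 b0)) -mulrBl ler_pdivrMr//.
    by rewrite (le_trans ab)// ler_pM2l.
  rewrite ler_norml lerNl opprB !H//.
    by rewrite (le_trans _ zz')// (le_trans (ler_norm _))// ler_dist_enorm.
  by rewrite (le_trans _ zz')// (le_trans (ler_norm _))// distrC ler_dist_enorm.
have sV0 : 0 <= s^-1 by rewrite invr_ge0 ltW.
have [C C0 HC] := exprn_sub_le (n - 2) sV0.
exists (e * s ^+ 2 / (C + 1)).
  by rewrite divr_gt0 ?mulr_gt0 ?exprn_gt0// ltr_wpDl.
move=> z z' [/eqP|[sz sz'] zz']; first by rewrite (negbTE n1).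
rewrite !fundamental_fin_num ?zne//; split => //.
rewrite /fundamental (negbTE n1) !(negbTE (zne _ _))// (negbTE n2) /=.
have a0 := lt_le_trans s0 sz; have b0 := lt_le_trans s0 sz'.
rewrite opprK addrC -!exprVn. rewrite (le_trans (HC _ _ _ _))//.
- by rewrite invr_ge0 ltW//= lef_pV2.
- by rewrite invr_ge0 ltW//= lef_pV2.
rewrite (_ : _ - _ = (enorm z - enorm z') / (enorm z * enorm z')); last first.
  by field; rewrite !gt_eqF.
rewrite normrM [X in _ * (_ * X)]ger0_norm; last by rewrite invr_ge0 mulr_ge0// ltW.
have {}zz' : `|enorm z - enorm z'| <= e * s ^+ 2 / (C + 1).
  by rewrite (le_trans _ zz')// ler_dist_enorm.
have C1 : 0 < C + 1 by rewrite ltr_wpDl.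
apply: (@le_trans _ _ ((C + 1) * (e * s ^+ 2 / (C + 1) / (s ^+ 2)))).
  apply: ler_pM => //; [|by rewrite lerDl|].
    by rewrite mulr_ge0// invr_ge0 mulr_ge0// ltW.
  apply: ler_pM => //; first by rewrite invr_ge0 mulr_ge0// ltW.
  by rewrite lef_pV2 ?posrE ?mulr_gt0 ?exprn_gt0// expr2 ler_pM// ltW.
rewrite le_eqVlt; apply/orP; left; apply/eqP; field.
by rewrite !gt_eqF.
Qed.

(* Uniform continuity of the fundamental function with values in [-oo, +oo[. *)
Lemma fundamental_dichotomy (M e r : R) : 0 < e -> 0 < r -> exists2 d, 0 < d &
  forall z z', enorm (z - z') <= d ->
    [/\ enorm z <= r, enorm z' <= r, (f z <= (- M)%:E)%E & (f z' <= (- M)%:E)%E] \/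
    [/\ f z \is a fin_num, f z' \is a fin_num & `|fine (f z) - fine (f z')| <= e].
Proof.
move=> e0 r0; have [n1|n1] := boolP (n == 1%N).
  have [d d0 H] := fundamental_near r0 e0; exists d => // z z' zz'; right.
  by apply: H => //; left; exact/eqP.
have [t t0 Ht] := fundamental_leN M n1.
(* With |z - z'| <= s / 4, either |z| <= s / 2 and both points lie in the ball of radius s, or both
   keep distance s / 4 from 0. *)
pose s := Num.min t r; have s0 : 0 < s by rewrite lt_min t0.
have s40 : 0 < s / 4 by rewrite divr_gt0.
have [d d0 Hd] := fundamental_near s40 e0.
exists (Num.min d (s / 4)); first by rewrite lt_min d0.
move=> z z'; rewrite le_min => /andP[zd zs].
have h1 := ler_enormB z z'; have h2 := ler_enormB z' z.
rewrite enorm_distC in h2.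
have [zs2|zs2] := leP (enorm z) (s / 2).
  have [st sr] : s <= t /\ s <= r by rewrite !ge_min !lexx orbT.
  by left; split; [| |apply: Ht|apply: Ht]; lra.
by right; apply: Hd => //; right; split; lra.
Qed.

Lemma fine_fundamental_continuous z : z != 0 -> {for z, continuous (fine \o f)}.
Proof.
rewrite -enorm_gt0 => z0; apply/(@cvgrPdist_le _ _ _ (nbhs z) (nbhs_filter z)) => e e0.
have z20 : 0 < enorm z / 2 by rewrite divr_gt0.
have [d d0 Hd] := fundamental_near z20 e0.
have s0 : 0 < Num.min d (enorm z / 2) by rewrite lt_min d0.
apply: filterS (nbhs_eball z s0) => z'; rewrite /eball/= le_min enorm_distC => /andP[zd zz].
have h1 := ler_enormB z z'.
by have [] := Hd z z' _ zd => //; right; split; lra.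
Qed.

Lemma measurable_fundamental : measurable_fun setT f.
Proof.
have m0 : measurable [set (0 : E)] := measurable_rV_set1 _.
rewrite -(setvU [set 0]); apply/measurable_funU => //; first exact: measurableC.
split; last exact: measurable_fun_set1.
apply: (eq_measurable_fun (EFin \o (fine \o f))).
  by move=> z /set_mem /eqP z0; rewrite /= fineK// fundamental_fin_num.
apply/measurable_EFinP; apply: measurable_continuous; first exact: measurableC.
by move=> z /eqP; exact: fine_fundamental_continuous.
Qed.

Lemma measurable_abse_fundamental (A : set E) : measurable_fun A (fun z => `|f z|%E).
Proof.
apply: measurableT_comp => //; apply: (@measurable_funTS _ _ _ _ A f).
exact: measurable_fundamental.
Qed.

(** A priori possibly +oo; [fundamental_mass_lty] derives finiteness from a Green function. *)
Definition fundamental_mass (r : R) : \bar R := (\int[lam]_(z in eball 0%R r) `|f z|)%E.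

Lemma fundamental_massE (y : E) r :
  (\int[lam]_(x in eball y r) `|f (x - y)| = fundamental_mass r)%E.
Proof.
rewrite /fundamental_mass -[RHS](ge0_integral_translate (- y)); last 3 first.
- exact: measurable_eball.
- exact: measurable_abse_fundamental.
- by [].
rewrite (_ : _ @^-1` _ = eball y r)//.
by apply/funext => x; rewrite /eball /= subr0.
Qed.

Lemma fundamental_mass_le r s : r <= s -> (fundamental_mass r <= fundamental_mass s)%E.
Proof.
move=> rs; apply: ge0_subset_integral => //.
- exact: measurable_eball.
- exact: measurable_eball.
- exact: measurable_abse_fundamental.
- exact: le_eball.
Qed.

(** If every small ball had mass above e, every annulus would have mass at most [fundamental_mass r]
    - e. By monotone convergence the punctured ball would too, and the centre is a null set. *)
Lemma fundamental_mass_small (r e : R) : 0 < r -> (fundamental_mass r < +oo)%E -> 0 < e ->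
  exists2 s, 0 < s <= r & (fundamental_mass s <= e%:E)%E.
Proof.
move=> r0 roo e0.
have rk0 k : 0 < r / k.+1%:R by rewrite divr_gt0.
pose F k := eball 0 r `\` eball (0 : E) (r / k.+1%:R).
have mF k : measurable (F k) by apply: measurableD; exact: measurable_eball.
have ndF : nondecreasing_seq F.
  move=> i j ij; apply/subsetPset => z [zr zi]; split => // zj; apply: zi.
  by apply: le_eball zj; rewrite ler_pM2l// lef_pV2 ?posrE// ler_nat ltnS.
have UF : \bigcup_k F k = eball 0 r `\` [set 0].
  apply/seteqP; split => z.
    move=> [k _ [zr zk]]; split => // z0; apply: zk.
    by rewrite z0; apply: eball_center; exact: ltW.
  move=> [zr z0]; have {}z0 : 0 < enorm z by rewrite enorm_gt0; exact/eqP.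
  have zr0 : 0 < enorm z / r by rewrite divr_gt0.
  have [k _ /(_ k (leqnn k)) /=] := near_infty_natSinv_lt (PosNum zr0).
  rewrite ltr_pdivlMr// mulrC => kz.
  by exists k => //; split => //; rewrite /eball /= subr0; apply/negP; rewrite -ltNge.
have JE k : fundamental_mass r =
    (\int[lam]_(z in F k) `|f z| + fundamental_mass (r / k.+1%:R))%E.
  have rk : eball 0 (r / k.+1%:R) `<=` eball (0 : E) r.
    by apply: le_eball; rewrite ler_pdivrMr// ler_peMr// ?ler1n// ltW.
  rewrite /fundamental_mass -(ge0_integral_setU _ (mF k) (measurable_eball _ _))//.
  - by rewrite setUC /F setDUK.
  - exact: measurable_abse_fundamental.
  - by apply/disj_setPS => z [[]].
apply: contrapT => H.
have J0 k : (0 <= fundamental_mass k)%E by exact: integral_ge0.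
have Jfin : fundamental_mass r \is a fin_num by rewrite ge0_fin_numE.
have Fle k : (\int[lam]_(z in F k) `|f z| <= fundamental_mass r - e%:E)%E.
  rewrite leeBrDr// [leRHS](JE k) leeD2l//.
  rewrite leNgt; apply/negP => Hk; apply: H; exists (r / k.+1%:R); last exact: ltW.
  by rewrite rk0 ler_pdivrMr// ler_peMr// ?ler1n// ltW.
have lim_le := ge0_nondecreasing_set_cvg_integral ndF mF (fun k => measurable_abse_fundamental (A := F k)) (fun _ z _ => abse_ge0 (f z)).
have : (\int[lam]_(z in \bigcup_k F k) `|f z| <= fundamental_mass r - e%:E)%E.
  by apply: cvge_le (lim_le lam); apply: nearW.
rewrite UF -(ge0_negligible_integral (measurable_rV_set1 _) (measurable_eball _ _))//; last 2 first.
- exact: measurable_abse_fundamental.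
- exact: lebesgue_set1.
rewrite -[X in (X <= _)%E]/(fundamental_mass r) -(fineK Jfin) -EFinB lee_fin; lra.
Qed.
End fundamental_solution.
Arguments fundamental_mass {R} n r.

(** * Green functions *)

Section green_functions.
Context {R : realType} {n : nat}.
Local Notation E := 'rV[R]_n.
Local Notation lam := (lebesgue_rV R n).
Local Notation f := (@fundamental R n).
Hypothesis n_gt0 : (0 < n)%N.
Context {D : set E} (hD : greenian D).
Implicit Types x y z : E.

Lemma measurable_fundamental_shift y (A : set E) : measurable_fun A (fun x => f (x - y)).
Proof.
have mT : measurable_fun [set: E] (fun x : E => x - y).
  have := measurable_rV_affine 1%R (- y); rewrite (_ : affine _ _ = fun x => x - y)//.
  by apply/funext => x; rewrite /affine scale1r.
have mf := @measurable_fundamental R n.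
have mfT := measurableT_comp mf mT.
apply: (@measurable_funTS _ _ _ _ A); exact: mfT.
Qed.

Lemma greenP y : D y -> is_green D y (fun x => green D x y).
Proof.
move=> Dy; rewrite /green; have [g gP] := hD.2 y Dy.
exact: (@xgetPex _ (fun=> -oo%E) [set g | is_green D y g]) (ex_intro _ g gP).
Qed.

(** [is_green] only asserts that a harmonic part exists; one is chosen here, with 0 as default. *)
Definition green_harmonic_part y : E -> R := xget (cst 0)
  [set h | Defs.harmonic D h /\ forall x, D x -> (green D x y = f (x - y) + (h x)%:E)%E].
Local Notation hp := green_harmonic_part.

Lemma green_harmonic_partP y : D y -> Defs.harmonic D (hp y) /\
  forall x, D x -> (green D x y = f (x - y) + (hp y x)%:E)%E.
Proof.
move=> /greenP[_ _ [h hh hE] _].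
exact: (@xgetPex _ (cst 0) [set h | Defs.harmonic D h /\ forall x, D x -> (green D x y = f (x - y) + (h x)%:E)%E])
  (ex_intro _ h (conj hh hE)).
Qed.

Lemma harmonic_green_harmonic_part y : D y -> harmonic D (hp y).
Proof. by move=> /green_harmonic_partP[]. Qed.

Lemma greenE x y : D x -> D y -> (green D x y = f (x - y) + (hp y x)%:E)%E.
Proof. by move=> Dx /green_harmonic_partP[_]; apply. Qed.

Lemma green_le0 x y : D x -> D y -> (green D x y <= 0)%E.
Proof. by move=> Dx /greenP[[_ + _] _ _ _]; apply. Qed.

Lemma green_fin_num x y : D x -> D y -> x != y -> green D x y \is a fin_num.
Proof. by move=> Dx Dy xy; rewrite greenE// fin_numD fundamental_fin_num// subr_eq0. Qed.

Lemma green_harmonic y : D y -> harmonic (D `\ y) (fun x => fine (green D x y)).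
Proof. by move=> /greenP[]. Qed.

Lemma green_negative_subharmonic y : D y -> negative_subharmonic D (fun x => green D x y).
Proof. by move=> /greenP[]. Qed.

Lemma fundamental_le_harmonic_part x y : D x -> D y -> (f (x - y) <= (- hp y x)%:E)%E.
Proof.
by move=> Dx Dy; have := green_le0 Dx Dy; rewrite greenE// EFinN -leeBrDr// sub0e.
Qed.

(* The harmonic part is the greatest harmonic minorant of - f(. - y), because
   the least harmonic majorant of the Green function is 0. *)
Lemma harmonic_part_max y (k : E -> R) : D y -> harmonic D k ->
  (forall x, D x -> (f (x - y) <= (- k x)%:E)%E) -> forall x, D x -> k x <= hp y x.
Proof.
move=> Dy hk fk x Dx; rewrite -subr_ge0.
have [_ _ _ H] := greenP Dy.
apply: (H (fun x => hp y x - k x)) => //; first by apply: harmonicB => //; exact: harmonic_green_harmonic_part.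
by move=> z Dz; rewrite greenE//= [hp y z - k z]addrC EFinD leeD2r// fk.
Qed.

Lemma measurable_green y : D y -> measurable_fun D (fun x => green D x y).
Proof.
move=> Dy; have oD := greenian_open hD; have mD := open_measurable_rV oD.
apply: (eq_measurable_fun (fun x => f (x - y) + (hp y x)%:E)%E).
  by move=> x /set_mem Dx; rewrite greenE.
apply: emeasurable_funD.
  exact: measurable_fundamental_shift.
apply/measurable_EFinP; apply: measurable_continuous => // x Dx.
exact: harmonic_continuous (harmonic_green_harmonic_part Dy) Dx.
Qed.

Section norming.
Context {phi : E -> R} (hphi : norming D phi).

Lemma ball_mean_cst (c : R) x r : 0 < r -> ball_mean (cst c%:E) x r = c%:E.
Proof.
move=> r0; rewrite -[cst _]/(EFin \o cst c) ball_meanE ?rmean_cst//.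
by apply: integrable_continuous => [|z _]; [exact: eball_compact|exact: cst_continuous].
Qed.

(** The constant -1 is a negative subharmonic function, to which condition (1) applies. *)
Lemma weight_integrable : (\int[lam]_(x in D) (phi x)%:E < +oo)%E.
Proof.
have [_ + _ _] := hphi => /(_ (cst (-1)%:E)); rewrite /wnorm.
under eq_integral do rewrite /= normrN normr1 mul1e.
apply; split => //.
- split; [by move=> x _; rewrite ltry| |].
    by move=> x _ a H; apply: filterS (nbhs_eball x ltr01) => z _; exact: H.
  by move=> x r r0 _; rewrite ball_mean_cst.
- by have [[[x Dx] _ _] _] := hD; exists x.
Qed.

Lemma phi_gt0 x : D x -> 0 < phi x.
Proof. by have [[_ +] _ _ _] := hphi; exact. Qed.

Lemma green_norm_lty y : D y -> (green_norm D phi y < +oo)%E.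
Proof. by move=> Dy; have [_ + _ _] := hphi; apply; exact: green_negative_subharmonic. Qed.

Lemma measurable_phi : measurable_fun D phi.
Proof. by apply: measurable_weight; [exact: greenian_open hD|case: hphi]. Qed.

Let mD : measurable D. Proof. by apply: open_measurable_rV; exact: greenian_open hD. Qed.

(** On the ball f(. - y) is a Green function minus [hp y]. The former is integrable because its norm
    is finite and the weight is bounded below there, the latter because it is continuous. *)
Lemma fundamental_mass_lty y r : D y -> eball y r `<=` D -> (fundamental_mass n r < +oo)%E.
Proof.
move=> Dy rD; rewrite -(fundamental_massE y).
have [c c0 cphi] := weight_lower_bound (norming_weight hphi) (eball_compact y r) rD.
have cB := eball_compact y r; have mB := measurable_eball y r.
have mG := measurable_green Dy.
have mGB : measurable_fun (eball y r) (fun x => green D x y) by exact: measurable_funS mG.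
have mphi := measurable_phi.
have ih : lam.-integrable (eball y r) (EFin \o hp y).
  apply: integrable_continuous => // z /rD; exact: harmonic_continuous (harmonic_green_harmonic_part Dy).
have mh := measurable_int _ ih.
apply: (@le_lt_trans _ _ (\int[lam]_(x in eball y r) (`|green D x y| + `|(hp y x)%:E|))%E).
  apply: ge0_le_integral => //.
  - apply: measurableT_comp => //.
    apply: (eq_measurable_fun (fun x => green D x y - (hp y x)%:E)%E).
      by move=> x /set_mem /rD Dx; rewrite greenE// addeK.
    by apply: emeasurable_funB.
  - by apply: emeasurable_funD; apply: measurableT_comp.
  - move=> x /rD Dx; rewrite (_ : f (x - y) = green D x y - (hp y x)%:E)%E.
      by rewrite (le_trans (lee_abs_sub _ _)).
    by rewrite greenE// addeK.
rewrite ge0_integralD//; last 2 first.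
- by apply: measurableT_comp.
- by apply: measurableT_comp.
apply: lte_add_pinfty; last by have /integrableP[_] := ih.
rewrite -(@lte_pmul2l _ c%:E)// gt0_muley// -ge0_integralZl//; last 2 first.
- by apply: measurableT_comp.
- by rewrite lee_fin ltW.
apply: le_lt_trans (green_norm_lty Dy).
apply: (@le_trans _ _ (\int[lam]_(x in eball y r) (`|green D x y| * (phi x)%:E)))%E.
  apply: ge0_le_integral => //.
  - by move=> x _; rewrite mule_ge0// lee_fin ltW.
  - apply: emeasurable_funM => //; by apply: measurableT_comp.
  - apply: emeasurable_funM; first by apply: measurableT_comp.
    by apply/measurable_EFinP; exact: measurable_funS mphi.
  - by move=> x xB; rewrite muleC; apply: lee_wpmul2l; rewrite // lee_fin cphi.
apply: ge0_subset_integral => //.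
- apply: emeasurable_funM; first by apply: measurableT_comp.
  by apply/measurable_EFinP.
- by move=> x Dx; rewrite mule_ge0// lee_fin ltW// phi_gt0.
Qed.

(** [hp y'] lies below - f(. - y'), so its mean over [eball x r] is at most the mass of f over a
    ball about y'. This mass is the same for all centres, which makes the bound uniform in y'. *)
Lemma harmonic_part_bounded y (r : R) : D y -> 0 < r -> eball y (3 * r) `<=` D ->
  exists M : R, forall y' x, enorm (y' - y) <= r -> enorm (x - y') <= r -> enorm (x - y) <= r -> hp y' x <= M.
Proof.
move=> Dy r0 rD.
have massoo := fundamental_mass_lty Dy rD.
have mass0 : (0 <= fundamental_mass n (3 * r))%E by exact: integral_ge0.
exists ((vol n r)^-1 * fine (fundamental_mass n (3 * r))) => y' x y'y xy' xy.
have Dy' : D y' by apply: rD; rewrite /eball /=; lra.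
have xrD : eball x r `<=` D.
  by apply: subset_trans rD; apply: eball_sub; lra.
have xr' : eball x r `<=` eball y' (3 * r).
  by apply: eball_sub; lra.
rewrite (harmonic_rmean (harmonic_green_harmonic_part Dy') r0 xrD) /rmean.
apply: ler_wpM2l; first by rewrite invr_ge0 ltW// vol_gt0.
have mf' (A : set E) : measurable_fun A (fun z => f (z - y'))%E.
  exact: measurable_fundamental_shift.
have mx := measurable_eball x r.
have ih : lam.-integrable (eball x r) (EFin \o hp y').
  apply: integrable_continuous => [|z /xrD]; first exact: eball_compact.
  exact: harmonic_continuous (harmonic_green_harmonic_part Dy').
have le1 : (\int[lam]_(z in eball x r) `|f (z - y')| <= fundamental_mass n (3 * r))%E.
  rewrite -(fundamental_massE y'); apply: ge0_subset_integral => //.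
  - exact: measurable_eball.
  - by apply: measurableT_comp.
rewrite /Rintegral fine_le//.
- exact: integrable_fin_num.
- by rewrite ge0_fin_numE.
apply: le_trans le1; apply: le_integral => //.
  apply/integrableP; split; first by apply: measurableT_comp.
  under eq_integral do rewrite abse_id.
  apply: le_lt_trans massoo; rewrite -(fundamental_massE y'); apply: ge0_subset_integral => //.
  - exact: measurable_eball.
  - by apply: measurableT_comp.
move=> z /set_mem/xrD Dz.
have := fundamental_le_harmonic_part Dz Dy'.
rewrite EFinN leeNr => /le_trans; apply; rewrite -abseN; exact: lee_abs.
Qed.

Lemma harmonic_part_near y (e : R) : D y -> 0 < e -> exists2 d, 0 < d &
  forall y', enorm (y' - y) <= d -> D y' /\ forall x, D x -> `|hp y' x - hp y x| <= e.
Proof.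
move=> Dy e0.
have : nbhs y D by apply: open_nbhs_nbhs; split => //; exact: greenian_open hD.
move=> /nbhs_eballP[s s0 sD].
pose r := s / 3; have r0 : 0 < r by rewrite divr_gt0.
have r3D : eball y (3 * r) `<=` D by rewrite /r mulrC divfK.
have [M HM] := harmonic_part_bounded Dy r0 r3D.
(* [M] bounds the harmonic parts of all nearby poles and is fixed before [d]; then - f is at least
   [M] wherever the two fundamental functions may differ by more than e. *)
have [d d0 Hd] := fundamental_dichotomy n_gt0 M e0 r0.
exists (Num.min d r); first by rewrite lt_min d0.
move=> y'; rewrite le_min => /andP[y'd y'r].
have Dy' : D y' by apply: r3D; rewrite /eball /=; lra.
split => // x Dx.
(* hp a - e is a harmonic minorant of - f(. - b) *)
have key a b : D a -> D b -> enorm (a - y) <= r -> enorm (b - y) <= r -> enorm (a - b) <= d ->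
    (forall x, enorm (x - a) <= r -> enorm (x - b) <= r -> enorm (x - y) <= r) ->
    hp a x - e <= hp b x.
  move=> Da Db ar br ab tri.
  apply: (@harmonic_part_max b (fun x => hp a x - e)) => //.
    apply: harmonicB; [exact: harmonic_green_harmonic_part|exact: harmonic_cst].
  move=> z Dz; have [|[h1 h2 h3 h4]|[h1 h2 h3]] := Hd (z - b) (z - a).
  - by rewrite (_ : _ - _ = a - b)//; apply/rowP => i; rewrite !mxE; ring.
  - apply: le_trans h3 _; rewrite lee_fin lerN2.
    have := HM a z ar h2 (tri z h2 h1); lra.
  - have := fundamental_le_harmonic_part Dz Da.
    rewrite -(fineK h1) -(fineK h2) !lee_fin => h4.
    by move: h3; rewrite ler_distl => /andP[_ h5]; rewrite (le_trans h5)// opprD opprK lerD2r.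
(* [key] is used for the pairs (y, y') and (y', y); one of the two points being y, its last premise
   is trivial. *)
have yy : enorm (y - y) <= r by rewrite subrr enorm0 ltW.
have yd' : enorm (y - y') <= d by rewrite enorm_distC.
rewrite ler_distl (key y y')// -lerBlDr (key y' y)//.
Qed.

End norming.
End green_functions.

(** * Weighted norms of functions *)

Section weighted_norm.
Context {R : realType} {n : nat}.
Local Notation E := 'rV[R]_n.
Local Notation lam := (lebesgue_rV R n).
Context {D : set E} {phi : E -> R} (oD : open D) (wphi : weight D phi).
Implicit Types u v : E -> R.

(** The norm is taken of a function and not of its class, so that pointwise values stay available;
    an infinite norm would be read as 0, hence the hypotheses [L1_mem]. *)
Definition nrm u : R := fine (wnorm D phi (EFin \o u)).

Let mD : measurable D. Proof. exact: open_measurable_rV. Qed.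

Lemma weight_ge0 x : D x -> 0 <= phi x.
Proof. by move=> Dx; rewrite ltW// wphi.2. Qed.

Lemma wnorm_ge0 A (u : E -> \bar R) : A `<=` D -> (0 <= wnorm A phi u)%E.
Proof. by move=> AD; apply: integral_ge0 => x /AD Dx; rewrite mule_ge0// lee_fin weight_ge0. Qed.

Lemma nrm_ge0 u : 0 <= nrm u.
Proof. by rewrite fine_ge0// wnorm_ge0. Qed.

Lemma wnormE u : L1_mem D phi u -> wnorm D phi (EFin \o u) = (nrm u)%:E.
Proof. by move=> [_ uoo]; rewrite fineK// ge0_fin_numE// wnorm_ge0. Qed.

Lemma wnormZ (a : R) u : measurable_fun D u ->
  (wnorm D phi (fun x => (a * u x)%:E) = `|a|%:E * wnorm D phi (EFin \o u))%E.
Proof.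
move=> mu; rewrite /wnorm -ge0_integralZl//; last 2 first.
- exact: (measurable_wnorm oD wphi mu).
- by move=> x Dx; rewrite mule_ge0// lee_fin weight_ge0.
by apply: eq_integral => x _; rewrite /= normrM EFinM muleA.
Qed.

Lemma L1_memZ (a : R) u : L1_mem D phi u -> L1_mem D phi (fun x => a * u x).
Proof.
move=> [mu uoo]; split; first exact: measurable_funM.
by rewrite wnormZ// lte_mul_pinfty.
Qed.

Lemma nrmZ (a : R) u : L1_mem D phi u -> nrm (fun x => a * u x) = `|a| * nrm u.
Proof.
move=> Lu; apply: EFin_inj; rewrite EFinM -!wnormE//; last exact: L1_memZ.
by rewrite -wnormZ//; case: Lu.
Qed.

Lemma nrmN u : nrm (fun x => - u x) = nrm u.
Proof. by rewrite /nrm -[in RHS]wnormN. Qed.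

Lemma nrmD u v : L1_mem D phi u -> L1_mem D phi v -> nrm (fun x => u x + v x) <= nrm u + nrm v.
Proof.
move=> Lu Lv.
have Luv : L1_mem D phi (fun x => u x + v x).
  have := L1_memB oD wphi Lu (L1_memZ (-1) Lv); congr L1_mem.
  by apply/funext => x; rewrite mulN1r opprK.
rewrite -lee_fin EFinD -!wnormE//.
by have [mu _] := Lu; have [mv _] := Lv; exact: ler_wnormD.
Qed.

Lemma nrm_distC u v : nrm (fun x => u x - v x) = nrm (fun x => v x - u x).
Proof.
by rewrite -nrmN; congr nrm; apply/funext => x; rewrite opprB.
Qed.

Lemma nrm_sub_le u v : L1_mem D phi u -> L1_mem D phi v -> nrm u <= nrm v + nrm (fun x => u x - v x).
Proof.
move=> Lu Lv; have := nrmD Lv (L1_memB oD wphi Lu Lv).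
by under [X in nrm X]funext do rewrite addrC subrK.
Qed.

Lemma ler_dist_nrm u v : L1_mem D phi u -> L1_mem D phi v -> `|nrm u - nrm v| <= nrm (fun x => u x - v x).
Proof.
move=> Lu Lv; rewrite ler_distl; apply/andP; split.
  by rewrite lerBlDr nrm_distC nrm_sub_le.
exact: nrm_sub_le.
Qed.

Lemma mdist_toL1 u v : L1_mem D phi u -> L1_mem D phi v ->
  mdist (toL1 oD wphi u) (toL1 oD wphi v) = nrm (fun x => u x - v x).
Proof. by move=> Lu Lv; rewrite toL1_dist. Qed.

Lemma toL1_eq_ae u v : L1_mem D phi u -> L1_mem D phi v -> toL1 oD wphi u = toL1 oD wphi v ->
  {ae lam, forall x, D x -> u x = v x}.
Proof.
move=> Lu Lv; rewrite /toL1; case: pselect => // {}Lu; case: pselect => // {}Lv.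
by move=> /eqP; rewrite eqmodE => /asboolP.
Qed.

Lemma toL1_ae u v : L1_mem D phi u -> L1_mem D phi v ->
  {ae lam, forall x, D x -> u x = v x} -> toL1 oD wphi u = toL1 oD wphi v.
Proof.
move=> Lu Lv uv; rewrite /toL1; case: pselect => // {}Lu; case: pselect => // {}Lv.
by apply/eqP; rewrite eqmodE; apply/asboolP.
Qed.

End weighted_norm.
Arguments nrm {R n} D phi u.

(** * The singularity of the Green function at its pole *)

Section ae_balls.
Context {R : realType} {n : nat}.
Local Notation E := 'rV[R]_n.
Local Notation lam := (lebesgue_rV R n).
Hypothesis n_gt0 : (0 < n)%N.

(** A null set together with one point, in applications the pole, cannot cover a ball of positive
    volume. *)
Lemma ae_exists_eball (D : set E) (P : E -> Prop) (x y : E) (r : R) : 0 < r -> eball x r `<=` D ->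
  {ae lam, forall z, D z -> P z} -> exists z, [/\ eball x r z, z <> y & P z].
Proof.
move=> r0 rD [N [mN N0 NP]]; apply: contrapT => H.
have : (lam (eball x r) <= lam (N `|` [set y]))%E.
  apply: le_measure; rewrite ?inE.
  - exact: measurable_eball.
  - by apply: measurableU => //; exact: measurable_rV_set1.
  move=> z zr; have [->|zy] := pselect (z = y); [by right|left].
  by apply: NP => /(_ (rD _ zr)) Pz; apply: H; exists z.
have -> : lam (N `|` [set y]) = 0%E.
  by rewrite (measureU0 mN (measurable_rV_set1 y) (lebesgue_set1 y n_gt0)).
by rewrite lebesgue_eball lee_fin leNgt vol_gt0.
Qed.

End ae_balls.

Section normalized_green.
Context {R : realType} {n : nat}.
Local Notation E := 'rV[R]_n.
Local Notation lam := (lebesgue_rV R n).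
Local Notation f := (@fundamental R n).
Hypothesis n_gt0 : (0 < n)%N.
Context {D : set E} (hD : greenian D) {phi : E -> R} (hphi : norming D phi).
Local Notation hp := (green_harmonic_part (D := D)).
Implicit Types x y z : E.

(** [O] may be smaller than D, so that [u] may be singular elsewhere. After subtraction of the
    harmonic part, c f(. - y) agrees almost everywhere on [O] with a harmonic, hence continuous,
    function [H]. For n <> 1 this contradicts the boundedness of [H] near y. For n = 1, [H] is
    nonnegative near y and [H y <= 0], so Harnack's inequality for - [H] forces [H] <= 0 near y,
    whereas c |z - y| > 0 off y. *)
Lemma green_not_harmonic (O : set E) y (c : R) (u : E -> R) : open O -> O `<=` D -> O y ->
  0 < c -> harmonic O u ->
  ~ {ae lam, forall x, O x -> c * fine (green D x y) = u x}.
Proof.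
move=> oO OD Oy c0 hu aeq; have Dy := OD _ Oy.
pose H x := u x - c * hp y x.
have hH : harmonic O H.
  by apply: harmonicB => //; apply: harmonicZ; apply: harmonicS OD _; exact: harmonic_green_harmonic_part.
have cH x : O x -> {for x, continuous H} by exact: harmonic_continuous.
have {}aeq : {ae lam, forall x, O x -> x <> y -> c * fine (f (x - y)) = H x}.
  apply: filterS aeq => x ux Ox /eqP xy.
  by rewrite /H -(ux Ox) (greenE hD (OD _ Ox))// fineD ?fundamental_fin_num ?subr_eq0//= -mulrBr addrK.
have point x r : 0 < r -> eball x r `<=` O ->
    exists z, [/\ eball x r z, z <> y & c * fine (f (z - y)) = H z].
  move=> r0 rD; have [z [zr zy]] := ae_exists_eball n_gt0 y r0 rD aeq.
  by move=> /(_ zy) Hz; exists z.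
have nD x : O x -> exists2 r, 0 < r & eball x r `<=` O.
  by move=> Ox; apply/nbhs_eballP; apply: open_nbhs_nbhs.
have [r r0 rD] := nD y Oy.
have [n1|n1] := boolP (n == 1%N); last first.
  have [M M0 HM] := compact_bounded_continuous (eball_compact y r) (fun x xr => cH x (rD _ xr)).
  (* Within distance [t] of the pole, c f <= - (M + 1), below the lower bound - M of [H]. *)
  have [t t0 Ht] := fundamental_leN n_gt0 ((M + 1) / c) n1.
  pose s := Num.min r t; have s0 : 0 < s by rewrite lt_min r0.
  have [sr st] : s <= r /\ s <= t by rewrite !ge_min !lexx orbT.
  have [z [zs zy Hz]] := point y s s0 (subset_trans (le_eball sr) rD).
  have := HM z (le_eball sr zs); rewrite -Hz ler_norml => /andP[+ _].
  have := Ht (z - y) (le_trans zs st).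
  have fin : f (z - y) \is a fin_num by rewrite fundamental_fin_num// subr_eq0; exact/eqP.
  rewrite -(fineK fin) lee_fin lerNr ler_pdivrMr// => h1 h2; move: h1; rewrite mulrC mulrN; lra.
have fE z : fine (f z) = enorm z by rewrite /fundamental n1.
have H0 x : eball y (r / 2) x -> 0 <= H x.
  move=> xr; rewrite leNgt; apply/negP => Hx.
  have xrD : eball x (r / 2) `<=` O.
    by apply: subset_trans rD; apply: eball_sub; move: xr; rewrite /eball/=; lra.
  have Ox : O x by apply: xrD; apply: eball_center; lra.
  have : nbhs x (H @^-1` [set t | t < 0]).
    by apply: (cH x Ox); apply: open_nbhs_nbhs; split => //; exact: open_lt.
  move=> /nbhs_eballP[s s0 sH].
  pose t := Num.min s (r / 2).
  have t0 : 0 < t by rewrite lt_min s0 divr_gt0.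
  have [ts tr] : t <= s /\ t <= r / 2 by rewrite !ge_min !lexx orbT.
  have [z [zt zy Hz]] := point x t t0 (subset_trans (le_eball tr) xrD).
  have := sH z (le_eball ts zt); rewrite /= -Hz fE ltNge mulr_ge0 ?enorm_ge0// ltW//.
have Hy : H y <= 0.
  rewrite leNgt; apply/negP => Hy.
  have : nbhs y (H @^-1` [set t | H y / 2 < t]).
    by apply: (cH y Oy); apply: open_nbhs_nbhs; split; [exact: open_gt|rewrite /=; lra].
  move=> /nbhs_eballP[s s0 sH].
  pose t := Num.min (Num.min s r) (H y / 2 / c).
  have t0 : 0 < t by rewrite !lt_min s0 r0 !divr_gt0.
  have [ts tr tH] : [/\ t <= s, t <= r & t <= H y / 2 / c] by rewrite !ge_min !lexx !orbT.
  have [z [zt zy Hz]] := point y t t0 (subset_trans (le_eball tr) rD).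
  have := sH z (le_eball ts zt); rewrite /= -Hz fE ltNge => /negP; apply.
  by rewrite mulrC -ler_pdivlMr// (le_trans zt).
have r20 : 0 < r / 2 by rewrite divr_gt0.
have r40 : 0 <= r / 4 < r / 2 by lra.
have r4 : 0 < r / 4 by lra.
have r2D : eball y (r / 2) `<=` O.
  by apply: subset_trans rD; apply: le_eball; lra.
have [z [zr zy Hz]] := point y (r / 4) r4 (subset_trans (le_eball (ltW (andP r40).2)) r2D).
have hN : harmonic O (fun x => -1 * H x) by exact: harmonicZ.
have := harnack hN _ r40 r2D zr; rewrite !mulN1r !opprK => Hzy.
have : H z <= 0.
  apply: (le_trans (Hzy _)).
    by move=> x xr; rewrite mulN1r oppr_le0 H0.
  by rewrite mulr_ge0_le0//; apply: exprn_ge0; apply: divr_ge0; lra.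
rewrite -Hz fE leNgt mulr_gt0// enorm_gt0 subr_eq0; exact/eqP.
Qed.


End normalized_green.

(** * Continuity and injectivity of Phi *)

Lemma normalization_split {R : realFieldType} (l l' g g' : R) :
  l'^-1 * g' - l^-1 * g = l'^-1 * (g' - g) + (l'^-1 - l^-1) * g.
Proof. ring. Qed.

(** Continuity of normalization: l, l' are the norms of g, g', and N is that of g' - g. As N <= l /
    2, also l' >= l / 2, and the sum is at most 2 N / l' <= 4 N / l. *)
Lemma normalization_bound {R : realFieldType} (l l' N e : R) : 0 < l -> N <= l / 2 ->
  N <= e * l / 4 -> `|l' - l| <= N ->
  0 < l' /\ l'^-1 * N + `|l'^-1 - l^-1| * l <= e.
Proof.
move=> l0 N1 N2 ll'; have N0 : 0 <= N by exact: le_trans ll'.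
have l'l : l / 2 <= l' by move: ll'; rewrite ler_distl => /andP[]; lra.
have l'0 : 0 < l' by lra.
split => //; have -> : l'^-1 - l^-1 = (l - l') / (l' * l) by field; rewrite !gt_eqF.
rewrite normrM [X in _ * X * _]ger0_norm; last by rewrite invr_ge0 mulr_ge0// ltW.
rewrite distrC (_ : _ * _ * l = l'^-1 * `|l' - l|); last by field; rewrite !gt_eqF.
rewrite -mulrDr ler_pdivrMl//; apply: (le_trans (lerD (lexx _) ll')).
apply: (@le_trans _ _ (e * l / 2)); first lra.
have e0 : 0 <= e by rewrite -(pmulr_lge0 _ l0); lra.
by rewrite [leRHS]mulrC -mulrA ler_wpM2l.
Qed.

Section normalized_green.
Context {R : realType} {n : nat}.
Local Notation E := 'rV[R]_n.
Local Notation lam := (lebesgue_rV R n).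
Local Notation f := (@fundamental R n).
Hypothesis n_gt0 : (0 < n)%N.
Context {D : set E} (hD : greenian D) {phi : E -> R} (hphi : norming D phi).
Local Notation hp := (green_harmonic_part (D := D)).
Local Notation oD := (greenian_open hD).
Local Notation wphi := (norming_weight hphi).
Local Notation nrm := (nrm D phi).
Implicit Types x y z : E.

Let mD : measurable D. Proof. exact: (open_measurable_rV oD). Qed.

Definition fgreen y x : R := fine (green D x y).

Lemma measurable_fgreen y : D y -> measurable_fun D (fgreen y).
Proof.
by move=> Dy; apply: measurableT_comp => //; exact: measurable_green hD _ Dy.
Qed.

(** [fine] changes the Green function at most at its pole, and a point is a null set as n > 0. *)
Lemma wnorm_fgreen y : D y -> wnorm D phi (EFin \o fgreen y) = green_norm D phi y.
Proof.
move=> Dy; have mphi := measurable_phi hD hphi.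
apply: ge0_ae_eq_integral => //.
- exact: (measurable_wnorm oD wphi (measurable_fgreen Dy)).
- apply: emeasurable_funM; last exact/measurable_EFinP.
  by apply: measurableT_comp => //; exact: measurable_green.
- by move=> x Dx; rewrite mule_ge0// lee_fin (weight_ge0 wphi).
- by move=> x Dx; rewrite mule_ge0// lee_fin (weight_ge0 wphi).
exists [set y]; split; [exact: measurable_rV_set1|exact: lebesgue_set1|].
move=> x /= /not_implyP[Dx xy]; apply: contrapT => /eqP yx; apply: xy.
by rewrite -[green D x y](fineK (green_fin_num hD Dx Dy yx)).
Qed.

Lemma L1_fgreen y : D y -> L1_mem D phi (fgreen y).
Proof.
move=> Dy; split; first exact: measurable_fgreen.
by rewrite wnorm_fgreen//; exact: green_norm_lty.
Qed.

Lemma fine_green_norm y : D y -> fine (green_norm D phi y) = nrm (fgreen y).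
Proof. by move=> Dy; rewrite /nrm wnorm_fgreen. Qed.

Lemma green_normE y : D y -> green_norm D phi y = (fine (green_norm D phi y))%:E.
Proof. by move=> Dy; rewrite fine_green_norm// -wnorm_fgreen// (wnormE wphi)//; exact: L1_fgreen. Qed.

(** A vanishing norm would make the Green function almost everywhere equal to the harmonic function
    0, against its singularity. *)
Lemma green_norm_gt0 y : D y -> 0 < fine (green_norm D phi y).
Proof.
move=> Dy; rewrite fine_green_norm// lt0r (nrm_ge0 wphi) andbT; apply/eqP => g0.
have L0 := @L1_mem0 R n D phi; have Lg := L1_fgreen Dy.
have : mdist (toL1 oD wphi (fgreen y)) (toL1 oD wphi (cst 0)) = 0.
  rewrite mdist_toL1// -[RHS]g0; congr (nrm _).
  by apply/funext => x /=; rewrite subr0.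
move=> /mdist_positivity/(toL1_eq_ae Lg L0).
move=> aeq; apply: (green_not_harmonic n_gt0 hD oD (@subset_refl _ D) Dy ltr01 (harmonic_cst D 0)).
by apply: filterS aeq => x H Dx; rewrite mul1r; exact: H.
Qed.

Definition ngreen y x : R := (fine (green_norm D phi y))^-1 * fine (green D x y).

Lemma PhiE y : Phi hD hphi y = toL1 oD wphi (ngreen y).
Proof. by []. Qed.

Lemma L1_ngreen y : D y -> L1_mem D phi (ngreen y).
Proof. by move=> Dy; apply: (L1_memZ oD wphi); exact: L1_fgreen. Qed.

Lemma nrm_ngreen y : D y -> nrm (ngreen y) = 1.
Proof.
move=> Dy; have l0 := green_norm_gt0 Dy.
rewrite (nrmZ oD wphi _ (L1_fgreen Dy)) -fine_green_norm// ger0_norm ?invr_ge0 ?mulVf ?gt_eqF//.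
exact: ltW.
Qed.

Lemma harmonic_ngreen y : D y -> harmonic (D `\ y) (ngreen y).
Proof. by move=> Dy; apply: harmonicZ; exact: green_harmonic. Qed.

Lemma ngreen_le0 x y : D x -> D y -> ngreen y x <= 0.
Proof.
move=> Dx Dy; rewrite /ngreen mulr_ge0_le0 ?invr_ge0 ?fine_le0 ?(green_le0 hD)//.
by rewrite ltW// green_norm_gt0.
Qed.

(** Condition (2) divided by the norm. At x = y, [fine] may have replaced -oo by 0. *)
Lemma ngreen_upper F : compact F -> F `<=` D -> exists2 C, 0 < C &
  forall x y, F x -> D y -> x != y -> ngreen y x <= - C.
Proof.
move=> cF FD; have [_ _ /(_ F cF FD)[C C0 HC] _] := hphi.
exists C => // x y Fx Dy xy.
have := HC _ (green_negative_subharmonic hD Dy) x Fx.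
rewrite -[wnorm _ _ _]/(green_norm D phi y) (green_normE Dy).
rewrite -[green D x y]fineK ?green_fin_num//; last exact: FD.
rewrite -EFinM -EFinN lee_fin /ngreen => H.
by rewrite ler_pdivrMl ?green_norm_gt0// mulrC mulNr.
Qed.

Lemma Phi_neq_harmonic y v : D y -> harmonic D v -> L1_mem D phi v ->
  Phi hD hphi y <> toL1 oD wphi v.
Proof.
move=> Dy hv Lv; rewrite PhiE => /(toL1_eq_ae (L1_ngreen Dy) Lv).
apply: (green_not_harmonic n_gt0 hD oD (@subset_refl _ D) Dy _ hv).
by rewrite invr_gt0 green_norm_gt0.
Qed.

(** If y <> y', the function with pole y' is harmonic near y, where the function with pole y agrees
    with no harmonic one. *)
Lemma Phi_inj y y' : D y -> D y' -> Phi hD hphi y = Phi hD hphi y' -> y = y'.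
Proof.
move=> Dy Dy'; rewrite !PhiE => /(toL1_eq_ae (L1_ngreen Dy) (L1_ngreen Dy')) aeq.
apply: contrapT => yy'.
have oO : open (D `\ y').
  rewrite setDE; apply: openI; first exact: oD.
  apply: closed_openC; apply: compact_closed; first exact: norm_hausdorff.
  exact: compact_set1.
have OD : D `\ y' `<=` D by move=> x [].
have c0 : 0 < (fine (green_norm D phi y))^-1 by rewrite invr_gt0; exact: green_norm_gt0.
apply: (green_not_harmonic n_gt0 hD oO OD (conj Dy yy') c0 (harmonic_ngreen Dy')).
by apply: filterS aeq => x H [Dx _]; exact: H.
Qed.

Lemma fgreenE x y : D x -> D y -> f (x - y) \is a fin_num ->
  fgreen y x = fine (f (x - y)) + hp y x.
Proof. by move=> Dx Dy fin; rewrite /fgreen (greenE hD Dx Dy); exact: (fineD fin). Qed.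

Lemma fgreen_dist_far y y' x (e : R) : D y -> D y' -> D x -> `|hp y' x - hp y x| <= e ->
  f (x - y') \is a fin_num -> f (x - y) \is a fin_num ->
  `|fine (f (x - y')) - fine (f (x - y))| <= e -> `|fgreen y' x - fgreen y x| <= e + e.
Proof.
move=> Dy Dy' Dx hh ff' ff fe; rewrite (fgreenE Dx Dy ff) (fgreenE Dx Dy' ff').
apply: le_trans (lerD fe hh).
by rewrite opprD addrACA ler_normD.
Qed.

(** Stated in extended reals: at an infinite pole the right-hand side is +oo and absorbs the value 0
    produced by [fine]. *)
Lemma fgreen_dist_near y y' x (e : R) : D y -> D y' -> D x -> `|hp y' x - hp y x| <= e ->
  (`|fgreen y' x - fgreen y x|%:E <= `|f (x - y')| + `|f (x - y)| + e%:E)%E.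
Proof.
move=> Dy Dy' Dx hh.
have [ff|] := boolP (f (x - y) \is a fin_num); last first.
  rewrite fin_numEn => ff; have -> : `|f (x - y)|%E = +oo%E by case/orP: ff => /eqP ->.
  rewrite addey; first by rewrite addye// leey.
  by rewrite -ltNye (lt_le_trans _ (abse_ge0 _)).
have [ff'|] := boolP (f (x - y') \is a fin_num); last first.
  rewrite fin_numEn => ff'; have -> : `|f (x - y')|%E = +oo%E by case/orP: ff' => /eqP ->.
  rewrite addye; first by rewrite addye// leey.
  by rewrite -ltNye (lt_le_trans _ (abse_ge0 _)).
rewrite (fgreenE Dx Dy ff) (fgreenE Dx Dy' ff').
rewrite -(fineK ff) -(fineK ff') -!EFinD lee_fin.
by rewrite opprD addrACA (le_trans (ler_normD _ _))// lerD// ler_normB.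
Qed.

(** D is split at [eball y s]: inside, the difference is bounded through the two fundamental
    functions and the weight by c; outside, the difference itself is at most e + e. *)
Lemma fgreen_dist_integral y y' (s c e : R) : D y -> D y' -> eball y s `<=` D ->
  (forall x, eball y s x -> phi x <= c) -> 0 <= c -> 0 <= e ->
  (forall x, D x -> `|hp y' x - hp y x| <= e) ->
  (forall x, D x -> ~ eball y s x -> `|fgreen y' x - fgreen y x| <= e + e) ->
  (wnorm D phi (EFin \o (fun x => fgreen y' x - fgreen y x)%R) <=
    (c%:E * (\int[lam]_(x in eball y s) `|f (x - y')|) + c%:E * (\int[lam]_(x in eball y s) `|f (x - y)|))
     + (e%:E * \int[lam]_(x in D) (phi x)%:E + (e + e)%:E * \int[lam]_(x in D) (phi x)%:E))%E.
Proof.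
move=> Dy Dy' sD phic c0 e0 hh far.
have mB := measurable_eball y s; have mphi := measurable_phi hD hphi.
have mphiE : measurable_fun D (EFin \o phi) by exact/measurable_EFinP.
have phi0 x : D x -> 0 <= phi x by exact: (weight_ge0 wphi).
have mg : measurable_fun D (fun x => fgreen y' x - fgreen y x).
  by apply: measurable_funB; exact: measurable_fgreen.
have mgphi := measurable_wnorm oD wphi mg.
have mf a A : measurable_fun A (fun x => `|f (x - a)|%E).
  by apply: measurableT_comp => //; exact: measurable_fundamental_shift.
rewrite /wnorm -{1}(setDUK sD) ge0_integral_setU//; last 4 first.
- exact: measurableD.
- by rewrite setDUK.
- by rewrite setDUK// => x Dx; rewrite mule_ge0// lee_fin phi0.
- by apply/disj_setPS => z [? []].
have subD A : A `<=` D -> measurable A -> (\int[lam]_(x in A) (phi x)%:E <= \int[lam]_(x in D) (phi x)%:E)%E.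
  by move=> AD mA; apply: ge0_subset_integral => // x Dx; rewrite lee_fin phi0.
have mcf a : measurable_fun (eball y s) (fun x => c%:E * `|f (x - a)|)%E.
  by apply: emeasurable_funM => //; exact: mf.
have mphiB : measurable_fun (eball y s) (EFin \o phi) by exact: measurable_funS mphiE.
have meph : measurable_fun (eball y s) (fun x => e%:E * (phi x)%:E)%E.
  by apply: emeasurable_funM.
rewrite [leRHS]addeA; apply: leeD.
- apply: (@le_trans _ _ (\int[lam]_(x in eball y s) (c%:E * `|f (x - y')| + c%:E * `|f (x - y)| + e%:E * (phi x)%:E))%E).
    apply: ge0_le_integral => //.
    + by move=> x /sD Dx; rewrite mule_ge0// lee_fin phi0.
    + exact: measurable_funS mgphi.
    + by apply: emeasurable_funD => //; exact: emeasurable_funD.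
    move=> x xs; have Dx := sD _ xs.
    apply: (@le_trans _ _ ((`|f (x - y')| + `|f (x - y)| + e%:E) * (phi x)%:E)%E).
      by apply: lee_wpmul2r; [rewrite lee_fin phi0|exact: (fgreen_dist_near Dy Dy' Dx (hh x Dx))].
    rewrite ge0_muleDl ?adde_ge0//; apply: leeD => //.
    rewrite -ge0_muleDr//; rewrite muleC; apply: lee_wpmul2r; first by rewrite adde_ge0.
    by rewrite lee_fin phic.
  have n0 a x : eball y s x -> (0 <= c%:E * `|f (x - a)|)%E by move=> _; rewrite mule_ge0.
  have ne0 x : eball y s x -> (0 <= e%:E * (phi x)%:E)%E.
    by move=> /sD Dx; rewrite mule_ge0// lee_fin phi0.
  have nphi0 x : eball y s x -> (0 <= (phi x)%:E)%E by move=> /sD Dx; rewrite lee_fin phi0.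
  rewrite (ge0_integralD lam mB _ (emeasurable_funD (mcf y') (mcf y)) ne0 meph); last first.
    by move=> x xs; rewrite adde_ge0// n0.
  rewrite (ge0_integralD lam mB (n0 y') (mcf y') (n0 y) (mcf y)).
  rewrite (ge0_integralZl lam mB mphiB nphi0)// (ge0_integralZl lam mB (mf y' _))// (ge0_integralZl lam mB (mf y _))//.
  by rewrite leeD2l// lee_wpmul2l// subD.
- have mDB : measurable (D `\` eball y s) by exact: measurableD.
  apply: (@le_trans _ _ (\int[lam]_(x in D `\` eball y s) ((e + e)%:E * (phi x)%:E))%E).
    apply: ge0_le_integral => //.
    + by move=> x [Dx _]; rewrite mule_ge0// lee_fin phi0.
    + by apply: measurable_funS mgphi => // x [].
    + by apply: emeasurable_funM => //; apply: measurable_funS mphiE => // x [].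
    + move=> x [Dx xs]; apply: lee_wpmul2r; first by rewrite lee_fin phi0.
      by rewrite lee_fin far.
  rewrite ge0_integralZl//; last 3 first.
  - by apply: measurable_funS mphiE => // x [].
  - by move=> x [Dx _]; rewrite lee_fin phi0.
  - by rewrite lee_fin addr_ge0.
  by rewrite lee_wpmul2l// ?lee_fin ?addr_ge0// subD// => x [].
Qed.

Lemma green_near y (e : R) : D y -> 0 < e -> exists2 d, 0 < d &
  forall y', enorm (y' - y) <= d -> D y' /\ nrm (fun x => fgreen y' x - fgreen y x) <= e.
Proof.
move=> Dy e0.
have : nbhs y D by apply: open_nbhs_nbhs; split => //; exact: oD.
move=> /nbhs_eballP[r r0 rD].
have [c c0 phic] := weight_upper_bound wphi (eball_compact y r) rD.
pose Psi := fine (\int[lam]_(x in D) (phi x)%:E)%E.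
have PsiE : (\int[lam]_(x in D) (phi x)%:E)%E = Psi%:E.
  rewrite /Psi fineK// ge0_fin_numE ?(weight_integrable hD hphi)//.
  by apply: integral_ge0 => x Dx; rewrite lee_fin (weight_ge0 wphi).
have Psi0 : 0 <= Psi.
  by rewrite -lee_fin -PsiE; apply: integral_ge0 => x Dx; rewrite lee_fin (weight_ge0 wphi).
have K0 : 0 < 2 * c + 3 * Psi by rewrite ltr_wpDr ?mulr_gt0// mulr_ge0.
(* With both masses at most [eta], the bound of [fgreen_dist_integral] becomes 2 c eta + 3 Psi eta =
   e. *)
pose eta := e / (2 * c + 3 * Psi).
have eta0 : 0 < eta by rewrite divr_gt0.
have [t /andP[t0 tr] Ht] := fundamental_mass_small n_gt0 r0 (fundamental_mass_lty hD hphi Dy rD) eta0.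
(* Half the radius, so that the ball about y lies in the ball of radius [t] about y', where the mass
   of f(. - y') is small. *)
have s0 : 0 < t / 2 by rewrite divr_gt0.
have st : t / 2 + t / 2 = t by rewrite -splitr.
have sr : t / 2 <= r by rewrite (le_trans _ tr)// ler_pdivrMr// ler_peMr ?(ltW t0)// ler1n.
(* Off the ball of radius t / 2 about y the distances exclude the first alternative, whatever its
   bound, here 0. *)
have [d1 d10 H1] := fundamental_dichotomy n_gt0 0 eta0 s0.
have [d2 d20 H2] := harmonic_part_near n_gt0 hD hphi Dy eta0.
exists (Num.min (Num.min d1 d2) (t / 2)); first by rewrite !lt_min d10 d20.
move=> y'; rewrite !le_min => /andP[/andP[y1 y2] ys].
have [Dy' hh] := H2 y' y2; split => //.
have sD : eball y (t / 2) `<=` D by apply: subset_trans rD; exact: le_eball.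
have Lgg := L1_memB oD wphi (L1_fgreen Dy') (L1_fgreen Dy).
rewrite -lee_fin -(wnormE wphi Lgg).
have far x : D x -> ~ eball y (t / 2) x -> `|fgreen y' x - fgreen y x| <= eta + eta.
  move=> Dx xs; have [|[h1 h2 _ _]|[h1 h2 h3]] := H1 (x - y') (x - y).
  - rewrite (_ : _ - _ = y - y') 1?enorm_distC//.
    by apply/rowP => i; rewrite !mxE; ring.
  - by [].
  - by apply: fgreen_dist_far => //; exact: hh.
have phic' x : eball y (t / 2) x -> phi x <= c by move=> xs; apply: phic; exact: le_eball xs.
apply: le_trans (fgreen_dist_integral Dy Dy' sD phic' (ltW c0) (ltW eta0) hh far) _.
have M1 : (\int[lam]_(x in eball y (t / 2)) `|f (x - y)| <= eta%:E)%E.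
  rewrite fundamental_massE; apply: le_trans Ht; apply: fundamental_mass_le.
  by rewrite ler_pdivrMr// ler_peMr ?(ltW t0)// ler1n.
have M2 : (\int[lam]_(x in eball y (t / 2)) `|f (x - y')| <= eta%:E)%E.
  apply: le_trans Ht; rewrite -(fundamental_massE y'); apply: ge0_subset_integral => //.
  - exact: measurable_eball.
  - exact: measurable_eball.
  - by apply: measurableT_comp => //; exact: measurable_fundamental_shift.
  - by apply: eball_sub; rewrite enorm_distC -[leRHS]st lerD2r.
have cE : (0 <= c%:E)%E by rewrite lee_fin ltW.
rewrite PsiE; apply: (le_trans (leeD (leeD (lee_wpmul2l cE M2) (lee_wpmul2l cE M1)) (lexx _))).
rewrite -!EFinM -!EFinD lee_fin le_eqVlt; apply/orP; left; apply/eqP.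
by rewrite /eta; field; rewrite gt_eqF.
Qed.

Lemma Phi_near y (e : R) : D y -> 0 < e -> exists2 d, 0 < d &
  forall y', enorm (y' - y) <= d -> D y' /\ mdist (Phi hD hphi y') (Phi hD hphi y) <= e.
Proof.
move=> Dy e0; have l0 := green_norm_gt0 Dy; set l := fine _ in l0.
have de0 : 0 < Num.min (l / 2) (e * l / 4) by rewrite lt_min !divr_gt0 ?mulr_gt0.
have [d d0 Hd] := green_near Dy de0; exists d => // y' /Hd[Dy' HN]; split => //; move: HN.
have Lg := L1_fgreen Dy; have Lg' := L1_fgreen Dy'.
set N := nrm (fun x => fgreen y' x - fgreen y x) => HN.
pose l' := fine (green_norm D phi y').
have lE : l = nrm (fgreen y) := fine_green_norm Dy.
have l'E : l' = nrm (fgreen y') := fine_green_norm Dy'.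
have ll' : `|l' - l| <= N.
  rewrite (congr2 (fun a b => a - b) l'E lE); exact: (ler_dist_nrm oD wphi Lg' Lg).
have {HN}[N1 N2] : N <= l / 2 /\ N <= e * l / 4 by move: HN; rewrite le_min => /andP[].
have [l'0 He] := normalization_bound l0 N1 N2 ll'.
rewrite !PhiE mdist_toL1; [|exact: L1_ngreen|exact: L1_ngreen].
have -> : (fun x => ngreen y' x - ngreen y x) =
  (fun x => l'^-1 * (fgreen y' x - fgreen y x) + (l'^-1 - l^-1) * fgreen y x).
  by apply/funext => x; exact: normalization_split.
apply: le_trans (nrmD oD wphi (L1_memZ oD wphi _ (L1_memB oD wphi Lg' Lg)) (L1_memZ oD wphi _ Lg)) _.
rewrite (nrmZ oD wphi _ (L1_memB oD wphi Lg' Lg)) (nrmZ oD wphi _ Lg) -/N -lE.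
by rewrite [X in X * N]ger0_norm ?invr_ge0 ?(ltW l'0).
Qed.

End normalized_green.
Arguments ngreen {R n} D phi y x.

(** * Exhaustions *)

Section exhaustion.
Context {R : realType} {n : nat}.
Local Notation E := 'rV[R]_n.
Implicit Types (x y z : E) (D U V W : set E).

Definition segment x z : set E := (fun t : R => x + t *: (z - x)) @` `[0, 1]%classic.

Lemma segment_connected_rV x z : connected (segment x z).
Proof.
apply: connected_continuous_connected; first exact: segment_connected.
apply: continuous_subspaceT => t.
apply: (@cvgD _ E _ _ _ (cst x) (fun t : R => t *: (z - x))); first exact: cvg_cst.
exact: scalel_continuous.
Qed.

Lemma segment_l x z : segment x z x.
Proof. by exists 0; rewrite /= ?scale0r ?addr0// in_itv /= lexx ler01. Qed.

Lemma segment_r x z : segment x z z.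
Proof. by exists 1; rewrite /= ?scale1r ?subrKC// in_itv /= lexx ler01. Qed.

Lemma segment_eball x z r : eball x r z -> segment x z `<=` eball x r.
Proof.
move=> zr _ [t + <-]; rewrite /= in_itv /= => /andP[t0 t1].
rewrite /eball /= [_ - x]addrC addKr enormZ ger0_norm//.
by rewrite (le_trans _ zr)// ler_piMl// enorm_ge0.
Qed.

Lemma component_eball V x0 x r z : connected_component V x0 x -> eball x r `<=` V ->
  eball x r z -> connected_component V x0 z.
Proof.
move=> cx rV xz; apply: (connected_component_trans cx).
apply: (@connected_component_max _ V (segment x z) x) => //.
- exact: segment_l.
- by apply: subset_trans rV; exact: segment_eball.
- exact: segment_connected_rV.
- exact: segment_r.
Qed.

Lemma component_subset V W x : V `<=` W -> connected_component V x `<=` connected_component W x.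
Proof.
move=> VW z cz; have xz := component_connected (A := V) (x := x).
have Vx : V x.
  by apply: contrapT => /connected_component_out c0; move: cz; rewrite c0.
apply: (@connected_component_max _ W (connected_component V x) x) => //.
- exact: connected_component_refl.
- by apply: subset_trans VW; exact: connected_component_sub.
Qed.

Lemma component_open V x : open V -> open (connected_component V x).
Proof.
move=> oV; rewrite openE => z cz.
have Vz : V z := connected_component_sub cz.
have : nbhs z V by exact: open_nbhs_nbhs.
move=> /nbhs_eballP[r r0 rV]; apply/nbhs_eballP; exists r => // w.
exact: component_eball.
Qed.

(** Compact sets whose interiors cover an open D; [j.+1] in place of j avoids the inverse of 0. *)
Definition deep D (j : nat) : set E :=
  [set x | enorm x <= j.+1%:R /\ forall z, ~ D z -> j.+1%:R^-1 <= enorm (z - x)].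

Lemma deep_closed D j : closed (deep D j).
Proof.
rewrite (_ : deep D j = eball 0 j.+1%:R `&` \bigcap_(z in ~` D) [set x | j.+1%:R^-1 <= enorm (x - z)]).
  apply: closedI; first exact: eball_closed.
  apply: closed_bigI => z _.
  apply: (@closed_comp _ _ (fun x => enorm (x - z)) [set t | j.+1%:R^-1 <= t]).
    by move=> x _; exact: dist_continuous.
  exact: closed_ge.
apply/seteqP; split => x; rewrite /deep /eball /= subr0.
  by move=> [xj xD]; split => // z /= /xD; rewrite enorm_distC.
by move=> [xj xD]; split => // z /xD; rewrite /= enorm_distC.
Qed.

Lemma deep_subset D j : deep D j `<=` D.
Proof.
move=> x [_ xD]; apply: contrapT => /xD; rewrite subrr enorm0 leNgt => /negP; apply.
by rewrite invr_gt0.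
Qed.

Lemma deep_le D i j : (i <= j)%N -> deep D i `<=` deep D j.
Proof.
move=> ij x [xi xD]; split; first by rewrite (le_trans xi)// ler_nat ltnS.
by move=> z /xD; apply: le_trans; rewrite lef_pV2 ?posrE// ler_nat ltnS.
Qed.

Lemma deep_compact D j : compact (deep D j).
Proof.
apply: (subclosed_compact (@deep_closed D j) (eball_compact 0 j.+1%:R)).
by move=> x []; rewrite /eball /= subr0.
Qed.

Lemma deep_cover D x : open D -> D x -> exists j, (deep D j)^° x.
Proof.
move=> oD Dx; have : nbhs x D by exact: open_nbhs_nbhs.
move=> /nbhs_eballP[r r0 rD].
have r20 : 0 < r / 2 by rewrite divr_gt0.
have [k _ /(_ k (leqnn k)) /= kr] := near_infty_natSinv_lt (PosNum r20).
have [m mx] : exists m : nat, enorm x + r / 2 <= m%:R.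
  exists (Num.bound (enorm x + r / 2)); apply: ltW; apply: archi_boundP.
  by rewrite addr_ge0 ?enorm_ge0// ltW.
exists (maxn k m); apply/nbhs_eballP; exists (r / 2) => // z; rewrite /eball /= => xz; split.
  rewrite -(subrK x z) (le_trans (ler_enormD _ _))// addrC.
  rewrite (le_trans (lerD (lexx _) xz))// (le_trans mx)// ler_nat.
  by rewrite leqW// leq_maxr.
move=> w Dw; apply: (@le_trans _ _ (r / 2)).
  rewrite (le_trans _ (ltW kr))// lef_pV2 ?posrE// ler_nat ltnS; exact: leq_maxl.
rewrite leNgt; apply/negP => wz; apply: Dw; apply: rD; rewrite /eball /=.
rewrite (_ : w - x = (w - z) + (z - x)); last by rewrite addrA subrK.
by rewrite (le_trans (ler_enormD _ _))// [leRHS]splitr lerD// ltW.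
Qed.

(** Condition (3) speaks of sequences of subdomains, so one must be produced. The interiors of the
    sets [deep] may be disconnected, hence the components of a fixed point; their union is open and
    relatively closed in D, hence all of D. *)
Lemma exhaustion_exists D : is_domain D -> exists D_ : nat -> set E, exhaustion D D_.
Proof.
move=> [[x0 Dx0] oD cD].
have [j0 x0j] := deep_cover oD Dx0.
(* Shifted by [j0] so that every term contains x0. *)
pose V j := (deep D (j0 + j)%N)^°.
have oV j : open (V j) by exact: open_interior.
have VV i j : (i <= j)%N -> V i `<=` V j.
  by move=> ij; apply: interiorS; apply: deep_le; rewrite leq_add2l.
have V0 j : V j x0 by apply: (VV 0 j (leq0n _)); rewrite /V addn0.
pose D_ j := connected_component (V j) x0.
have DV j : D_ j `<=` V j by exact: connected_component_sub.
have DD i j : (i <= j)%N -> D_ i `<=` D_ j by move=> /VV; exact: component_subset.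
have oDj j : open (D_ j) by exact: component_open.
have Dx j : D_ j x0 by exact: connected_component_refl.
have Ddeep j : D_ j `<=` deep D (j0 + j)%N.
  by apply: subset_trans (DV j) _; exact: interior_subset.
have cl j : closure (D_ j) `<=` deep D (j0 + j)%N.
  rewrite [X in _ `<=` X](iffLR (closure_id _) (@deep_closed D _)); exact: closureS.
have Vcover x : D x -> exists j, V j x.
  move=> Dx'; have [j xj] := deep_cover oD Dx'; exists j.
  by apply: interiorS xj; apply: deep_le; rewrite leq_addl.
exists D_; split => //.
- by move=> j; split => //; [exists x0|exact: component_connected].
- move=> j; split; last by apply: subset_trans (cl j) _; exact: deep_subset.
  apply: (subclosed_compact _ (@deep_compact D (j0 + j)%N) (cl j)); exact: closed_closure.
- by move=> j; apply: DD.
apply: cD.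
- by exists x0, 0%N.
- exists (\bigcup_j D_ j); first exact: bigcup_open.
  rewrite setIidr//; apply: bigcup_sub => j _.
  by apply: subset_trans (Ddeep j) _; exact: deep_subset.
- exists (closure (\bigcup_j D_ j)); first exact: closed_closure.
  apply/seteqP; split => x.
    move=> Ux; split; last exact: subset_closure.
    by have [j _ /Ddeep/deep_subset] := Ux.
  move=> [Dx' clx]; have [j xj] := Vcover x Dx'.
  have : nbhs x (V j) by exact: open_nbhs_nbhs.
  move=> /nbhs_eballP[r r0 rV].
  have [z [[i _ zi] xz]] := clx _ (nbhs_eball x r0).
  exists (maxn i j) => //.
  have rV' : eball x r `<=` V (maxn i j) by apply: subset_trans (VV _ _ (leq_maxr _ _)).
  apply: (connected_component_trans (DD _ _ (leq_maxl i j) _ zi)).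
  apply: connected_component_sym; apply: (component_eball _ rV' xz).
  apply: connected_component_refl; apply: rV'; apply: eball_center; exact: ltW.
Qed.

End exhaustion.

(** * Limits of normalized Green functions *)

Lemma ultra_fmap {S T : Type} (f : S -> T) (U : set_system S) : UltraFilter U -> UltraFilter (f @ U).
Proof.
move=> UU; split; first exact: fmap_proper_filter.
move=> G GF sub; apply/seteqP; split => // A GA.
have [//|UnA] := in_ultra_setVsetC (f @^-1` A) UU.
have : G (~` A) by exact: sub.
by move=> /(filterI GA); rewrite setICr => /filter_ex[].
Qed.

Lemma ultra_bounded_cvg {R : realType} {T : Type} (U : set_system T) (f : T -> R) (C : R) :
  UltraFilter U -> U [set y | `|f y| <= C] -> exists l : R, f @ U --> l.
Proof.
move=> UU fC.
have : compact `[- C, C]%classic by exact: segment_compact.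
rewrite compact_ultra => /(_ (f @ U) (ultra_fmap f UU))[|l [_ fl]]; last by exists l.
apply: (@filterS T U _ [set y | `|f y| <= C]) => // y.
by rewrite /= in_itv /= -ler_norml.
Qed.

Lemma harnack_constant {R : realFieldType} k (rho e : R) : 0 < rho -> 0 < e ->
  exists2 d, 0 < d < rho & (rho / (rho - d)) ^+ k <= 1 + e.
Proof.
move=> r0 e0; have [C C0 HC] := exprn_sub_le k (ler0n R 2).
(* The bound rho / 2 keeps rho / (rho - d) in [0, 2], where C is a Lipschitz constant of the k-th
   power; the other bound gives C d / (rho - d) <= e. *)
have d0 : 0 < Num.min (rho / 2) (e * rho / (2 * (C + 1))).
  by rewrite lt_min !divr_gt0 ?mulr_gt0// ltr_wpDl.
set d := Num.min _ _ in d0 *.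
have [d1 d2] : d <= rho / 2 /\ d <= e * rho / (2 * (C + 1)) by rewrite !ge_min !lexx orbT.
clearbody d; exists d; first by rewrite d0/=; lra.
have rd : 0 < rho - d by lra.
have p2 : rho / (rho - d) <= 2 by rewrite ler_pdivrMr//; lra.
have p0 : 0 <= rho / (rho - d) by rewrite divr_ge0// ltW.
have := HC (rho / (rho - d)) 1; rewrite p0 p2 ler01 ler1n expr1n => /(_ isT isT).
rewrite ler_distl => /andP[_ /le_trans]; apply; rewrite lerD2l.
have -> : rho / (rho - d) - 1 = d / (rho - d) by field; rewrite gt_eqF.
rewrite ger0_norm ?divr_ge0 ?(ltW d0) ?(ltW rd)//.
have C1 : 0 < C + 1 by rewrite ltr_wpDl.
move: d2; rewrite ler_pdivlMr ?mulr_gt0// => d2.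
rewrite mulrA ler_pdivrMr//; nra.
Qed.

(** Harnack's inequality in both directions between values of modulus at most C leaves a difference
    of at most (K - 1) C <= e. *)
Lemma harnack_dist {R : realFieldType} (C e K a b : R) : 0 < C -> 0 < e -> K <= 1 + e / C ->
  - b <= K * - a -> - a <= K * - b -> `|a| <= C -> `|b| <= C -> a <= 0 -> b <= 0 ->
  `|b - a| <= e.
Proof.
move=> C0 e0 Ke ba ab aC bC a0 b0.
have aux p q : - p <= K * - q -> `|q| <= C -> q <= 0 -> q - p <= e.
  move=> pq qC q0; have : - p <= (1 + e / C) * - q.
    by rewrite (le_trans pq)// ler_wpM2r// oppr_ge0.
  rewrite mulrDl mul1r => pq'; have : e / C * - q <= e.
    rewrite mulrAC ler_pdivrMr// ler_pM2l// (le_trans _ qC)// -normrN ler_norm//.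
  lra.
rewrite ler_norml lerNl opprB; apply/andP; split; exact: aux.
Qed.

Section rmean_bound.
Context {R : realType} {n : nat}.
Local Notation E := 'rV[R]_n.
Local Notation lam := (lebesgue_rV R n).

Lemma rmean_dist_le (u v : E -> R) x r (e : R) : 0 < r ->
  (forall z, eball x r z -> {for z, continuous u}) ->
  (forall z, eball x r z -> {for z, continuous v}) ->
  (forall z, eball x r z -> `|u z - v z| <= e) -> `|rmean u x r - rmean v x r| <= e.
Proof.
move=> r0 cu cv uv; have mB := measurable_eball x r; have V0 := vol_gt0 n r0.
have iu := integrable_continuous (eball_compact x r) cu.
have iv := integrable_continuous (eball_compact x r) cv.
rewrite /rmean -mulrBr -RintegralB// normrM ger0_norm ?invr_ge0 ?(ltW V0)//.
have cuv z : eball x r z -> {for z, continuous (fun z => u z - v z)}.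
  by move=> xz; apply: continuousB; [exact: cu|exact: cv].
have iuv := integrable_continuous (eball_compact x r) cuv.
rewrite ler_pdivrMl//; apply: (le_trans (le_normr_Rintegral mB iuv)).
apply: (@le_trans _ _ (\int[lam]_(z in eball x r) e)).
  apply: le_Rintegral => //.
  - exact: integrable_norm.
  - by apply: integrable_continuous => [|z _]; [exact: eball_compact|exact: cst_continuous].
rewrite Rintegral_cst// [fine _](congr1 fine (lebesgue_eball x r)) /= mulrC//.
Qed.

End rmean_bound.

Section weighted_norm_bounds.
Context {R : realType} {n : nat}.
Local Notation E := 'rV[R]_n.
Local Notation lam := (lebesgue_rV R n).
Context {D : set E} {phi : E -> R} (oD : open D) (wphi : weight D phi).
Implicit Types (u v : E -> R) (A B : set E).
Local Open Scope ereal_scope.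

Let mD : measurable D. Proof. exact: open_measurable_rV. Qed.
Let mphi : measurable_fun D (EFin \o phi).
Proof. by apply/measurable_EFinP; exact: measurable_weight. Qed.

Let mw A u : measurable A -> A `<=` D -> measurable_fun A u ->
  measurable_fun A (fun x => `|(EFin \o u) x| * (phi x)%:E).
Proof.
move=> mA AD mu; apply: emeasurable_funM; last exact: measurable_funS mphi.
by apply: measurableT_comp => //; exact/measurable_EFinP.
Qed.

Lemma wnorm_subset A B u : measurable A -> measurable B -> A `<=` B -> B `<=` D ->
  measurable_fun B u -> wnorm A phi (EFin \o u) <= wnorm B phi (EFin \o u).
Proof.
move=> mA mB AB BD mu; apply: ge0_subset_integral => //; first exact: mw.
by move=> x /BD Dx; rewrite mule_ge0// lee_fin (weight_ge0 wphi).
Qed.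

Lemma wnorm_leD A u v1 v2 : measurable A -> A `<=` D -> measurable_fun A u ->
  measurable_fun A v1 -> measurable_fun A v2 ->
  (forall x, A x -> `|u x|%R <= `|v1 x| + `|v2 x|)%R ->
  wnorm A phi (EFin \o u) <= wnorm A phi (EFin \o v1) + wnorm A phi (EFin \o v2).
Proof.
move=> mA AD mu mv1 mv2 uv.
have w0 (v : E -> R) x : A x -> 0 <= `|(EFin \o v) x| * (phi x)%:E.
  by move=> /AD Dx; rewrite mule_ge0// lee_fin (weight_ge0 wphi).
rewrite /wnorm -(ge0_integralD lam mA (w0 v1) (mw mA AD mv1) (w0 v2) (mw mA AD mv2)).
apply: ge0_le_integral => //.
- exact: w0.
- exact: mw.
- by apply: emeasurable_funD; exact: mw.
move=> x Ax; rewrite -ge0_muleDl//; apply: lee_wpmul2r.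
  by rewrite lee_fin (weight_ge0 wphi)//; exact: AD.
by rewrite /= -EFinD lee_fin uv.
Qed.

Lemma wnorm_cst A (c : R) : (0 <= c)%R -> measurable A -> A `<=` D ->
  wnorm A phi (EFin \o cst c) <= c%:E * \int[lam]_(x in D) (phi x)%:E.
Proof.
move=> c0 mA AD; apply: (@le_trans _ _ (wnorm D phi (EFin \o cst c))).
  by apply: wnorm_subset => //.
rewrite /wnorm -ge0_integralZl//; last first.
  by move=> x Dx; rewrite lee_fin (weight_ge0 wphi).
rewrite le_eqVlt; apply/orP; left; apply/eqP; apply: eq_integral => x _.
by rewrite /= ger0_norm.
Qed.

Lemma wnorm_exhaustion A (D_ : nat -> set E) (c : \bar R) u : exhaustion D D_ ->
  measurable A -> A `<=` D -> measurable_fun A u ->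
  (forall k, wnorm (A `&` D_ k) phi (EFin \o u) <= c) -> wnorm A phi (EFin \o u) <= c.
Proof.
move=> [dD _ D_S UD] mA AD mu uc.
have mDk k : measurable (D_ k) by apply: open_measurable_rV; case: (dD k).
have AE : A = \bigcup_k (A `&` D_ k) by rewrite -setI_bigcupr UD setIidl.
have nd : nondecreasing_seq (fun k => A `&` D_ k).
  by apply/nondecreasing_seqP => k; apply/subsetPset; apply: setIS; exact: D_S.
have mk k : measurable (A `&` D_ k) by exact: measurableI.
have mfk k : measurable_fun (A `&` D_ k) (fun x => `|(EFin \o u) x| * (phi x)%:E).
  by apply: measurable_funS (mw mA AD mu) => //; exact: subIsetl.
have f0 k x : (A `&` D_ k) x -> 0 <= `|(EFin \o u) x| * (phi x)%:E.
  by move=> [/AD Dx _]; rewrite mule_ge0// lee_fin (weight_ge0 wphi).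
suff : wnorm (\bigcup_k (A `&` D_ k)) phi (EFin \o u) <= c by rewrite -AE.
have cv := @ge0_nondecreasing_set_cvg_integral _ _ _ _ _ lam nd mk mfk f0.
rewrite /wnorm; apply: cvge_le cv.
by apply: nearW => k; exact: uc.
Qed.

End weighted_norm_bounds.

Section compactness.
Context {R : realType} {n : nat}.
Local Notation E := 'rV[R]_n.
Hypothesis n_gt0 : (0 < n)%N.
Context {D : set E} (hD : greenian D) {phi : E -> R} (hphi : norming D phi).
Local Notation oD := (greenian_open hD).
Local Notation wphi := (norming_weight hphi).
Local Notation w := (ngreen D phi).
Implicit Types x y z : E.

Let mD : measurable D. Proof. exact: (open_measurable_rV oD). Qed.

Lemma domain_eball x : D x -> exists2 r, 0 < r & eball x r `<=` D.
Proof. by move=> Dx; apply/nbhs_eballP; apply: open_nbhs_nbhs; split => //; exact: oD. Qed.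

Lemma wnorm_ngreen y : D y -> wnorm D phi (EFin \o w y) = 1%E.
Proof. by move=> Dy; rewrite (wnormE wphi (L1_ngreen n_gt0 hD hphi Dy)) nrm_ngreen. Qed.

Lemma ngreen_bounded x r : 0 < r -> eball x r `<=` D -> exists2 C, 0 < C &
  forall y x', D y -> ~ eball x r y -> eball x (r / 2) x' -> `|w y x'| <= C.
Proof.
move=> r0 rD; have [C C0 HC] := harmonic_le_wnorm oD wphi r0 rD.
exists C => // y x' Dy yr xr.
have := HC (D `\ y) (w y) (L1_ngreen n_gt0 hD hphi Dy).1 _ (harmonic_ngreen hD Dy) x' xr.
rewrite wnorm_ngreen// mule1 lee_fin; apply => z zr; split; first exact: rD.
by move=> zy; apply: yr; rewrite -zy.
Qed.

(** Harnack's inequality is applied on the balls of radius r / 4 about x and about x', both inside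
    [eball x r], where [w y] is harmonic because its pole lies outside. Neither r nor d depends on
    y. *)
Lemma ngreen_equicontinuous x (e : R) : D x -> 0 < e ->
  exists2 r, 0 < r & eball x r `<=` D /\ exists2 d, 0 < d <= r & forall y, D y -> ~ eball x r y ->
    forall x', eball x d x' -> `|w y x' - w y x| <= e.
Proof.
move=> Dx e0; have [r r0 rD] := domain_eball Dx; exists r => //; split => //.
have [C C0 HC] := ngreen_bounded r0 rD.
have r40 : 0 < r / 4 by rewrite divr_gt0.
have eC : 0 < e / C by rewrite divr_gt0.
have [d /andP[d0 dr] Hd] := harnack_constant n r40 eC.
exists d; first by rewrite d0/=; lra.
move=> y Dy yr x' xx'; have hw : harmonic (D `\ y) (w y) := harmonic_ngreen hD Dy.
have sub z s : enorm (z - x) + s <= r -> eball z s `<=` D `\ y.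
  move=> zs t /(eball_sub zs) tr; split; first exact: rD.
  by move=> ty; apply: yr; rewrite -ty.
have neg z s : enorm (z - x) + s <= r -> forall t, eball z s t -> w y t <= 0.
  by move=> zs t /(eball_sub zs) tr; apply: (ngreen_le0 n_gt0 hD hphi) => //; exact: rD.
have dr' : 0 <= d < r / 4 by rewrite ltW.
have x0 : enorm (x - x) + r / 4 <= r by rewrite subrr enorm0; lra.
have x0' : enorm (x' - x) + r / 4 <= r by move: xx'; rewrite /eball /=; lra.
have h1 := harnack hw (neg _ _ x0) dr' (sub _ _ x0) xx'.
have h2 := harnack hw (neg _ _ x0') dr' (sub _ _ x0') (eball_sym xx').
have xr2 : eball x (r / 2) x by apply: eball_center; lra.
have xr2' : eball x (r / 2) x' by apply: le_eball xx'; lra.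
have b1 := HC y x Dy yr xr2; have b2 := HC y x' Dy yr xr2'.
have Dx' : D x' by apply: rD; apply: le_eball xx'; lra.
have n1 := ngreen_le0 n_gt0 hD hphi Dx Dy; have n2 := ngreen_le0 n_gt0 hD hphi Dx' Dy.
move: (w y x) (w y x') h1 h2 b1 b2 n1 n2 => a b.
move=> *; exact: (harnack_dist C0 e0 Hd).
Qed.

End compactness.

Lemma dist_three {R : realFieldType} (e a b c d : R) : `|d - b| <= e / 3 ->
  `|c - d| <= e / 3 -> `|a - b| <= e / 3 -> `|a - c| <= e.
Proof. by rewrite !ler_distl; lra. Qed.

Lemma dist_norm_le {R : realFieldType} (e a b : R) : `|a - b| <= e -> `|b| <= `|a| + e.
Proof.
move=> ab; rewrite -[X in `|X| <= _](subrK a) (le_trans (ler_normD _ _))//.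
by rewrite addrC lerD2l distrC.
Qed.

Section ultrafilter_limits.
Context {R : realType} {n : nat}.
Local Notation E := 'rV[R]_n.
Local Notation lam := (lebesgue_rV R n).
Hypothesis n_gt0 : (0 < n)%N.
Context {D : set E} (hD : greenian D) {phi : E -> R} (hphi : norming D phi).
Local Notation oD := (greenian_open hD).
Local Notation wphi := (norming_weight hphi).
Local Notation nrm := (nrm D phi).
Local Notation w := (ngreen D phi).
Implicit Types x y z : E.

Let mD : measurable D. Proof. exact: (open_measurable_rV oD). Qed.

(** The filter form of leaving every compact subset; [no_accumulation_escaping] identifies it with
    [no_accumulation] for sequences. *)
Definition escaping (F : set_system E) := F D /\ forall K, compact K -> K `<=` D -> F (~` K).

(** The properties of the limits on which the sequel relies; v is not itself asked to be a limit. *)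
Definition martin_limit (v : E -> R) :=
  [/\ harmonic D v, L1_mem D phi v, nrm v = 1 & forall x, D x -> v x < 0].

(** A compact member of [U] inside D forces convergence; otherwise [U] contains the complement of
    every compact subset. *)
Lemma ultra_dichotomy (U : set_system E) : UltraFilter U -> U D ->
  (exists2 y, D y & U --> y) \/ escaping U.
Proof.
move=> UU UD; have [|H] := pselect (exists2 y, D y & U --> y); first by left.
right; split => // K cK KD; have [UK|//] := in_ultra_setVsetC K UU.
exfalso; apply: H; move: cK; rewrite compact_ultra => /(_ U UU UK)[y [Ky Uy]].
by exists y => //; exact: KD.
Qed.

Section limit.
Variable U : set_system E.
Hypotheses (UU : UltraFilter U) (escU : escaping U).

Let UD : U D. Proof. by case: escU. Qed.

(** The premise [D x] sits inside the existential so that choice yields a function on the whole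
    space. *)
Lemma ngreen_ultra_cvg x : exists l : R, D x -> (w y x) @[y --> U] --> l.
Proof.
have [Dx|] := pselect (D x); last by exists 0.
have [r r0 rD] := domain_eball hD Dx.
have [C C0 HC] := ngreen_bounded n_gt0 hD hphi r0 rD.
have [|l] := @ultra_bounded_cvg R E U (w^~ x) C UU; last by exists l.
apply: filterS2 UD (escU.2 _ (eball_compact x r) rD) => y Dy yr.
by apply: HC => //; apply: eball_center; rewrite divr_ge0// ltW.
Qed.

Variable v : E -> R.
Hypothesis vlim : forall x, D x -> (w y x) @[y --> U] --> v x.

(** The equicontinuity estimate passes to v; hence [w y] is near v on a whole ball as soon as it is
    near v at the centre. *)
Lemma ultra_limit_local x (e : R) : D x -> 0 < e -> exists2 d, 0 < d &
  [/\ eball x d `<=` D, forall x', eball x d x' -> `|v x' - v x| <= e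
    & U [set y | forall x', eball x d x' -> `|w y x' - v x'| <= e]].
Proof.
move=> Dx e0; have e30 : 0 < e / 3 by rewrite divr_gt0.
have [r r0 [rD [d /andP[d0 dr] Hd]]] := ngreen_equicontinuous n_gt0 hD hphi Dx e30.
have Ur := escU.2 _ (eball_compact x r) rD.
have dD : eball x d `<=` D by apply: subset_trans rD; exact: le_eball.
have vx x' : eball x d x' -> `|v x' - v x| <= e / 3.
  move=> xx'; have cw : (`|w y x' - w y x|) @[y --> U] --> `|v x' - v x|.
    by apply: cvg_norm; apply: cvgB; apply: vlim => //; exact: dD.
  apply: (cvgr_to_le cw); apply: filterS2 UD Ur => y Dy yr; exact: Hd.
exists d => //; split => //.
  by move=> x' /vx vv; rewrite (le_trans vv)// ler_pdivrMr// ler_peMr ?ler1n// ltW.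
have Uw : U [set y | `|v x - w y x| <= e / 3] by move: (vlim Dx) => /cvgrPdist_le; exact.
apply: filterS3 UD Ur Uw => y Dy yr wx x' xx'.
exact: dist_three wx (vx x' xx') (Hd y Dy yr x' xx').
Qed.

Lemma ultra_limit_continuous x : D x -> {for x, continuous v}.
Proof.
move=> Dx; apply/(@cvgrPdist_le _ _ _ (nbhs x) (nbhs_filter x)) => e e0.
have [d d0 [_ vd _]] := ultra_limit_local Dx e0.
by apply: filterS (nbhs_eball x d0) => x' /vd; rewrite distrC.
Qed.

Lemma ultra_limit_uniform K (e : R) : compact K -> K `<=` D -> 0 < e ->
  U [set y | forall x, K x -> `|w y x - v x| <= e].
Proof.
move=> /compact_near_coveringP cK KD e0.
apply: (cK E U (fun y x => `|w y x - v x| <= e)) => x Kx.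
have [d d0 [_ _ Ud]] := ultra_limit_local (KD _ Kx) e0.
exists (eball x d, [set y | forall x', eball x d x' -> `|w y x' - v x'| <= e]).
  by split => //; exact: nbhs_eball.
by move=> [x' y] /= [xx' H]; exact: H.
Qed.

Lemma ultra_limit_harmonic : harmonic D v.
Proof.
apply: harmonicP => [x|x r r0 rD]; first exact: ultra_limit_continuous.
have cB := eball_compact x r.
apply/eqP; rewrite -subr_eq0 -normr_le0; apply/ler_addgt0Pl => e e0; rewrite addr0.
have e20 : 0 < e / 2 by rewrite divr_gt0.
have [y [[Dy yr] Hy]] := filter_ex (filterI (filterI UD (escU.2 _ cB rD)) (ultra_limit_uniform cB rD e20)).
have hw : harmonic (D `\ y) (w y) := harmonic_ngreen hD Dy.
have rDy : eball x r `<=` D `\ y.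
  by move=> z zr; split; [exact: rD|move=> zy; apply: yr; rewrite -zy].
rewrite (_ : v x - rmean v x r = (v x - w y x) + (rmean (w y) x r - rmean v x r)); last first.
  by rewrite -(harmonic_rmean hw r0 rDy) addrA subrK.
rewrite (le_trans (ler_normD _ _))// [leRHS]splitr lerD//.
  by rewrite distrC Hy//; apply: eball_center; exact: ltW.
apply: rmean_dist_le => // z /[dup] /rDy zDy zr.
- exact: harmonic_continuous hw zDy.
- by apply: ultra_limit_continuous; exact: rD.
Qed.

(** Condition (2) gives one negative upper bound for all poles y <> x, so the limit cannot
    vanish. *)
Lemma ultra_limit_lt0 x : D x -> v x < 0.
Proof.
move=> Dx; have Dx1 : [set x] `<=` D by move=> z ->.
have c1 : compact [set x] by exact: compact_set1.
have [C C0 HC] := ngreen_upper n_gt0 hD hphi c1 Dx1.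
apply: (@le_lt_trans _ _ (- C)); last by rewrite oppr_lt0.
apply: (cvgr_to_le (vlim Dx)); apply: filterS2 UD (escU.2 _ c1 Dx1) => y Dy xy.
by apply: HC => //; apply/eqP => yx; apply: xy; rewrite yx.
Qed.

Lemma ultra_limit_measurable : measurable_fun D v.
Proof. by apply: measurable_continuous => // x; exact: ultra_limit_continuous. Qed.

Lemma weight_mass : exists2 P : R, 0 <= P & (\int[lam]_(x in D) (phi x)%:E = P%:E)%E.
Proof.
have P0 : (0 <= \int[lam]_(x in D) (phi x)%:E)%E.
  by apply: integral_ge0 => x Dx; rewrite lee_fin (weight_ge0 wphi).
exists (fine (\int[lam]_(x in D) (phi x)%:E)%E); first exact: fine_ge0.
by rewrite fineK// ge0_fin_numE// (weight_integrable hD hphi).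
Qed.

(** A substitute for Fatou's lemma: on each [A]&[D_ k] the convergence is uniform, and the integrals
    over these sets increase to the integral over [A]. *)
Lemma ultra_limit_wnorm (A : set E) (c : R) : measurable A -> A `<=` D ->
  (forall y, D y -> (wnorm A phi (EFin \o w y) <= c%:E)%E) ->
  (wnorm A phi (EFin \o v) <= c%:E)%E.
Proof.
move=> mA AD wc; have [D_ exD] := exhaustion_exists hD.1.
have mv := measurable_funS mD AD ultra_limit_measurable.
apply: (wnorm_exhaustion oD wphi exD) => // k.
have [dD cD _ _] := exD; have [P P0 PE] := weight_mass.
have mk : measurable (A `&` D_ k).
  by apply: measurableI => //; apply: open_measurable_rV; case: (dD k).
have kD : A `&` D_ k `<=` D by move=> x [/AD].
apply/lee_addgt0Pr => e e0.
(* The constant e / (P + 1) has weighted norm at most e; P + 1 avoids a division by 0. *)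
have eP : 0 < e / (P + 1) by rewrite divr_gt0// ltr_wpDl.
have [y [Dy Hy]] := filter_ex (filterI UD (ultra_limit_uniform (cD k).1 (cD k).2 eP)).
have mwy : measurable_fun D (w y) := (L1_ngreen n_gt0 hD hphi Dy).1.
have mS (u : E -> R) : measurable_fun D u -> measurable_fun (A `&` D_ k) u.
  by move=> mu; exact: measurable_funS mu.
apply: (@le_trans _ _ (wnorm (A `&` D_ k) phi (EFin \o w y) + wnorm (A `&` D_ k) phi (EFin \o cst (e / (P + 1))%R))%E).
  apply: (wnorm_leD oD wphi) => //; [exact: mS ultra_limit_measurable|exact: mS|].
  move=> x [_ xk]; rewrite [X in _ + X]ger0_norm ?(ltW eP)//.
  have := Hy x (subset_closure xk); exact: dist_norm_le.
apply: leeD.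
  apply: le_trans (wc y Dy); apply: (wnorm_subset oD wphi) => //.
  exact: measurable_funS mwy.
apply: (le_trans (wnorm_cst oD wphi (ltW eP) mk kD)).
rewrite PE -EFinM lee_fin mulrAC ler_pdivrMr ?ltr_wpDl// ler_pM2l// lerDl//.
Qed.

(** Condition (3) divided by the norm. Since j serves all y at once, no mass is lost at the boundary
    in the limit. *)
Lemma wnorm_tail (D_ : nat -> set E) : exhaustion D D_ -> forall e : R, 0 < e ->
  exists j, forall y, D y -> (wnorm (D `\` D_ j) phi (EFin \o w y) <= e%:E)%E.
Proof.
move=> exD e e0; have [_ _ _ /(_ D_ exD)[eps [eps0 epsl Heps]]] := hphi.
have [j _ /(_ j (leqnn j)) /= ej] := cvgr_le _ epsl _ e0.
exists j => y Dy; apply: (@le_trans _ _ (eps j)%:E); last by rewrite lee_fin.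
have [dD _ _ _] := exD.
have mDj : measurable (D `\` D_ j).
  by apply: measurableD => //; apply: open_measurable_rV; case: (dD j).
have l0 := green_norm_gt0 n_gt0 hD hphi Dy.
have DjD : D `\` D_ j `<=` D by move=> x [].
have mphi : measurable_fun D (EFin \o phi) by apply/measurable_EFinP; exact: (measurable_phi hD hphi).
have := Heps _ (green_negative_subharmonic hD Dy) j.
rewrite -[wnorm D phi _]/(green_norm D phi y) (green_normE n_gt0 hD hphi Dy).
set l := fine _ in l0 *; rewrite -EFinM => Hj.
have -> : (eps j)%:E = (l^-1%:E * (eps j * l)%:E)%E.
  by rewrite -EFinM mulrCA mulVf ?mulr1// gt_eqF.
have lV0 : (0 <= l^-1%:E)%E by rewrite lee_fin invr_ge0 ltW.
apply: le_trans (lee_wpmul2l lV0 Hj).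
rewrite /wnorm -ge0_integralZl//; last 2 first.
- apply: measurable_funS (DjD) _ => //; apply: emeasurable_funM => //.
  by apply: measurableT_comp => //; exact: (measurable_green hD Dy).
- by move=> x [Dx _]; rewrite mule_ge0// lee_fin (weight_ge0 wphi).
apply: ge0_le_integral => //.
- by move=> x [Dx _]; rewrite mule_ge0// lee_fin (weight_ge0 wphi).
- apply: measurable_funS (DjD) _ => //.
  exact: (measurable_wnorm oD wphi (L1_ngreen n_gt0 hD hphi Dy).1).
- apply: emeasurable_funM => //; apply: measurable_funS (DjD) _ => //; apply: emeasurable_funM => //.
  by apply: measurableT_comp => //; exact: (measurable_green hD Dy).
move=> x [Dx _]; rewrite muleA; apply: lee_wpmul2r; first by rewrite lee_fin (weight_ge0 wphi).
rewrite /= /ngreen -/l normrM EFinM ger0_norm ?invr_ge0 ?(ltW l0)//.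
apply: lee_wpmul2l => //.
by case: (green D x y) => [t| |]; rewrite /= ?lexx ?leey.
Qed.

(** One third of e for [D_ j], by uniform convergence on its compact closure, and one third each for
    the tails of [w y] and of v, the latter through [ultra_limit_wnorm]. *)
Lemma ultra_limit_nrm (e : R) : 0 < e -> U [set y | nrm (fun x => w y x - v x) <= e].
Proof.
move=> e0; have [D_ exD] := exhaustion_exists hD.1.
have [dD cD _ _] := exD; have [P P0 PE] := weight_mass.
have e30 : 0 < e / 3 by rewrite divr_gt0.
have [j Hj] := wnorm_tail exD e30.
have eP : 0 < e / 3 / (P + 1) by rewrite divr_gt0// ltr_wpDl.
have mDj : measurable (D_ j) by apply: open_measurable_rV; case: (dD j).
have mDDj : measurable (D `\` D_ j) by exact: measurableD.
have DDj : D `\` D_ j `<=` D by move=> x [].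
have DjD : D_ j `<=` D by apply: subset_trans (cD j).2; exact: subset_closure.
have mv := ultra_limit_measurable.
have vj := ultra_limit_wnorm mDDj DDj Hj.
apply: filterS2 UD (ultra_limit_uniform (cD j).1 (cD j).2 eP) => y Dy Hy.
have mwy : measurable_fun D (w y) := (L1_ngreen n_gt0 hD hphi Dy).1.
have mwv : measurable_fun D (fun x => w y x - v x) by exact: measurable_funB.
suff : (wnorm D phi (EFin \o (fun x => w y x - v x)%R) <= e%:E)%E.
  rewrite /nrm /= => H; rewrite -lee_fin fineK//.
  by rewrite ge0_fin_numE ?(wnorm_ge0 wphi)// (le_lt_trans H)// ltry.
have mphiw := measurable_wnorm oD wphi mwv.
rewrite {1}/wnorm -{1}(setDUK DjD) ge0_integral_setU//; last 3 first.
- by rewrite setDUK.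
- by rewrite setDUK// => x Dx; rewrite mule_ge0// lee_fin (weight_ge0 wphi).
- by apply/disj_setPS => x [? []].
rewrite (_ : e%:E = ((e / 3)%:E + ((e / 3)%:E + (e / 3)%:E))%E); last first.
  by rewrite -!EFinD; congr EFin; field.
apply: leeD.
- apply: (@le_trans _ _ (wnorm (D_ j) phi (EFin \o cst (e / 3 / (P + 1))))).
    apply: ge0_le_integral => //.
    + by move=> x /DjD Dx; rewrite mule_ge0// lee_fin (weight_ge0 wphi).
    + exact: measurable_funS mphiw.
    + apply: measurable_funS DjD _ => //.
      exact: (measurable_wnorm oD wphi (measurable_cst _)).
    move=> x xj; apply: lee_wpmul2r; first by rewrite lee_fin (weight_ge0 wphi)//; exact: DjD.
    by rewrite /= lee_fin [leRHS]ger0_norm ?(ltW eP)// Hy//; exact: subset_closure.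
  apply: (le_trans (wnorm_cst oD wphi (ltW eP) mDj DjD)).
  by rewrite PE -EFinM lee_fin mulrAC ler_pdivrMr ?ltr_wpDl// ler_pM2l// lerDl.
- apply: le_trans (leeD (Hj y Dy) vj).
  apply: (wnorm_leD oD wphi) => //.
  + exact: measurable_funS mwv.
  + exact: measurable_funS mwy.
  + exact: measurable_funS mv.
  + by move=> x _; exact: ler_normB.
Qed.

Lemma ultra_martin_limit : martin_limit v.
Proof.
have L1v : L1_mem D phi v.
  split; first exact: ultra_limit_measurable.
  apply: (@le_lt_trans _ _ 1%E); last exact: ltry.
  apply: (@ultra_limit_wnorm D 1) => // y Dy.
  by rewrite (wnorm_ngreen n_gt0 hD hphi Dy).
split => //; [exact: ultra_limit_harmonic| |exact: ultra_limit_lt0].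
apply/eqP; rewrite -subr_eq0 -normr_le0; apply/ler_addgt0Pl => e e0; rewrite addr0.
have [y [Dy Hy]] := filter_ex (filterI UD (ultra_limit_nrm e0)).
have := ler_dist_nrm oD wphi L1v (L1_ngreen n_gt0 hD hphi Dy).
rewrite nrm_distC (nrm_ngreen n_gt0 hD hphi Dy) => /le_trans; exact.
Qed.

End limit.

Lemma ultra_limit_exists (U : set_system E) : UltraFilter U -> escaping U ->
  exists2 v, martin_limit v & (Phi hD hphi y @[y --> U] --> toL1 oD wphi v).
Proof.
move=> UU escU; have /choice[v vlim] := ngreen_ultra_cvg UU escU.
have mv := ultra_martin_limit UU escU vlim; exists v => //.
have [_ Lv _ _] := mv.
apply/cvg_ballP => e e0; have e20 : 0 < e / 2 by rewrite divr_gt0.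
apply: filterS2 escU.1 (ultra_limit_nrm UU escU vlim e20) => y Dy Hy.
apply: ball_sym; rewrite ballEmdist /= PhiE mdist_toL1//; last exact: L1_ngreen.
by rewrite (le_lt_trans Hy)// ltr_pdivrMr// ltr_pMr// ltr1n.
Qed.

End ultrafilter_limits.

(** * Homeomorphisms from convergent sequences *)

Section filters.

(** If [A] were not in [F], the complement of [A] could be adjoined to [F], and an ultrafilter above
    would contain both. This lets claims about sequences be checked along ultrafilters. *)
Lemma filter_ultra {T : Type} (F : set_system T) (A : set T) : Filter F ->
  (forall U : set_system T, UltraFilter U -> F `<=` U -> U A) -> F A.
Proof.
move=> FF FU; apply: contrapT => FA.
have PW : ProperFilter (within (~` A) F).
  apply: Build_ProperFilter_ex => B FB; apply: contrapT => B0; apply: FA.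
  have {}FB : F [set x | (~` A) x -> B x] by exact: FB.
  by apply: filterS FB => x /= Bx; apply: contrapT => Ax; apply: B0; exists x; exact: Bx.
have [U [UU WU]] := ultraFilterLemma PW.
have UA : U A by apply: FU => // B FB; apply: WU; apply: filterS FB.
have UnA : U (~` A) by apply: WU; apply: (@filterE _ F) => x.
have : U (A `&` ~` A) by exact: filterI.
by rewrite setICr => /filter_ex[].
Qed.

Lemma compact_ultra_cvg {S : Type} {T : topologicalType} (f : S -> T) (U : set_system S) (A : set T) :
  compact A -> UltraFilter U -> U (f @^-1` A) -> exists2 q, A q & f @ U --> q.
Proof.
rewrite compact_ultra => cA UU UA.
by have [q [Aq fq]] := cA (f @ U) (ultra_fmap f UU) UA; exists q.
Qed.

Lemma ultra_cvg {S : Type} {T : topologicalType} (f : S -> T) (F : set_system S) (q : T) : Filter F ->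
  (forall U, UltraFilter U -> F `<=` U -> f @ U --> q) -> f @ F --> q.
Proof.
move=> FF fU B Bq; apply: (@filter_ultra _ F (f @^-1` B) FF) => U UU FU; exact: (fU U UU FU B Bq).
Qed.

End filters.

Section metric_sequences.
Context {R : realType} {X : metricType R}.
Implicit Types (p q : X).

Lemma mdist_cvgP {T : Type} (F : set_system T) (f : T -> X) p : Filter F ->
  (f @ F --> p) <-> (forall e : R, 0 < e -> F [set x | mdist p (f x) < e]).
Proof.
move=> FF; rewrite cvg_ballP; split=> H e /H; apply: filterS => x; by rewrite ballEmdist.
Qed.

Lemma closure_mdistP (A : set X) p : closure A p <-> forall e : R, 0 < e -> exists2 q, A q & mdist p q < e.
Proof.
split=> [cl e e0|H B /nbhs_ballP[e /= e0 eB]].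
  have [q [Aq]] := cl _ (nbhsx_ballx p e e0).
  by rewrite ballEmdist /= => pq; exists q.
by have [q Aq pq] := H e e0; exists q; split => //; apply: eB; rewrite ballEmdist.
Qed.

Lemma cvg_mdist_seq (f : nat -> X) p : (forall j, mdist p (f j) < j.+1%:R^-1) -> f @ \oo --> p.
Proof.
move=> H; apply/mdist_cvgP => e e0.
by apply: filterS (near_infty_natSinv_lt (PosNum e0)) => j /=; exact: lt_trans.
Qed.

Lemma closure_seqP (T : Type) (D : set T) (a : T -> X) p : closure (a @` D) p ->
  exists2 y_ : nat -> T, (forall j, D (y_ j)) & a (y_ j) @[j --> \oo] --> p.
Proof.
move=> /closure_mdistP cl.
have /choice[y_ Hy] : forall j : nat, exists y, D y /\ mdist p (a y) < j.+1%:R^-1.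
  move=> j; have j0 : 0 < j.+1%:R^-1 :> R by rewrite invr_gt0.
  by have [_ [y Dy <-] py] := cl _ j0; exists y.
by exists y_; [move=> j; exact: (Hy j).1|apply: cvg_mdist_seq => j; exact: (Hy j).2].
Qed.

End metric_sequences.

Section dense_extension.
Context {R : realType} {X Y : metricType R} {T : Type}.
Variables (D : set T) (a : T -> X) (b : T -> Y).
Hypothesis D0 : D !=set0.
Hypothesis ab : forall y_ : nat -> T, (forall j, D (y_ j)) ->
  forall p : X, a (y_ j) @[j --> \oo] --> p -> exists q : Y, b (y_ j) @[j --> \oo] --> q.

(* interleaving two sequences *)
Let b_unique (y_ y'_ : nat -> T) (p : X) (q q' : Y) : (forall j, D (y_ j)) -> (forall j, D (y'_ j)) ->
  a (y_ j) @[j --> \oo] --> p -> a (y'_ j) @[j --> \oo] --> p ->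
  b (y_ j) @[j --> \oo] --> q -> b (y'_ j) @[j --> \oo] --> q' -> q = q'.
Proof.
move=> Dy Dy' ay ay' by_ by'.
pose z_ j := if odd j then y'_ j./2 else y_ j./2.
have Dz j : D (z_ j) by rewrite /z_; case: ifP.
have half_oo : (fun j => j./2) @ \oo --> \oo.
  move=> A [N _ NA]; exists N.*2 => // j /= Nj; apply: NA => /=.
  by rewrite -(doubleK N) half_leq.
have az : a (z_ j) @[j --> \oo] --> p.
  apply/mdist_cvgP => e e0.
  have h1 : \forall j \near \oo, mdist p (a (y_ j./2)) < e.
    exact: (half_oo _ ((mdist_cvgP _ _ _).1 ay e e0)).
  have h2 : \forall j \near \oo, mdist p (a (y'_ j./2)) < e.
    exact: (half_oo _ ((mdist_cvgP _ _ _).1 ay' e e0)).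
  apply: (@filterS2 _ \oo _ _ _ _ _ h1 h2) => j /= h1' h2'.
  by rewrite /z_; case: ifP.
have [r bz] := ab Dz az.
have even_oo : (fun j => j.*2) @ \oo --> \oo.
  move=> A [N _ NA]; exists N => // j /= Nj; apply: NA => /=.
  by rewrite (leq_trans Nj)// -addnn leq_addr.
have odd_oo : (fun j => j.*2.+1) @ \oo --> \oo.
  move=> A [N _ NA]; exists N => // j /= Nj; apply: NA => /=.
  by rewrite (leq_trans Nj)// -addnn leqW// leq_addr.
have hY : hausdorff_space Y by exact: metric_hausdorff.
transitivity r.
  apply: (cvg_unique hY by_); have := cvg_comp _ _ even_oo bz.
  by rewrite (_ : _ \o _ = (fun j => b (y_ j)))//; apply/funext => j; rewrite /= /z_ odd_double doubleK.
apply: (cvg_unique hY _ by'); have := cvg_comp _ _ odd_oo bz.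
by rewrite (_ : _ \o _ = (fun j => b (y'_ j)))//; apply/funext => j; rewrite /= /z_ /= odd_double uphalf_double.
Qed.

(** The extension takes limits along sequences and is single-valued by [b_unique]. *)
Lemma dense_extension : exists h : X -> Y,
  [/\ {within closure (a @` D), continuous h},
     (forall (y_ : nat -> T) (p : X), (forall j, D (y_ j)) -> a (y_ j) @[j --> \oo] --> p -> b (y_ j) @[j --> \oo] --> h p)
    & forall p, closure (a @` D) p -> closure (b @` D) (h p)].
Proof.
have [t0 Dt0] := D0.
have /choice[h Hh] : forall p : X, exists q : Y, forall (y_ : nat -> T), (forall j, D (y_ j)) ->
    a (y_ j) @[j --> \oo] --> p -> b (y_ j) @[j --> \oo] --> q.
  move=> p; have [[y_ Dy ay]|H] := pselect (exists2 y_ : nat -> T, (forall j, D (y_ j)) & a (y_ j) @[j --> \oo] --> p); last first.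
    (* Off the closure no sequence converges to p, and [b t0] is a default value. *)
    by exists (b t0) => y_ Dy ay; exfalso; apply: H; exists y_.
  have [q bq] := ab Dy ay; exists q => y'_ Dy' ay'.
  have [q' bq'] := ab Dy' ay'.
  by rewrite (b_unique Dy Dy' ay ay' bq bq').
have hcl p : closure (a @` D) p -> closure (b @` D) (h p).
  move=> /closure_seqP[y_ Dy ay]; apply/closure_mdistP => e e0.
  have [j Hj] := filter_ex ((mdist_cvgP _ _ _).1 (Hh p y_ Dy ay) e e0).
  by exists (b (y_ j)) => //; exists (y_ j).
exists h; split => [|y_ p Dy ay|//]; last exact: Hh.
apply/subspace_continuousP => p Ap; apply/mdist_cvgP => e e0.
apply: contrapT => nW.
(* Were h discontinuous at p, some [q_ j] tending to p would have values at distance at least e from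
   [h p]. Each is replaced below by a nearby [a (y_ j)] with [b (y_ j)] within e / 2 of [h (q_ j)],
   against the convergence of [b (y_ j)] to [h p]. *)
have /choice[q_ Hq] : forall j : nat, exists q, [/\ closure (a @` D) q, mdist p q < j.+1%:R^-1 & ~ mdist (h p) (h q) < e].
  move=> j; apply: contrapT => H; apply: nW.
  have j0 : 0 < j.+1%:R^-1 :> R by rewrite invr_gt0.
  apply: filterS (nbhsx_ballx p _ j0) => q; rewrite ballEmdist /= => pq Aq.
  by apply: contrapT => hq; apply: H; exists q.
have e20 : 0 < e / 2 by rewrite divr_gt0.
have /choice[y_ Hy] : forall j : nat, exists y, [/\ D y, mdist (q_ j) (a y) < j.+1%:R^-1 & mdist (h (q_ j)) (b y) < e / 2].
  move=> j; have [Aq _ _] := Hq j; have [y_ Dy ay] := closure_seqP Aq.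
  have j0 : 0 < j.+1%:R^-1 :> R by rewrite invr_gt0.
  have [k [H1 H2]] := filter_ex (filterI ((mdist_cvgP _ _ _).1 ay _ j0) ((mdist_cvgP _ _ _).1 (Hh _ y_ Dy ay) _ e20)).
  by exists (y_ k); split.
have Dy j : D (y_ j) by case: (Hy j).
have ay : a (y_ j) @[j --> \oo] --> p.
  apply/mdist_cvgP => d d0; have d20 : 0 < d / 2 by rewrite divr_gt0.
  apply: filterS (near_infty_natSinv_lt (PosNum d20)) => j /= jd.
  have [_ h1 _] := Hy j; have [_ h2 _] := Hq j.
  rewrite (le_lt_trans (metric_triangle p (q_ j) _))// [ltRHS]splitr ltrD//.
    exact: lt_trans jd.
  exact: lt_trans jd.
have [j /= Hj] := filter_ex ((mdist_cvgP _ _ _).1 (Hh p y_ Dy ay) _ e20).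
have [_ _ h1] := Hy j; have [_ _] := Hq j; apply.
rewrite (le_lt_trans (metric_triangle _ (b (y_ j)) _))// [ltRHS]splitr ltrD//.
by rewrite metric_sym.
Qed.

End dense_extension.

Lemma dense_homeomorphism {R : realType} {X Y : metricType R} {T : Type} (D : set T)
    (a : T -> X) (b : T -> Y) : D !=set0 ->
  (forall y_ : nat -> T, (forall j, D (y_ j)) -> forall p : X, a (y_ j) @[j --> \oo] --> p ->
    exists q : Y, b (y_ j) @[j --> \oo] --> q) ->
  (forall y_ : nat -> T, (forall j, D (y_ j)) -> forall q : Y, b (y_ j) @[j --> \oo] --> q ->
    exists p : X, a (y_ j) @[j --> \oo] --> p) ->
  exists2 h : X -> Y, homeomorphism_on (closure (a @` D)) (closure (b @` D)) h &
    forall (y_ : nat -> T) (p : X), (forall j, D (y_ j)) -> a (y_ j) @[j --> \oo] --> p ->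
      b (y_ j) @[j --> \oo] --> h p.
Proof.
move=> D0 ab ba.
have [h [ch hseq hcl]] := dense_extension D0 ab.
have [g [cg gseq gcl]] := dense_extension D0 ba.
exists h => //; split => //; exists g; split => //.
- by move=> _ [p /hcl hp <-].
- by move=> _ [p /gcl gp <-].
- move=> p /set_mem /closure_seqP[y_ Dy ay].
  exact: (cvg_unique (@metric_hausdorff R X) (gseq _ _ Dy (hseq _ _ Dy ay)) ay).
- move=> q /set_mem /closure_seqP[y_ Dy by_].
  exact: (cvg_unique (@metric_hausdorff R Y) (hseq _ _ Dy (gseq _ _ Dy by_)) by_).
Qed.

(** * The closure of Phi(D) *)

(** An ultrafilter [W] on the closure is transported to T: the points whose image is within e of a
    member of [W] form the sets [B], which generate a proper filter. The limit p of [a] along an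
    ultrafilter above it is the limit of [W], for otherwise the complement of a ball about p would
    be in [W], yet contain points close to p. *)
Lemma compact_closure_image {R : realType} {X : metricType R} {T : Type} (D : set T) (a : T -> X) :
  (forall U : set_system T, UltraFilter U -> U D -> exists p : X, a @ U --> p) ->
  compact (closure (a @` D)).
Proof.
move=> aU; rewrite compact_ultra => W WW Wcl.
pose I := [set Ae : set X * R | W Ae.1 /\ 0 < Ae.2].
pose B (Ae : set X * R) := [set y | D y /\ exists2 q, Ae.1 q & mdist (a y) q < Ae.2].
have PB : ProperFilter (filter_from I B).
  apply: filter_from_proper; first apply: filter_from_filter.
  - by exists (setT, 1); split => //=; exact: filterT.
  - move=> [A e] [A' e'] [/= WA e0] [/= WA' e0'].
    exists (A `&` A', Num.min e e'); first by split; [exact: filterI|rewrite /= lt_min e0].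
    by move=> y [Dy [q [Aq A'q]]] /=; rewrite lt_min => /andP[h1 h2]; split; split => //; exists q.
  - move=> [A e] [/= WA e0].
    have [q [clq Aq]] := filter_ex (filterI Wcl WA).
    have [_ [y Dy <-] qy] := (closure_mdistP _ _).1 clq e e0.
    by exists y; split => //; exists q => //; rewrite metric_sym.
have [U [UU BU]] := ultraFilterLemma PB.
have UD : U D.
  apply: BU; exists (setT, 1); first by split => //=; exact: filterT.
  by move=> y [].
have [p ap] := aU U UU UD.
exists p; split.
  apply/closure_mdistP => e e0.
  have [y [Dy py]] := filter_ex (filterI UD ((mdist_cvgP _ _ _).1 ap e e0)).
  by exists (a y) => //; exists y.
move=> N /nbhs_ballP[e /= e0 eN]; apply: (filterS eN).
have [//|Wn] := in_ultra_setVsetC (ball p e) WW.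
have e20 : 0 < e / 2 by rewrite divr_gt0.
have UB : U (B (~` ball p e, e / 2)) by apply: BU; exists (~` ball p e, e / 2).
have [y [[Dy [q nq yq]] py]] := filter_ex (filterI UB ((mdist_cvgP _ _ _).1 ap _ e20)).
exfalso; apply: nq; rewrite ballEmdist /=.
by rewrite (le_lt_trans (metric_triangle p (a y) q))// [ltRHS]splitr ltrD.
Qed.

Section structure.
Context {R : realType} {n : nat}.
Local Notation E := 'rV[R]_n.
Hypothesis n_gt0 : (0 < n)%N.
Context {D : set E} (hD : greenian D) {phi : E -> R} (hphi : norming D phi).
Local Notation oD := (greenian_open hD).
Local Notation wphi := (norming_weight hphi).
Local Notation nrm := (nrm D phi).
Local Notation w := (ngreen D phi).
Local Notation Phi := (Phi hD hphi).
Local Notation X := (L1_norming hD hphi).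
Implicit Types (x y z : E) (p q : X).

Lemma Phi_cvg {T : Type} (F : set_system T) (g : T -> E) y : Filter F -> D y ->
  g @ F --> y -> Phi (g t) @[t --> F] --> Phi y.
Proof.
move=> FF Dy gy; apply/mdist_cvgP => e e0; have e20 : 0 < e / 2 by rewrite divr_gt0.
have [d d0 Hd] := Phi_near n_gt0 hD hphi Dy e20.
have Fg : F [set t | eball y d (g t)] by exact: (gy _ (nbhs_eball y d0)).
apply: filterS Fg => t /= /Hd[_].
move=> H; rewrite (metric_sym (Phi y) (Phi (g t))); apply: (le_lt_trans H).
by rewrite ltr_pdivrMr// ltr_pMr// ltr1n.
Qed.

Lemma Phi_ultra (U : set_system E) : UltraFilter U -> U D -> exists p, Phi @ U --> p.
Proof.
move=> UU UD; have [[y Dy Uy]|esc] := ultra_dichotomy UU UD.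
  by exists (Phi y); apply: (@Phi_cvg _ U id).
by have [v _ Hv] := ultra_limit_exists n_gt0 hD hphi UU esc; exists (toL1 oD wphi v).
Qed.

Lemma Dtilde_compact : compact (Dtilde hD hphi).
Proof. exact: compact_closure_image Phi_ultra. Qed.

Lemma Phi_Dtilde y : D y -> Dtilde hD hphi (Phi y).
Proof. by move=> Dy; apply: subset_closure; exists y. Qed.

Lemma ultra_cases (U : set_system E) p : UltraFilter U -> U D -> Phi @ U --> p ->
  (exists y, [/\ D y, U --> y & p = Phi y]) \/
  (escaping (D := D) U /\ exists2 v, martin_limit (D := D) (phi := phi) v & p = toL1 oD wphi v).
Proof.
move=> UU UD Up; have hX : hausdorff_space X by exact: metric_hausdorff.
have [[y Dy Uy]|esc] := ultra_dichotomy UU UD.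
  left; exists y; split => //; apply: (cvg_unique hX Up).
  by apply: (@Phi_cvg _ U id).
right; split => //; have [v mv Hv] := ultra_limit_exists n_gt0 hD hphi UU esc.
by exists v => //; exact: (cvg_unique hX Up Hv).
Qed.

Section limits.
Context {T : Type} (F : set_system T) {PF : ProperFilter F} (g : T -> E).
Hypothesis FD : F [set t | D (g t)].

Lemma Phi_limit_cases p : Phi (g t) @[t --> F] --> p ->
  (exists2 y, D y & p = Phi y) \/ (exists2 v, martin_limit (D := D) (phi := phi) v & p = toL1 oD wphi v).
Proof.
move=> Fp; have [U [UU FU]] := ultraFilterLemma PF.
have Up : Phi @ (g @ U) --> p by move=> B /Fp /FU.
have [[y [Dy _ py]]|[_ [v mv pv]]] := ultra_cases (ultra_fmap g UU) (FU _ FD) Up.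
  by left; exists y.
by right; exists v.
Qed.

(** Continuity of the inverse of Phi: along every finer ultrafilter g converges in D, and then to y
    by injectivity, or escapes, and then Phi y would be the class of a harmonic function. *)
Lemma Phi_limit_interior y : D y -> Phi (g t) @[t --> F] --> Phi y -> g @ F --> y.
Proof.
move=> Dy Fy; apply: ultra_cvg => U UU FU.
have Up : Phi @ (g @ U) --> Phi y by move=> B /Fy /FU.
have [[z [Dz gz yz]]|[_ [v [hv Lv _ _] yv]]] := ultra_cases (ultra_fmap g UU) (FU _ FD) Up.
  by rewrite (Phi_inj n_gt0 Dy Dz yz).
by have := Phi_neq_harmonic n_gt0 Dy hv Lv yv.
Qed.

(** Staying in a compact set along some ultrafilter would give a limit Phi z, which is the class of
    no harmonic function. *)
Lemma Phi_limit_escaping v : harmonic D v -> L1_mem D phi v ->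
  Phi (g t) @[t --> F] --> toL1 oD wphi v -> escaping (D := D) (g @ F).
Proof.
move=> hv Lv Fv; split => // K cK KD.
apply: (@filter_ultra _ F (g @^-1` (~` K))) => U UU FU.
have [UK|//] := in_ultra_setVsetC (g @^-1` K) UU.
have [z Kz gz] := compact_ultra_cvg cK UU UK.
have Dz := KD _ Kz.
have Uv : Phi (g t) @[t --> U] --> toL1 oD wphi v by move=> B /Fv /FU.
have hX : hausdorff_space X by exact: metric_hausdorff.
have := Phi_neq_harmonic n_gt0 (hD := hD) (hphi := hphi) Dz hv Lv.
by case; exact: (cvg_unique hX (Phi_cvg _ Dz gz) Uv).
Qed.

End limits.

(** Evaluation near x is Lipschitz for the L1 distance on functions harmonic around x. One pair r, C
    serves limit functions and Green functions with pole off the ball, since continuity at a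
    boundary point compares both kinds. *)
Lemma eval_local x : D x -> exists r C : R, [/\ 0 < r, 0 < C, eball x r `<=` D,
  forall y v, D y -> ~ eball x r y -> harmonic D v -> L1_mem D phi v ->
    forall x', eball x (r / 2) x' -> `|w y x' - v x'| <= C * mdist (Phi y) (toL1 oD wphi v)
  & forall v v', harmonic D v -> L1_mem D phi v -> harmonic D v' -> L1_mem D phi v' ->
    forall x', eball x (r / 2) x' ->
      `|v x' - v' x'| <= C * mdist (toL1 oD wphi v) (toL1 oD wphi v')].
Proof.
move=> Dx; have [r r0 rD] := domain_eball hD Dx.
have [C C0 HC] := harmonic_le_wnorm oD wphi r0 rD.
have key O u u' : L1_mem D phi u -> L1_mem D phi u' -> eball x r `<=` O ->
    harmonic O u -> harmonic O u' -> forall x', eball x (r / 2) x' ->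
    `|u x' - u' x'| <= C * mdist (toL1 oD wphi u) (toL1 oD wphi u').
  move=> Lu Lu' rO hu hu' x' xx'; have Luu := L1_memB oD wphi Lu Lu'.
  have := HC O _ Luu.1 rO (harmonicB hu hu') x' xx'.
  by rewrite (wnormE wphi Luu) -EFinM lee_fin mdist_toL1.
exists r, C; split => //.
- move=> y v Dy xy hv Lv x' xx'; rewrite PhiE.
  apply: (key (D `\ y) (w y) v) => //.
  + exact: L1_ngreen.
  + by move=> z zr; split; [exact: rD|move=> zy; apply: xy; rewrite -zy].
  + exact: harmonic_ngreen.
  + by apply: harmonicS hv => z [].
- by move=> v v' hv Lv hv' Lv' x' xx'; apply: (key D v v').
Qed.

Lemma toL1_harmonic_inj v v' : harmonic D v -> L1_mem D phi v -> harmonic D v' -> L1_mem D phi v' ->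
  toL1 oD wphi v = toL1 oD wphi v' -> forall x, D x -> v x = v' x.
Proof.
move=> hv Lv hv' Lv' vv x Dx; have [r [C [r0 C0 rD _ HC]]] := eval_local Dx.
have xr : eball x (r / 2) x by apply: eball_center; rewrite divr_ge0// ltW.
have := HC v v' hv Lv hv' Lv' x xr.
by rewrite vv mdistxx mulr0 normr_le0 subr_eq0 => /eqP.
Qed.

Lemma eq_nrm (u u' : E -> R) : (forall x, D x -> u x = u' x) -> nrm u = nrm u'.
Proof. by move=> uu; congr fine; apply: eq_integral => x /set_mem Dx; rewrite /= uu. Qed.

(** Equal ratios mean v = c v' with c = v x0 / v' x0 > 0, and the norms, both 1, give c = 1. *)
Lemma martin_ratio_inj x0 v v' : D x0 -> martin_limit (D := D) (phi := phi) v ->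
  martin_limit (D := D) (phi := phi) v' ->
  (forall x, D x -> v x / v x0 = v' x / v' x0) -> toL1 oD wphi v = toL1 oD wphi v'.
Proof.
move=> Dx0 [hv Lv nv v0] [hv' Lv' nv' v0'] ratio.
pose c := v x0 / v' x0.
have vx0 := v0 x0 Dx0; have vx0' := v0' x0 Dx0.
have vc x : D x -> v x = c * v' x.
  move=> Dx; have := ratio x Dx => /(congr1 (fun t => t * v x0)).
  by rewrite divfK ?lt_eqF// => ->; rewrite /c; ring.
have c0 : 0 <= c by rewrite /c -mulrNN -invrN divr_ge0// oppr_ge0 ltW.
have c1 : c = 1.
  by rewrite -[RHS]nv (eq_nrm vc) (nrmZ oD wphi c Lv') nv' mulr1 ger0_norm.
apply: (toL1_ae oD wphi Lv Lv'); apply: aeW => x Dx.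
by rewrite vc// c1 mul1r.
Qed.

(** The two normalizing factors cancel. At x = y the kernel may be infinite. *)
Lemma martin_kernelE x0 x y : D x0 -> D x -> D y -> x != y ->
  martin_kernel D x0 x y = (w y x / w y x0)%:E.
Proof.
move=> Dx0 Dx Dy xy; rewrite /martin_kernel -[green D x y]fineK; last exact: (green_fin_num hD).
rewrite -EFinM; congr EFin; rewrite /ngreen.
have l0 := green_norm_gt0 n_gt0 hD hphi Dy.
by rewrite invfM invrK mulrACA mulVf ?mul1r// gt_eqF.
Qed.

Section evaluation.
Context {T : Type} (F : set_system T) {PF : ProperFilter F} (g : T -> E).
Hypothesis FD : F [set t | D (g t)].
Variable v : E -> R.
Hypothesis mv : martin_limit (D := D) (phi := phi) v.
Hypothesis Fv : Phi (g t) @[t --> F] --> toL1 oD wphi v.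

Let hv : harmonic D v. Proof. by case: mv. Qed.
Let Lv : L1_mem D phi v. Proof. by case: mv. Qed.
Let esc : escaping (D := D) (g @ F). Proof. exact: Phi_limit_escaping hv Lv Fv. Qed.

Lemma ngreen_cvg_local x (e : R) : D x -> 0 < e -> exists2 d, 0 < d &
  F [set t | forall x', eball x d x' -> `|w (g t) x' - v x'| <= e].
Proof.
move=> Dx e0; have [r [C [r0 C0 rD HC _]]] := eval_local Dx.
exists (r / 2); first by rewrite divr_gt0.
have eC : 0 < e / C by rewrite divr_gt0.
have Fe : F [set t | mdist (toL1 oD wphi v) (Phi (g t)) < e / C].
  by have /mdist_cvgP := Fv; apply.
have Fr : F [set t | ~ eball x r (g t)] := esc.2 _ (eball_compact x r) rD.
apply: filterS3 FD Fr Fe => t Dt tr te x' xx'.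
apply: (le_trans (HC (g t) v Dt tr hv Lv x' xx')).
rewrite (metric_sym (Phi (g t)) (toL1 oD wphi v)).
by rewrite mulrC -ler_pdivlMr//; exact: ltW.
Qed.

Lemma ngreen_cvg x : D x -> w (g t) x @[t --> F] --> v x.
Proof.
move=> Dx; apply/cvgrPdist_le => e e0; have [d d0 Fd] := ngreen_cvg_local Dx e0.
by apply: filterS Fd => t /(_ x (eball_center x (ltW d0))); rewrite distrC.
Qed.

Lemma martin_kernel_near x0 x : D x0 -> D x ->
  F [set t | martin_kernel D x0 x (g t) = (w (g t) x / w (g t) x0)%:E].
Proof.
move=> Dx0 Dx; have c1 : compact [set x] by exact: compact_set1.
have D1 : [set x] `<=` D by move=> z ->.
have Fx : F [set t | g t <> x] := esc.2 _ c1 D1.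
apply: filterS2 FD Fx => t Dt /eqP xt; apply: martin_kernelE => //.
by rewrite eq_sym.
Qed.

Lemma martin_kernel_cvg x0 x : D x0 -> D x ->
  martin_kernel D x0 x (g t) @[t --> F] --> (v x / v x0)%:E.
Proof.
move=> Dx0 Dx; have [_ _ _ v0] := mv.
have : (w (g t) x / w (g t) x0)%:E @[t --> F] --> (v x / v x0)%:E.
  apply: cvg_EFin; first by apply: nearW => t.
  apply: cvgM; first exact: ngreen_cvg.
  by apply: cvgV; [rewrite lt_eqF// v0|exact: ngreen_cvg].
apply: cvg_trans; apply: near_eq_cvg.
by apply: filterS (martin_kernel_near Dx0 Dx) => t /= ->.
Qed.

End evaluation.

Lemma no_accumulation_escaping (y_ : nat -> E) :
  no_accumulation D y_ <-> (forall j, D (y_ j)) /\ escaping (D := D) (y_ @ \oo).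
Proof.
split=> [[Dy nacc]|[Dy [_ esc]]]; split => //.
  split; first by exists 0%N => // j _; exact: Dy.
  move=> K cK KD; apply: (@filter_ultra _ \oo (y_ @^-1` (~` K))) => U UU FU.
  have [UK|//] := in_ultra_setVsetC (y_ @^-1` K) UU.
  have [z Kz yz] := compact_ultra_cvg cK UU UK.
  exfalso; apply: (nacc z (KD _ Kz)) => A B /FU UA /yz UB.
  by have [x [Ax Bx]] := filter_ex (filterI UA UB); exists x.
move=> z Dz cz; have [r r0 rD] := domain_eball hD Dz.
have [x [nx rx]] := cz _ _ (esc _ (eball_compact z r) rD) (nbhs_eball z r0).
exact: nx rx.
Qed.

End structure.

(** * Uniqueness of the Martin compactification *)

Section uniqueness.
Context {R : realType} {n : nat}.
Local Notation E := 'rV[R]_n.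
Hypothesis n_gt0 : (0 < n)%N.
Context {D : set E} (hD : greenian D) {phi : E -> R} (hphi : norming D phi).
Local Notation oD := (greenian_open hD).
Local Notation wphi := (norming_weight hphi).
Local Notation Phi := (Phi hD hphi).
Local Notation X := (L1_norming hD hphi).
Context {x0 : E} (Dx0 : D x0) {M : metricType R} {i : E -> M}.
Hypothesis hM : martin_compactification D x0 i.

Let hausM : hausdorff_space M. Proof. exact: metric_hausdorff. Qed.

Lemma embedding_cvg {T : Type} (F : set_system T) (g : T -> E) y : Filter F ->
  F [set t | D (g t)] -> D y -> g @ F --> y -> i (g t) @[t --> F] --> i y.
Proof.
move=> FF FD Dy gy; have [_ [/subspace_continuousP ci _ _] _ _] := hM.
move=> B /(ci y Dy) By; have Fg : F [set t | D (g t) -> B (i (g t))] by exact: (gy _ By).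
have : F [set t | B (i (g t))] by apply: filterS2 FD Fg => t Dt; apply.
exact.
Qed.

Lemma embedding_cvg_inv {T : Type} (F : set_system T) (g : T -> E) y : Filter F ->
  F [set t | D (g t)] -> D y -> i (g t) @[t --> F] --> i y -> g @ F --> y.
Proof.
move=> FF FD Dy iy N Ny; have [_ [_ inj oi] _ _] := hM.
have oND : open (N^° `&` D) by apply: openI; [exact: open_interior|exact: oD].
have iND : nbhs (i y) (i @` (N^° `&` D)).
  apply: open_nbhs_nbhs; split; first by apply: oi => // x [].
  by exists y.
have Fi : F [set t | (i @` (N^° `&` D)) (i (g t))] by exact: (iy _ iND).
suff : F [set t | N (g t)] by exact.
apply: filterS2 FD Fi => t Dt [z [Nz Dz] zt].
rewrite /=; rewrite -(inj z (g t) (mem_set Dz) (mem_set Dt) zt); exact: interior_subset.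
Qed.

Lemma embedding_escaping {T : Type} (F : set_system T) (g : T -> E) zeta : Filter F ->
  F [set t | D (g t)] -> ~ (i @` D) zeta -> i (g t) @[t --> F] --> zeta -> escaping (D := D) (g @ F).
Proof.
move=> FF FD nz iz; split => // K cK KD.
apply: (@filter_ultra _ F (g @^-1` (~` K))) => U UU FU.
have [UK|//] := in_ultra_setVsetC (g @^-1` K) UU.
have [z Kz gz] := compact_ultra_cvg cK UU UK.
exfalso; apply: nz; exists z; first exact: KD.
have Ui : i (g t) @[t --> U] --> zeta by move=> B /iz /FU.
exact: (cvg_unique hausM (embedding_cvg _ (FU _ FD) (KD _ Kz) gz) Ui).
Qed.

Lemma escaping_boundary {T : Type} (F : set_system T) (g : T -> E) zeta : ProperFilter F ->
  escaping (D := D) (g @ F) -> i (g t) @[t --> F] --> zeta -> ~ (i @` D) zeta.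
Proof.
move=> PF [FD esc] iz [y Dy yz]; rewrite -yz in iz.
have gy : g @ F --> y by exact: embedding_cvg_inv.
have [r r0 rD] := domain_eball hD Dy.
have F1 : F [set t | ~ eball y r (g t)] := esc _ (eball_compact y r) rD.
have F2 : F [set t | eball y r (g t)] by exact: (gy _ (nbhs_eball y r0)).
by have [t [h1 h2]] := filter_ex (filterI F1 F2).
Qed.

(** The link between an arbitrary compactification and Phi: along [U] the kernel tends to [K x zeta]
    by continuity at the boundary point and to v x / v x0 by convergence of quotients. So v
    determines zeta by separation, and zeta determines the class of v by [martin_ratio_inj]. *)
Lemma boundary_kernel : exists K : E -> M -> \bar R,
  (forall zeta zeta', ~ (i @` D) zeta -> ~ (i @` D) zeta' ->
     (forall x, D x -> K x zeta = K x zeta') -> zeta = zeta') /\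
  (forall T (U : set_system T) (g : T -> E) v zeta, UltraFilter U -> escaping (D := D) (g @ U) ->
     martin_limit (D := D) (phi := phi) v -> Phi (g t) @[t --> U] --> toL1 oD wphi v ->
     i (g t) @[t --> U] --> zeta -> forall x, D x -> K x zeta = (v x / v x0)%:E).
Proof.
have [_ _ _ [K [Ki Kc Ksep _]]] := hM; exists K; split => // T U g v zeta UU esc mv Uv Ui x Dx.
have UD : U [set t | D (g t)] by case: esc.
have PU : ProperFilter U by exact: ultra_proper.
have nz := escaping_boundary PU esc Ui.
have c1 : martin_kernel D x0 x (g t) @[t --> U] --> (v x / v x0)%:E.
  exact: (martin_kernel_cvg n_gt0 UD mv Uv Dx0 Dx).
have [_ cK] := Kc x zeta Dx nz.
have c2 : K x (i (g t)) @[t --> U] --> K x zeta.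
  by move=> B /cK/Ui.
apply: (cvg_unique (@ereal_hausdorff R) c2); apply: cvg_trans c1.
by apply: near_eq_cvg; apply: filterS UD => t Dt; rewrite Ki.
Qed.

(** At a boundary limit, compactness of M gives a limit along each ultrafilter above [\oo]; K takes
    the same values at all of them, so they coincide. *)
Lemma Phi_cvg_embedding (y_ : nat -> E) : (forall j, D (y_ j)) ->
  forall p : X, Phi (y_ j) @[j --> \oo] --> p -> exists zeta : M, i (y_ j) @[j --> \oo] --> zeta.
Proof.
move=> Dy p py; have Fy : \oo [set j | D (y_ j)] by exists 0%N => // j _; exact: Dy.
have [[y Dy' pE]|[v mv pE]] := Phi_limit_cases n_gt0 Fy py.
  rewrite pE in py; exists (i y); apply: embedding_cvg => //.
  exact: (Phi_limit_interior n_gt0 Fy Dy' py).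
rewrite pE in py; have [K [Ksep HK]] := boundary_kernel.
have [hv Lv _ _] := mv.
have esc : escaping (D := D) (y_ @ \oo) by exact: (Phi_limit_escaping n_gt0 Fy hv Lv py).
have cM : compact [set: M] by case: hM.
have escU U : UltraFilter U -> \oo `<=` U -> escaping (D := D) (y_ @ U).
  by move=> UU FU; split=> [|A cA AD]; [exact: (FU _ Fy)|exact: (FU _ (esc.2 A cA AD))].
have [U0 [UU0 FU0]] := ultraFilterLemma (_ : ProperFilter \oo).
have [z0 _ yz0] := compact_ultra_cvg (f := i \o y_) cM UU0 filterT.
exists z0; apply: ultra_cvg => U UU FU.
have [z _ yz] := compact_ultra_cvg (f := i \o y_) cM UU filterT.
have e1 := escU U UU FU; have e0 := escU U0 UU0 FU0.
have p1 : Phi (y_ t) @[t --> U] --> toL1 oD wphi v by move=> B /py /FU.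
have p0 : Phi (y_ t) @[t --> U0] --> toL1 oD wphi v by move=> B /py /FU0.
rewrite (_ : z0 = z) //; apply: Ksep.
- exact: escaping_boundary _ e0 yz0.
- exact: escaping_boundary _ e1 yz.
by move=> x Dx; rewrite (HK _ _ _ _ _ UU0 e0 mv p0 yz0 x Dx) (HK _ _ _ _ _ UU e1 mv p1 yz x Dx).
Qed.

(** If zeta is a boundary point, every ultrafilter limit of Phi is the class of some v with v / v x0
    = K(., zeta), and these classes coincide. *)
Lemma embedding_cvg_Phi (y_ : nat -> E) : (forall j, D (y_ j)) ->
  forall zeta : M, i (y_ j) @[j --> \oo] --> zeta -> exists p : X, Phi (y_ j) @[j --> \oo] --> p.
Proof.
move=> Dy zeta yz; have Fy : \oo [set j | D (y_ j)] by exists 0%N => // j _; exact: Dy.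
have [[y Dy' zE]|nz] := pselect ((i @` D) zeta).
  rewrite -zE in yz; exists (Phi y); apply: (Phi_cvg n_gt0) => //.
  exact: embedding_cvg_inv yz.
have esc : escaping (D := D) (y_ @ \oo) by exact: (embedding_escaping _ Fy nz yz).
have [K [_ HK]] := boundary_kernel.
have escU U : UltraFilter U -> \oo `<=` U -> escaping (D := D) (y_ @ U).
  by move=> UU FU; split=> [|A cA AD]; [exact: (FU _ Fy)|exact: (FU _ (esc.2 A cA AD))].
have lim U : UltraFilter U -> \oo `<=` U -> exists v, [/\ martin_limit (D := D) (phi := phi) v,
    Phi (y_ t) @[t --> U] --> toL1 oD wphi v & forall x, D x -> K x zeta = (v x / v x0)%:E].
  move=> UU FU; have e := escU U UU FU.
  have [v mv Uv] := ultra_limit_exists n_gt0 hD hphi (ultra_fmap y_ UU) e.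
  exists v; split => //; apply: (HK _ U y_ v zeta UU e mv Uv).
  by move=> B /yz /FU.
have [U0 [UU0 FU0]] := ultraFilterLemma (_ : ProperFilter \oo).
have [v0 [mv0 Uv0 Kv0]] := lim U0 UU0 FU0.
exists (toL1 oD wphi v0); apply: ultra_cvg => U UU FU.
have [v [mv Uv Kv]] := lim U UU FU.
rewrite (_ : toL1 oD wphi v0 = toL1 oD wphi v)//.
apply: (martin_ratio_inj hD hphi Dx0 mv0 mv) => x Dx.
by have := Kv0 x Dx; rewrite Kv// => -[].
Qed.

Lemma martin_compactification_unique : exists h : X -> M,
  [/\ homeomorphism_on (Dtilde hD hphi) [set: M] h,
      forall y, D y -> h (Phi y) = i y
    & h @` partialM hD hphi = ~` (i @` D)].
Proof.
have D0 : D !=set0 by exists x0.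
have [h hh hseq] := dense_homeomorphism D0 Phi_cvg_embedding embedding_cvg_Phi.
have dense_i : closure (i @` D) = setT.
  have [_ _ di _] := hM; apply/seteqP; split => // z _ B.
  rewrite nbhsE => -[V [openV Vz] VB].
  have [q [Vq iq]] := di V (ex_intro _ z Vz) openV.
  by exists q; split => //; exact: VB.
exists h; split.
- by move: hh; rewrite dense_i.
- move=> y Dy; apply: (cvg_unique hausM (F := i y @[j --> \oo])).
    by apply: (hseq (fun=> y)) => //; exact: cvg_cst.
  exact: cvg_cst.
apply/seteqP; split => [_ [p [y_ nacc py] <-]|zeta nz].
  have [Dy esc] := (no_accumulation_escaping hD y_).1 nacc.
  exact: escaping_boundary _ esc (hseq y_ p Dy py).
have /closure_seqP[y_ Dy yz] : closure (i @` D) zeta by rewrite dense_i.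
have [p py] := embedding_cvg_Phi Dy yz.
have Fy : \oo [set j | D (y_ j)] by exists 0%N => // j _; exact: Dy.
exists p; last exact: (cvg_unique hausM (hseq y_ p Dy py) yz).
exists y_ => //; apply/(no_accumulation_escaping hD); split => //.
exact: embedding_escaping _ Fy nz yz.
Qed.

End uniqueness.

(** * Existence of the Martin compactification *)

Section metric_subspace.
Context {R : realType} {X : metricType R} (A : set X).

(** [martin_compactification] concerns a whole metric space, so the closure of Phi(D) is made a type
    with the induced distance. *)
Definition metric_sub : Type := {x : X | A x}.

HB.instance Definition _ := gen_eqMixin metric_sub.
HB.instance Definition _ := gen_choiceMixin metric_sub.

Let sub_dist (p q : metric_sub) : R := mdist (sval p) (sval q).

Let sub_distxx p : sub_dist p p = 0. Proof. exact: mdistxx. Qed.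

Let sub_dist_eq0 p q : sub_dist p q = 0 -> p = q.
Proof. by move=> /mdist_positivity; exact: eq_sig_hprop. Qed.

Let sub_distC p q : sub_dist p q = sub_dist q p. Proof. exact: metric_sym. Qed.

Let sub_dist_triangle q p r : sub_dist p r <= sub_dist p q + sub_dist q r.
Proof. exact: metric_triangle. Qed.

HB.instance Definition _ := isMetric.Build R metric_sub
  sub_distxx sub_dist_eq0 sub_distC sub_dist_triangle.

Lemma metric_subE (p q : metric_sub) : mdist p q = mdist (sval p) (sval q).
Proof. by []. Qed.

Lemma metric_sub_cvgP {T : Type} (F : set_system T) (f : T -> metric_sub) (p : metric_sub) : Filter F ->
  f @ F --> p <-> sval (f t) @[t --> F] --> sval p.
Proof. by move=> FF; rewrite !mdist_cvgP. Qed.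

Lemma metric_sub_compact : compact A -> compact [set: metric_sub].
Proof.
move=> cA; rewrite compact_ultra => U UU _.
have UA : U [set p | A (sval p)] by apply: filterE => p; exact: proj2_sig.
have [q Aq Uq] := compact_ultra_cvg (f := sval) cA UU UA.
exists (exist _ q Aq); split => //.
exact: (metric_sub_cvgP id (exist _ q Aq) _).2.
Qed.

End metric_subspace.

(** Uniform in a, of which only a bound is given: a will be v x for x in a ball, and b will be v
    x0. *)
Lemma ratio_continuous {R : realFieldType} (B b e : R) : b != 0 -> 0 < e ->
  exists2 eta, 0 < eta & forall a a' b', `|a| <= B -> `|a - a'| <= eta -> `|b - b'| <= eta ->
    `|a / b - a' / b'| < e.
Proof.
move=> b0 e0; have nb0 : 0 < `|b| by rewrite normr_gt0.
have B1 : 0 < `|B| + `|b| by rewrite ltr_wpDl.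
(* The bound |b| / 2 keeps |b'| >= |b| / 2; the error is then at most eta (|B| + |b|) / (|b|^2 / 2)
   <= e / 2. *)
have eta0 : 0 < Num.min (`|b| / 2) (e * `|b| ^+ 2 / (4 * (`|B| + `|b|))).
  by rewrite lt_min !divr_gt0 ?mulr_gt0 ?exprn_gt0.
set eta := Num.min _ _ in eta0 *.
have [eta1 eta2] : eta <= `|b| / 2 /\ eta <= e * `|b| ^+ 2 / (4 * (`|B| + `|b|)).
  by rewrite !ge_min !lexx orbT.
clearbody eta; exists eta => // a a' b' aB aa bb.
have bb' : `|b| / 2 <= `|b'|.
  by have := ler_normD (b - b') b'; rewrite subrK => h; lra.
have nb' : 0 < `|b'| by apply: lt_le_trans bb'; rewrite divr_gt0.
have b'0 : b' != 0 by rewrite -normr_gt0.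
rewrite (_ : a / b - a' / b' = (a * (b' - b) + b * (a - a')) / (b * b')); last first.
  by field; rewrite ?b0 ?b'0.
rewrite normrM normfV ltr_pdivrMr ?normrM ?mulr_gt0//.
apply: (@le_lt_trans _ _ (eta * (`|B| + `|b|))).
  apply: le_trans (ler_normD _ _) _; rewrite !normrM (mulrDr eta) (mulrC `|b|).
  apply: lerD; last by apply: ler_pM.
  by rewrite mulrC distrC; apply: ler_pM => //; exact: le_trans aB (ler_norm _).
move: eta2; rewrite ler_pdivlMr ?mulr_gt0// => eta2.
have h3 : `|b| * (`|b| / 2) <= `|b| * `|b'| by rewrite ler_wpM2l.
have h4 : 0 < e * `|b| ^+ 2 by rewrite mulr_gt0// exprn_gt0.
have h5 : e * (`|b| * (`|b| / 2)) <= e * (`|b| * `|b'|) by rewrite ler_wpM2l// ltW.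
apply: lt_le_trans h5; rewrite expr2 in eta2 h4; lra.
Qed.

Section existence.
Context {R : realType} {n : nat}.
Local Notation E := 'rV[R]_n.
Hypothesis n_gt0 : (0 < n)%N.
Context {D : set E} (hD : greenian D) {phi : E -> R} (hphi : norming D phi).
Local Notation oD := (greenian_open hD).
Local Notation wphi := (norming_weight hphi).
Local Notation Phi := (Phi hD hphi).
Local Notation w := (ngreen D phi).
Local Notation M := (metric_sub (Dtilde hD hphi)).
Local Notation martin_limit := (martin_limit (D := D) (phi := phi)).
Context {x0 : E} (Dx0 : D x0).

Lemma Phi_sub_exists : exists i : E -> M, forall y, D y -> sval (i y) = Phi y.
Proof.
have /choice[i Hi] : forall y, exists z : M, D y -> sval z = Phi y.
  move=> y; have [Dy|nDy] := pselect (D y).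
    by exists (exist _ (Phi y) (@Phi_Dtilde _ _ _ hD _ hphi y Dy)) => _.
  exists (exist _ (Phi x0) (@Phi_Dtilde _ _ _ hD _ hphi x0 Dx0)) => Dy.
  exact: (False_ind _ (nDy Dy)).
by exists i; exact: Hi.
Qed.

Variable i : E -> M.
Hypothesis Phi_subE : forall y, D y -> sval (i y) = Phi y.

Lemma Dtilde_cases (zeta : M) : (exists2 y, D y & zeta = i y) \/
  (exists2 v, martin_limit v & sval zeta = toL1 oD wphi v).
Proof.
have [y_ Dy yz] := closure_seqP (proj2_sig zeta).
have Fy : \oo [set j | D (y_ j)] by exists 0%N => // j _; exact: Dy.
have [[y Dy' zE]|] := Phi_limit_cases n_gt0 Fy yz; last by right.
by left; exists y => //; apply: eq_sig_hprop => //; rewrite Phi_subE.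
Qed.

Lemma Phi_sub_boundary (zeta : M) v : martin_limit v -> sval zeta = toL1 oD wphi v -> ~ (i @` D) zeta.
Proof.
move=> [hv Lv _ _] zv [y Dy yz].
by apply: (Phi_neq_harmonic n_gt0 Dy hv Lv); rewrite -zv -yz Phi_subE.
Qed.

Lemma Phi_sub_inj : set_inj D i.
Proof.
move=> y y' /set_mem Dy /set_mem Dy' yy; apply: (@Phi_inj _ _ n_gt0 _ hD _ hphi _ _ Dy Dy').
exact: (etrans (esym (Phi_subE Dy)) (etrans (congr1 sval yy) (Phi_subE Dy'))).
Qed.

Lemma Phi_sub_continuous : {within D, continuous i}.
Proof.
apply/subspace_continuousP => y Dy; apply/metric_sub_cvgP; rewrite Phi_subE//.
have : Phi t @[t --> within D (nbhs y)] --> Phi y.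
  by apply: (@Phi_cvg _ _ n_gt0 _ hD _ hphi _ (within D (nbhs y)) id) => //; exact: cvg_within.
apply: cvg_trans; apply: near_eq_cvg.
by apply: filterS (withinT D (nbhs_filter y)) => z Dz; rewrite Phi_subE.
Qed.

(** If the image were not a neighbourhood of [i y], points [y_ j] off a ball about y would have Phi
    (y_ j) tending to Phi y, against [Phi_limit_interior]. A boundary point close to Phi y is first
    replaced by some Phi (z_ k) close to it, with [z_ k] outside the ball because the sequence
    escapes. *)
Lemma Phi_sub_open (U : set E) : open U -> U `<=` D -> open (i @` U).
Proof.
move=> oU UD; rewrite openE => _ [y Uy <-]; have Dy := UD _ Uy.
have : nbhs y U by exact: open_nbhs_nbhs.
move=> /nbhs_eballP[r r0 rU].
apply: contrapT => nU.
have /choice[y_ Hy] : forall j : nat, exists y', [/\ D y', ~ eball y r y' & mdist (Phi y) (Phi y') < j.+1%:R^-1].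
  move=> j; apply: contrapT => H; apply: nU.
  have j0 : 0 < j.+1%:R^-1 :> R by rewrite invr_gt0.
  apply: (filterS _ (nbhsx_ballx (i y) _ j0)) => zeta; rewrite ballEmdist /= metric_subE Phi_subE// => yz.
  have [[y' Dy' zE]|[v mv zv]] := Dtilde_cases zeta.
    exists y' => //; apply: rU; apply: contrapT => yr; apply: H; exists y'; split => //.
    by rewrite -(Phi_subE Dy') -zE.
  exfalso; apply: H.
  have [z_ Dz zz] := closure_seqP (proj2_sig zeta).
  have Fz : \oo [set k | D (z_ k)] by exists 0%N => // k _; exact: Dz.
  have [hv Lv _ _] := mv.
  have esc : escaping (D := D) (z_ @ \oo).
    by apply: (Phi_limit_escaping n_gt0 Fz hv Lv); rewrite -zv.
  have h1 : \oo [set k | ~ eball y r (z_ k)].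
    by apply: (esc.2 _ (eball_compact y r)); exact: subset_trans UD.
  have d0 : 0 < j.+1%:R^-1 - mdist (Phi y) (sval zeta) by rewrite subr_gt0.
  have h2 : \oo [set k | mdist (sval zeta) (Phi (z_ k)) < j.+1%:R^-1 - mdist (Phi y) (sval zeta)].
    by have /mdist_cvgP := zz; apply.
  have [k [k1 k2]] := filter_ex (filterI h1 h2).
  exists (z_ k); split => //.
  by rewrite (le_lt_trans (metric_triangle _ (sval zeta) _))// addrC -ltrBrDr.
have Fy : \oo [set j | D (y_ j)] by exists 0%N => // j _; case: (Hy j).
have yy : y_ @ \oo --> y.
  have Py : Phi (y_ j) @[j --> \oo] --> Phi y by apply: cvg_mdist_seq => j; case: (Hy j).
  exact: (Phi_limit_interior n_gt0 Fy Dy Py).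
have h1 : \oo [set j | eball y r (y_ j)] by exact: (yy _ (nbhs_eball y r0)).
by have [j jr] := filter_ex h1; have [_ + _] := Hy j; apply.
Qed.

Lemma Phi_sub_dense : dense (i @` D).
Proof.
move=> V [zeta Vz] openV.
have : nbhs zeta V by exact: open_nbhs_nbhs.
move=> /nbhs_ballP[e /= e0 eV].
have [_ [y Dy <-] zy] := (closure_mdistP _ _).1 (proj2_sig zeta) e e0.
exists (i y); split; last by exists y.
by apply: eV; rewrite ballEmdist /= metric_subE Phi_subE.
Qed.

(** Keeps poles away: interior points near a boundary point come from poles outside [K0]. *)
Lemma avoid_compact (K0 : set E) (zeta : M) : compact K0 -> K0 `<=` D -> ~ (i @` D) zeta ->
  nbhs zeta (~` (i @` K0)).
Proof.
move=> cK KD nz; have ciK : compact (i @` K0).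
  by apply: continuous_compact cK; exact: continuous_subspaceW Phi_sub_continuous.
have oiK : open (~` (i @` K0)).
  apply: closed_openC; apply: (compact_closed _ ciK); exact: (@metric_hausdorff R M).
apply: open_nbhs_nbhs; split => // -[y Ky yz]; apply: nz; exists y => //; exact: KD.
Qed.

(** [m zeta] is a function in the class zeta: [w y] at an interior point, otherwise the harmonic
    representative, unique on D. The cases exclude each other because no Phi y is the class of a
    harmonic function. *)
Lemma evaluation_exists : exists m : M -> E -> R,
  (forall y, D y -> m (i y) = w y) /\
  (forall zeta v, martin_limit v -> sval zeta = toL1 oD wphi v -> forall x, D x -> m zeta x = v x).
Proof.
have /choice[m Hm] : forall zeta : M, exists u : E -> R,
    (forall y, D y -> zeta = i y -> u = w y) /\
    (forall v, martin_limit v -> sval zeta = toL1 oD wphi v -> forall x, D x -> u x = v x).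
  move=> zeta; have [[y Dy zE]|[v mv zv]] := Dtilde_cases zeta.
    exists (w y); split=> [y' Dy' zE'|v mv zv].
      by congr w; apply: (Phi_sub_inj (mem_set Dy) (mem_set Dy')); rewrite -zE.
    by exfalso; apply: (Phi_sub_boundary mv zv); exists y.
  exists v; split=> [y Dy zE|v' mv' zv'].
    by exfalso; apply: (Phi_sub_boundary mv zv); exists y.
  have [hv Lv _ _] := mv; have [hv' Lv' _ _] := mv'.
  have vv := etrans (esym zv) zv'.
  by move=> x Dx; exact: (toL1_harmonic_inj n_gt0 hv Lv hv' Lv' vv Dx).
exists m; split=> [y Dy|zeta v mv zv x Dx]; first exact: (Hm (i y)).1 y Dy erefl.
exact: (Hm zeta).2 v mv zv x Dx.
Qed.

Section kernel.
Variable m : M -> E -> R.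
Hypothesis m_interior : forall y, D y -> m (i y) = w y.
Hypothesis m_boundary : forall zeta v, martin_limit v -> sval zeta = toL1 oD wphi v ->
  forall x, D x -> m zeta x = v x.

Lemma evaluation_continuous (zeta : M) x : D x -> ~ (i @` D) zeta -> {for zeta, continuous (m^~ x)}.
Proof.
move=> Dx nz; have [[y Dy zE]|[v mv zv]] := Dtilde_cases zeta.
  by exfalso; apply: nz; exists y.
have [hv Lv _ _] := mv.
have [r [C [r0 C0 rD HC HC']]] := eval_local n_gt0 hD hphi Dx.
have xr : eball x (r / 2) x by apply: eball_center; rewrite divr_ge0// ltW.
apply/(@cvgrPdist_le _ _ _ (nbhs zeta) (nbhs_filter zeta)) => e e0.
have eC : 0 < e / C by rewrite divr_gt0.
have key (q : M) (t : R) : mdist zeta q < e / C -> `|t - v x| <= C * mdist (sval q) (toL1 oD wphi v) ->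
    `|v x - t| <= e.
  rewrite metric_subE -zv (metric_sym (sval q) (sval zeta)) distrC => zq /le_trans; apply.
  by rewrite mulrC -ler_pdivlMr//; exact: ltW.
have N1 := avoid_compact (eball_compact x r) rD nz.
have N2 : nbhs zeta (ball zeta (e / C)) by exact: nbhsx_ballx.
suff : nbhs zeta [set q | `|m zeta x - m q x| <= e] by exact.
apply: (@filterS2 _ _ (nbhs_filter zeta) _ _ _ _ N1 N2) => q nq /=.
rewrite ballEmdist /= (m_boundary mv zv Dx) => zq.
have [[y Dy qE]|[v' mv' qv']] := Dtilde_cases q.
  rewrite qE m_interior//; apply: (key q) => //.
  have := HC y v Dy _ hv Lv x xr; rewrite qE (Phi_subE Dy); apply => yr.
  by apply: nq; exists y.
rewrite (m_boundary mv' qv' Dx); apply: (key q) => //.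
have [hv' Lv' _ _] := mv'.
by have := HC' v' v hv' Lv' hv Lv x xr; rewrite qv'.
Qed.

(** On i(D) the kernel must be [martin_kernel] with its possibly infinite values at the poles, so
    the quotient of values of [m] is used only at boundary points. *)
Lemma kernel_exists : exists K : E -> M -> \bar R,
  (forall x y, D y -> K x (i y) = martin_kernel D x0 x y) /\
  (forall x zeta, ~ (i @` D) zeta -> K x zeta = (m zeta x / m zeta x0)%:E).
Proof.
have /choice[k Hk] : forall zeta : M, exists k : E -> \bar R,
    (forall y, D y -> zeta = i y -> k = fun x => martin_kernel D x0 x y) /\
    (~ (i @` D) zeta -> k = fun x => (m zeta x / m zeta x0)%:E).
  move=> zeta; have [[y Dy yz]|nz] := pselect ((i @` D) zeta).
    exists (fun x => martin_kernel D x0 x y); split=> [y' Dy' zE|[]]; last by exists y.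
    by rewrite (Phi_sub_inj (mem_set Dy) (mem_set Dy') (etrans yz zE)).
  exists (fun x => (m zeta x / m zeta x0)%:E); split=> // y Dy zE.
  by exfalso; apply: nz; exists y.
exists (fun x zeta => k zeta x); split=> [x y Dy|x zeta nz].
  by rewrite ((Hk (i y)).1 y Dy erefl).
by rewrite ((Hk zeta).2 nz).
Qed.

Variable K : E -> M -> \bar R.
Hypothesis K_interior : forall x y, D y -> K x (i y) = martin_kernel D x0 x y.
Hypothesis K_boundary : forall x zeta, ~ (i @` D) zeta -> K x zeta = (m zeta x / m zeta x0)%:E.

Lemma K_martin_limit x (zeta : M) v : D x -> martin_limit v -> sval zeta = toL1 oD wphi v ->
  K x zeta = (v x / v x0)%:E.
Proof.
move=> Dx mv zv; rewrite K_boundary; last exact: Phi_sub_boundary mv zv.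
by rewrite (m_boundary mv zv Dx) (m_boundary mv zv Dx0).
Qed.

Lemma kernel_continuous x (zeta : M) : D x -> ~ (i @` D) zeta -> {for zeta, continuous (K x)}.
Proof.
move=> Dx nz; have [[y Dy zE]|[v mv zv]] := Dtilde_cases zeta.
  by exfalso; apply: nz; exists y.
have [_ _ _ v0] := mv.
have c1 : compact [set x] by exact: compact_set1.
have D1 : [set x] `<=` D by move=> z ->.
have FZ : Filter (nbhs zeta) := nbhs_filter zeta.
suff : K x q @[q --> nbhs zeta] --> (m zeta x / m zeta x0)%:E.
  by rewrite -(K_boundary x nz); exact.
have : (m q x / m q x0)%:E @[q --> nbhs zeta] --> (m zeta x / m zeta x0)%:E.
  apply: cvg_EFin; first by apply: nearW.
  apply: cvgM; first exact: evaluation_continuous.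
  apply: cvgV; last exact: evaluation_continuous.
  by rewrite (m_boundary mv zv Dx0) lt_eqF// v0.
apply: cvg_trans; apply: near_eq_cvg.
have N1 := avoid_compact c1 D1 nz.
apply: (@filterS _ _ FZ _ _ _ N1) => q nq.
have [[y Dy qE]|[v' mv' qv']] := Dtilde_cases q; last first.
  by rewrite K_boundary//; exact: Phi_sub_boundary mv' qv'.
rewrite qE K_interior// m_interior// (martin_kernelE n_gt0 hD hphi)//.
by apply/eqP => xy; apply: nq; exists y.
Qed.

Lemma kernel_ge0 x (zeta : M) : D x -> ~ (i @` D) zeta -> (0 <= K x zeta)%E.
Proof.
move=> Dx nz; have [[y Dy zE]|[v mv zv]] := Dtilde_cases zeta.
  by exfalso; apply: nz; exists y.
have [_ _ _ v0] := mv; rewrite (K_martin_limit Dx mv zv) lee_fin.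
by rewrite -mulrNN -invrN divr_ge0// oppr_ge0 ltW// v0.
Qed.

Lemma kernel_separates (zeta zeta' : M) : ~ (i @` D) zeta -> ~ (i @` D) zeta' ->
  (forall x, D x -> K x zeta = K x zeta') -> zeta = zeta'.
Proof.
move=> nz nz' KK; have [[y Dy zE]|[v mv zv]] := Dtilde_cases zeta.
  by exfalso; apply: nz; exists y.
have [[y Dy zE]|[v' mv' zv']] := Dtilde_cases zeta'.
  by exfalso; apply: nz'; exists y.
apply: eq_sig_hprop => //; rewrite zv zv'.
apply: (martin_ratio_inj hD hphi Dx0 mv mv') => x Dx.
by have := KK x Dx; rewrite (K_martin_limit Dx mv zv) (K_martin_limit Dx mv' zv') => -[].
Qed.

(** Along an ultrafilter above [\oo], Phi (y_ j) tends to the class of some v, a point of the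
    closure; convergence at single points already identifies k with v / v x0 on D. *)
Lemma martin_function_boundary (k : E -> R) : martin_function D x0 k ->
  exists2 zeta, ~ (i @` D) zeta & forall x, D x -> K x zeta = (k x)%:E.
Proof.
move=> [y_ nacc uk]; have [Dy esc] := (no_accumulation_escaping hD y_).1 nacc.
have [U [UU FU]] := ultraFilterLemma (_ : ProperFilter \oo).
have escU : escaping (D := D) (y_ @ U) by split=> [|A cA AD]; [exact: (FU _ esc.1)|exact: (FU _ (esc.2 A cA AD))].
have [v mv Uv] := ultra_limit_exists n_gt0 hD hphi (ultra_fmap y_ UU) escU.
have clv : Dtilde hD hphi (toL1 oD wphi v).
  apply/closure_mdistP => e e0.
  have Ue : U [set t | mdist (toL1 oD wphi v) (Phi (y_ t)) < e] by have /mdist_cvgP := Uv; apply.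
  have PU : ProperFilter U by exact: ultra_proper.
  by have [j Hj] := filter_ex Ue; exists (Phi (y_ j)) => //; exists (y_ j).
have zv : sval (exist _ _ clv : M) = toL1 oD wphi v by exact: erefl.
exists (exist _ _ clv); first exact: Phi_sub_boundary mv zv.
move=> x Dx; rewrite (K_martin_limit Dx mv zv).
have PU : ProperFilter U by exact: ultra_proper.
have UD : U [set t | D (y_ t)] by exact: escU.1.
have c1 : martin_kernel D x0 x (y_ t) @[t --> U] --> (v x / v x0)%:E.
  exact: (martin_kernel_cvg n_gt0 UD mv Uv Dx0 Dx).
have cx : compact [set x] by exact: compact_set1.
have D1 : [set x] `<=` D by move=> z ->.
have := uk [set x] cx D1; rewrite uniform_set1 => c2.
have c2' : fine (martin_kernel D x0 x (y_ t)) @[t --> U] --> k x by move=> B /c2 /FU.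
have c1' : fine (martin_kernel D x0 x (y_ t)) @[t --> U] --> v x / v x0 by exact: (fine_cvg c1).
by rewrite (cvg_unique (@Rhausdorff R) c1' c2').
Qed.

(** A sequence with Phi (y_ j) tending to zeta escapes, and [w (y_ j)] tends to v uniformly near
    each point of D; [ratio_continuous] carries this over to the quotients, compactness to all of
    [A]. *)
Lemma boundary_martin_function (k : E -> R) (zeta : M) : ~ (i @` D) zeta ->
  (forall x, D x -> K x zeta = (k x)%:E) -> martin_function D x0 k.
Proof.
move=> nz Kk; have [[y Dy zE]|[v mv zv]] := Dtilde_cases zeta.
  by exfalso; apply: nz; exists y.
have [hv Lv _ v0] := mv.
have [y_ Dy yz] := closure_seqP (proj2_sig zeta).
have Fy : \oo [set j | D (y_ j)] by exists 0%N => // j _; exact: Dy.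
have yv : Phi (y_ j) @[j --> \oo] --> toL1 oD wphi v by rewrite -zv.
have esc : escaping (D := D) (y_ @ \oo) by exact: (Phi_limit_escaping n_gt0 Fy hv Lv yv).
have kE x : D x -> k x = v x / v x0.
  by move=> Dx; have := Kk x Dx; rewrite (K_martin_limit Dx mv zv) => -[].
exists y_; first exact/(no_accumulation_escaping hD).
move=> A cA AD V; rewrite uniform_nbhs => -[Q [/= entQ QV]].
have [e /= e0 eQ] := entQ.
have H : \forall j \near \oo, forall x, A x -> `|k x - fine (martin_kernel D x0 x (y_ j))| < e.
  have /compact_near_coveringP cA' := cA.
  apply: (cA' nat \oo (fun j x => `|k x - fine (martin_kernel D x0 x (y_ j))| < e)) => x Ax.
  have Dx := AD _ Ax.
  have [r r0 rD] := domain_eball hD Dx.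
  have cv z : eball x r z -> {for z, continuous v}.
    by move=> /rD Dz; exact: harmonic_continuous hv Dz.
  have [B B0 HB] := compact_bounded_continuous (eball_compact x r) cv.
  have vx0 : v x0 != 0 by rewrite lt_eqF// v0.
  have [eta eta0 Heta] := ratio_continuous B vx0 e0.
  have [d d0 Hd] := ngreen_cvg_local n_gt0 Fy mv yv Dx eta0.
  have [d' d'0 Hd'] := ngreen_cvg_local n_gt0 Fy mv yv Dx0 eta0.
  have Hr : \oo [set j | ~ eball x r (y_ j)] := esc.2 _ (eball_compact x r) rD.
  exists (eball x (Num.min d r), [set j | forall x', eball x (Num.min d r) x' ->
      `|k x' - fine (martin_kernel D x0 x' (y_ j))| < e]); last first.
    by move=> [x' j] /= [xx' H]; exact: H.
  split => /=; first by apply: nbhs_eball; rewrite lt_min d0.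
  apply: filterS3 Hd Hd' Hr => j jd jd' jr x' xx'.
  have xd : eball x d x' by apply: le_eball xx'; rewrite ge_min lexx.
  have xr : eball x r x' by apply: le_eball xx'; rewrite ge_min lexx orbT.
  have Dx' := rD _ xr.
  have x'y : x' != y_ j by apply/eqP => xy; apply: jr; rewrite -xy.
  rewrite (martin_kernelE n_gt0 hD hphi Dx0 Dx' (Dy j) x'y) kE//=.
  apply: Heta; first exact: HB.
    by rewrite distrC; exact: jd.
  by rewrite distrC; apply: jd'; exact: eball_center (ltW d'0).
suff : \oo [set j | V (fun x => fine (martin_kernel D x0 x (y_ j)))] by exact.
by apply: filterS H => j Hj; apply: QV => x Ax; apply: eQ; exact: Hj.
Qed.

End kernel.

Lemma Phi_sub_martin : martin_compactification D x0 i.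
Proof.
have [m [mi mb]] := evaluation_exists.
have [K [Ki Kb]] := kernel_exists m.
split.
- exact: metric_sub_compact (@Dtilde_compact _ _ n_gt0 _ hD _ hphi).
- split; [exact: Phi_sub_continuous|exact: Phi_sub_inj|exact: Phi_sub_open].
- exact: Phi_sub_dense.
exists K; split.
- by move=> x y _ Dy; exact: Ki.
- move=> x zeta Dx nz; split; first exact: (kernel_ge0 mb Kb Dx nz).
  exact: (kernel_continuous mi mb Ki Kb Dx nz).
- by move=> zeta zeta' nz nz' KK; exact: (kernel_separates mb Kb nz nz' KK).
- move=> k; split; first exact: (martin_function_boundary mb Kb).
  by move=> [zeta nz Kk]; exact: (boundary_martin_function mb Kb nz Kk).
Qed.

End existence.

(** The first conjunct keeps the second from being vacuous; its witness is the closure of Phi(D)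
    itself, embedded by Phi. *)
Theorem mainTheorem7 (R : realType) (n : nat) (n_gt0 : (0 < n)%N)
    (D : set 'rV[R]_n) (hD : greenian D)
    (phi : 'rV[R]_n -> R) (hphi : norming D phi)
    (x0 : 'rV[R]_n) (Dx0 : D x0) :
  (exists (M : metricType R) (i : 'rV[R]_n -> M),
     martin_compactification D x0 i) /\
  (forall (M : metricType R) (i : 'rV[R]_n -> M),
     martin_compactification D x0 i ->
     exists h : L1_norming hD hphi -> M,
       [/\ homeomorphism_on (Dtilde hD hphi) [set: M] h,
           forall y, D y -> h (Phi hD hphi y) = i y
         & h @` partialM hD hphi = ~` (i @` D)]).
Proof.
split=> [|M i hM]; last exact: (martin_compactification_unique n_gt0 hD hphi Dx0 hM).
have [i iE] := Phi_sub_exists hD hphi Dx0.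
exists (metric_sub (Dtilde hD hphi)), i; exact: (Phi_sub_martin n_gt0 Dx0 iE).
Qed.
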